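(* Let $M$ be a complex manifold of dimension $m$ and let $\mathcal{A}$ be a sheaf of $\mathbb{C}$-algebras over $M$. Suppose that there exist a natural number $n$ and a morphism of sheaves of $\mathbb{C}$-algebras $\pi\colon \mathcal{A}\to\mathcal{O}_M$ such that for each $x\in M$ there exist an open neighbourhood $U$ of $x$ in $M$ and an isomorphism of sheaves of $\mathbb{C}$-algebras $\alpha\colon \mathcal{A}|_U \to \iota_U^{-1}\mathcal{O}_{U\times\mathbb{C}^n}$, where $\iota_U\colon U\hookrightarrow U\times\mathbb{C}^n$ is the embedding $y\mapsto (y,0)$, such that $\iota_U^\#\circ\alpha = \pi|_U$, where $\iota_U^\#\colon \iota_U^{-1}\mathcal{O}_{U\times\mathbb{C}^n}\to\mathcal{O}_U$ is the canonical morphism (restriction of functions) induced by $\iota_U$. Then: (i) There exist a complex manifold $M'$ of dimension $m+n$ and a closed embedding $\iota\colon M\to M'$ such that there is an isomorphism $\mathcal{A}\cong\iota^{-1}\mathcal{O}_{M'}$ of sheaves of $\mathbb{C}$-algebras which commutes with the morphisms $\pi\colon\mathcal{A}\to\mathcal{O}_M$ and $\iota^\#\colon\iota^{-1}\mathcal{O}_{M'}\to\mathcal{O}_M$. (ii) The manifold-germ $M'$ is unique up to unique isomorphism in the following sense. If $M_1'$, $M_2'$ are two complex manifolds, $\iota_1\colon M\to M_1'$ and $\iota_2\colon M\to M_2'$ are two closed embeddings, and $\phi\colon\iota_1^{-1}\mathcal{O}_{M_1'}\to\iota_2^{-1}\mathcal{O}_{M_2'}$ is an isomorphism of sheaves of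 $\mathbb{C}$-algebras commuting with the canonical surjections to $\mathcal{O}_M$, then $\phi$ is induced (by pull-back of functions) by a biholomorphic map $\varphi\colon N_2\to N_1$ between open neighbourhoods $N_i$ of $M$ in $M_i'$, $i\in\{1,2\}$, such that $\varphi$ is the identity map on $M$ (that is, $\varphi\circ\iota_2=\iota_1$). Such a map $\varphi$ is unique as a germ of maps on a neighbourhood of $M$.
   Context: Manifolds are required to be paracompact (and Hausdorff). $\mathcal{O}_X$ denotes the sheaf of holomorphic functions on a complex manifold $X$. For a closed embedding $\iota\colon M\to M'$ of complex manifolds, $\iota^{-1}$ denotes the topological inverse image of sheaves, and $\iota^\#\colon\iota^{-1}\mathcal{O}_{M'}\to\mathcal{O}_M$ is the canonical surjection given by restricting functions to $M$. $M$ is identified with its image in $M'$. ''Unique as a germ'' means that any two such maps agree on some common open neighbourhood of $M$. *)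

(* Defs.v *)
From HB Require Import structures.
From mathcomp Require Import all_boot all_order all_algebra.
From mathcomp Require Import complex.
From mathcomp Require Import all_classical all_reals all_analysis.
Set Implicit Arguments. Unset Strict Implicit. Unset Printing Implicit Defensive.
Import Order.TTheory GRing.Theory Num.Theory.
Import numFieldNormedType.Exports.
Local Open Scope quotient_scope.
Local Open Scope classical_set_scope.
Local Open Scope ring_scope.

(* Giving R[i] the type numFieldType selects the topology and the normed      *)
(* module structures that the library attaches to every numFieldType.         *)
Definition complex_field (R : realType) : numFieldType := R[i].

(* A unital associative C-algebra: a ring with a ring morphism from C to its  *)
(* centre. The library's algType is not usable here, as it excludes the zero  *)
(* ring, which is the ring of sections over the empty set.                    *)
Record calg (R : realType) := CAlg {
  calg_ring :> pzRingType;
  scal : {rmorphism complex_field R -> calg_ring};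
  scal_central : forall a x, scal a * x = x * scal a
}.

Definition complex_calg (R : realType) : calg R :=
  @CAlg R (complex_field R) idfun (fun a x => mulrC a x).

Record opens (X : topologicalType) := Opens {
  opens_set :> set X;
  opens_open : open opens_set
}.

Definition opens_pred (X : topologicalType) (U : opens X) : X -> Prop :=
  opens_set U.
Coercion opens_pred : opens >-> Funclass.

Definition opensI (X : topologicalType) (U V : opens X) : opens X :=
  Opens (openI (opens_open U) (opens_open V)).

Lemma opensI_mem (X : topologicalType) (U V : opens X) x :
  U x -> V x -> opensI U V x.
Proof. by []. Qed.

Definition opensT (X : topologicalType) : opens X := Opens (@openT X).

(* A sheaf of C-algebras. In the gluing axiom, agreement on the intersection  *)
(* is expressed on every open subset W of it.                                 *)
Record sheaf (R : realType) (X : topologicalType) := Sheaf {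
  sect :> opens X -> calg R;
  res : forall U V : opens X, V `<=` U -> {rmorphism sect U -> sect V};
  res_scal : forall (U V : opens X) (VU : V `<=` U) a,
    res VU (scal (sect U) a) = scal (sect V) a;
  res_id : forall (U : opens X) (UU : U `<=` U) s, res UU s = s;
  res_comp : forall (U V W : opens X) (VU : V `<=` U) (WV : W `<=` V)
    (WU : W `<=` U) s, res WV (res VU s) = res WU s;
  sheaf_sep : forall (U : opens X) (I : Type) (V : I -> opens X)
    (VU : forall i, V i `<=` U), U `<=` \bigcup_i V i ->
    forall s t : sect U, (forall i, res (VU i) s = res (VU i) t) -> s = t;
  sheaf_glue : forall (U : opens X) (I : Type) (V : I -> opens X)
    (VU : forall i, V i `<=` U), U `<=` \bigcup_i V i ->
    forall s : forall i, sect (V i),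
    (forall i j (W : opens X) (Wi : W `<=` V i) (Wj : W `<=` V j),
       res Wi (s i) = res Wj (s j)) ->
    exists t : sect U, forall i, res (VU i) t = s i
}.
Arguments res {R X s U V} VU : rename.

Record sheaf_mor (R : realType) (X : topologicalType) (F G : sheaf R X) :=
  SheafMor {
  mor :> forall U : opens X, {rmorphism F U -> G U};
  mor_scal : forall (U : opens X) a, mor U (scal (F U) a) = scal (G U) a;
  mor_res : forall (U V : opens X) (VU : V `<=` U) (s : F U),
    mor V (res VU s) = res VU (mor U s)
}.

Definition sheaf_iso (R : realType) (X : topologicalType) (F G : sheaf R X)
    (f : sheaf_mor F G) : Prop :=
  exists g : sheaf_mor G F,
    (forall U, cancel (f U) (g U)) /\ (forall U, cancel (g U) (f U)).

Section Stalk.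
Variables (R : realType) (X : topologicalType) (F : sheaf R X) (x : X).

Record local_section := LocalSection {
  ls_dom : opens X;
  ls_mem : ls_dom x;
  ls_sec : F ls_dom
}.

HB.instance Definition _ := gen_eqMixin local_section.
HB.instance Definition _ := gen_choiceMixin local_section.

Definition same_germ (p q : local_section) : Prop :=
  exists (W : opens X) (Wp : W `<=` ls_dom p) (Wq : W `<=` ls_dom q),
    W x /\ res Wp (ls_sec p) = res Wq (ls_sec q).

Lemma same_germ_refl : reflexive (fun p q => `[< same_germ p q >]).
Proof.
move=> p; apply/asboolP; have h : ls_dom p `<=` ls_dom p by [].
by exists (ls_dom p), h, h; split=> //; exact: ls_mem.
Qed.

Lemma same_germ_sym : symmetric (fun p q => `[< same_germ p q >]).
Proof.
suff h p q : same_germ p q -> same_germ q p by move=> p q; apply/asboolP/asboolP; apply: h.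
by move=> [W [hp [hq [Wx e]]]]; exists W, hq, hp.
Qed.

Lemma same_germ_trans : transitive (fun p q => `[< same_germ p q >]).
Proof.
move=> q p r /asboolP[W [hp [hq [Wx e]]]] /asboolP[V [kq [kr [Vx e']]]].
apply/asboolP; exists (opensI W V).
have WI : opensI W V `<=` W by move=> y [].
have VI : opensI W V `<=` V by move=> y [].
exists (subset_trans WI hp), (subset_trans VI kr); split=> //.
rewrite -(res_comp hp WI) e (res_comp hq WI (subset_trans WI hq)).
by rewrite -(res_comp kr VI) -e' (res_comp kq VI (subset_trans WI hq)).
Qed.

Definition same_germ_equiv :=
  EquivRel _ same_germ_refl same_germ_sym same_germ_trans.

Definition stalk_type := {eq_quot same_germ_equiv}.
HB.instance Definition _ := Choice.on stalk_type.

Definition germ (U : opens X) (Ux : U x) (s : F U) : stalk_type :=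
  \pi_stalk_type (LocalSection Ux s).

Lemma germP (U V : opens X) (Ux : U x) (Vx : V x) (s : F U) (t : F V) :
  germ Ux s = germ Vx t <->
  exists (W : opens X) (WU : W `<=` U) (WV : W `<=` V),
    W x /\ res WU s = res WV t.
Proof.
split; last by move=> h; apply/eqmodP/asboolP.
by move=> /eqmodP/asboolP.
Qed.

Lemma germ_res (U V : opens X) (Ux : U x) (Vx : V x) (VU : V `<=` U) (s : F U) :
  germ Vx (res VU s) = germ Ux s.
Proof.
apply/germP; have h : V `<=` V by [].
by exists V, h, VU; split=> //; rewrite res_id.
Qed.

Lemma germ_surj (a : stalk_type) :
  exists (U : opens X) (Ux : U x) (s : F U), a = germ Ux s.
Proof.
by elim/quotW: a => -[U Ux s]; exists U, Ux, s.
Qed.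

Let IL (U V : opens X) : opensI U V `<=` U. Proof. by move=> y []. Qed.
Let IR (U V : opens X) : opensI U V `<=` V. Proof. by move=> y []. Qed.

Lemma germ_surj2 (a b : stalk_type) :
  exists (U : opens X) (Ux : U x) (s t : F U), a = germ Ux s /\ b = germ Ux t.
Proof.
have [U [Ux [s ->]]] := germ_surj a; have [V [Vx [t ->]]] := germ_surj b.
exists (opensI U V), (opensI_mem Ux Vx), (res (@IL U V) s), (res (@IR U V) t).
by rewrite !(germ_res _ (opensI_mem Ux Vx)).
Qed.

Lemma germ_surj3 (a b c : stalk_type) :
  exists (U : opens X) (Ux : U x) (s t u : F U),
    [/\ a = germ Ux s, b = germ Ux t & c = germ Ux u].
Proof.
have [U [Ux [s [t [-> ->]]]]] := germ_surj2 a b.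
have [V [Vx [u ->]]] := germ_surj c.
exists (opensI U V), (opensI_mem Ux Vx), (res (@IL U V) s), (res (@IL U V) t),
  (res (@IR U V) u).
by rewrite !(germ_res _ (opensI_mem Ux Vx)).
Qed.

Definition stalk_op (op : forall U : opens X, F U -> F U -> F U)
    (a b : stalk_type) : stalk_type :=
  let p := repr a in let q := repr b in
  germ (opensI_mem (ls_mem p) (ls_mem q))
    (op _ (res (@IL _ _) (ls_sec p)) (res (@IR _ _) (ls_sec q))).

Lemma stalk_opE op (U : opens X) (Ux : U x) (s t : F U) :
  (forall (U V : opens X) (h : V `<=` U) (s t : F U),
     res h (op U s t) = op V (res h s) (res h t)) ->
  stalk_op op (germ Ux s) (germ Ux t) = germ Ux (op U s t).
Proof.
move=> opres; rewrite /stalk_op.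
have reprE (u : F U) : exists (W : opens X) (Wp : W `<=` ls_dom (repr (germ Ux u)))
    (WU : W `<=` U), W x /\ res Wp (ls_sec (repr (germ Ux u))) = res WU u.
  apply/(germP (ls_mem _) Ux); rewrite -[RHS]reprK /germ.
  by case: (repr _).
have [W [Wp [WU [Wx e]]]] := reprE s; have [V [Vp [VU [Vx e']]]] := reprE t.
move: (repr (germ Ux s)) (repr (germ Ux t)) Wp e Vp e' => p q Wp e Vq e'.
apply/germP; exists (opensI W V).
have h : opensI W V `<=` opensI (ls_dom p) (ls_dom q).
  by move=> y [/Wp ? /Vq ?].
exists h, (subset_trans (@IL W V) WU); split=> //.
rewrite !opres; congr (op _ _ _).
- rewrite (res_comp _ _ (subset_trans (@IL W V) Wp)).
  by rewrite -(res_comp Wp (@IL W V)) e (res_comp _ _ (subset_trans (@IL W V) WU)).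
- rewrite (res_comp _ _ (subset_trans (@IR W V) Vq)).
  by rewrite -(res_comp Vq (@IR W V)) e' (res_comp _ _ (subset_trans (@IL W V) WU)).
Qed.

Definition stalk_scal (a : complex_field R) : stalk_type :=
  germ (I : opensT X x) (scal _ a).

Lemma stalk_scalE (U : opens X) (Ux : U x) a : stalk_scal a = germ Ux (scal _ a).
Proof.
have UT : U `<=` opensT X by [].
by rewrite /stalk_scal -(res_scal F UT) (germ_res (I : opensT X x)).
Qed.

Definition stalk_add := stalk_op (fun U s t => s + t).
Definition stalk_mul := stalk_op (fun U s t => s * t).
Definition stalk_opp := stalk_op (fun U s t => - t) (stalk_scal 0).

Lemma stalk_addE (U : opens X) (Ux : U x) (s t : F U) :
  stalk_add (germ Ux s) (germ Ux t) = germ Ux (s + t).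
Proof. by apply: stalk_opE => *; rewrite rmorphD. Qed.

Lemma stalk_mulE (U : opens X) (Ux : U x) (s t : F U) :
  stalk_mul (germ Ux s) (germ Ux t) = germ Ux (s * t).
Proof. by apply: stalk_opE => *; rewrite rmorphM. Qed.

Lemma stalk_oppE (U : opens X) (Ux : U x) (s : F U) :
  stalk_opp (germ Ux s) = germ Ux (- s).
Proof.
by rewrite /stalk_opp (stalk_scalE Ux) stalk_opE // => *; rewrite rmorphN.
Qed.

Fact stalk_addA : associative stalk_add.
Proof.
by move=> a b c; have [U [Ux [s [t [u [-> -> ->]]]]]] := germ_surj3 a b c;
   rewrite !stalk_addE addrA.
Qed.

Fact stalk_addC : commutative stalk_add.
Proof.
by move=> a b; have [U [Ux [s [t [-> ->]]]]] := germ_surj2 a b;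
   rewrite !stalk_addE addrC.
Qed.

Fact stalk_add0 : left_id (stalk_scal 0) stalk_add.
Proof.
by move=> a; have [U [Ux [s ->]]] := germ_surj a;
   rewrite (stalk_scalE Ux) stalk_addE rmorph0 add0r.
Qed.

Fact stalk_addN : left_inverse (stalk_scal 0) stalk_opp stalk_add.
Proof.
by move=> a; have [U [Ux [s ->]]] := germ_surj a;
   rewrite stalk_oppE stalk_addE (stalk_scalE Ux) rmorph0 addNr.
Qed.

HB.instance Definition _ := GRing.isZmodule.Build stalk_type
  stalk_addA stalk_addC stalk_add0 stalk_addN.

Fact stalk_mulA : associative stalk_mul.
Proof.
by move=> a b c; have [U [Ux [s [t [u [-> -> ->]]]]]] := germ_surj3 a b c;
   rewrite !stalk_mulE mulrA.
Qed.

Fact stalk_mul1 : left_id (stalk_scal 1) stalk_mul.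
Proof.
by move=> a; have [U [Ux [s ->]]] := germ_surj a;
   rewrite (stalk_scalE Ux) stalk_mulE rmorph1 mul1r.
Qed.

Fact stalk_1mul : right_id (stalk_scal 1) stalk_mul.
Proof.
by move=> a; have [U [Ux [s ->]]] := germ_surj a;
   rewrite (stalk_scalE Ux) stalk_mulE rmorph1 mulr1.
Qed.

Fact stalk_mulDl : left_distributive stalk_mul +%R.
Proof.
by move=> a b c; have [U [Ux [s [t [u [-> -> ->]]]]]] := germ_surj3 a b c;
   rewrite /GRing.add /= !(stalk_addE, stalk_mulE) mulrDl.
Qed.

Fact stalk_mulDr : right_distributive stalk_mul +%R.
Proof.
by move=> a b c; have [U [Ux [s [t [u [-> -> ->]]]]]] := germ_surj3 a b c;
   rewrite /GRing.add /= !(stalk_addE, stalk_mulE) mulrDr.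
Qed.

HB.instance Definition _ := GRing.Zmodule_isPzRing.Build stalk_type
  stalk_mulA stalk_mul1 stalk_1mul stalk_mulDl stalk_mulDr.

Lemma germD (U : opens X) (Ux : U x) (s t : F U) :
  germ Ux (s + t) = germ Ux s + germ Ux t.
Proof. by rewrite /GRing.add /= stalk_addE. Qed.

Lemma germM (U : opens X) (Ux : U x) (s t : F U) :
  germ Ux (s * t) = germ Ux s * germ Ux t.
Proof. by rewrite /GRing.mul /= stalk_mulE. Qed.

Lemma germN (U : opens X) (Ux : U x) (s : F U) : germ Ux (- s) = - germ Ux s.
Proof. by rewrite /GRing.opp /= stalk_oppE. Qed.

Fact stalk_scal_zmod : zmod_morphism stalk_scal.
Proof. by move=> a b; rewrite /stalk_scal raddfB germD germN. Qed.

Fact stalk_scal_monoid : monoid_morphism stalk_scal.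
Proof. by split=> // a b; rewrite /stalk_scal rmorphM germM. Qed.

HB.instance Definition _ := GRing.isZmodMorphism.Build _ _ stalk_scal
  stalk_scal_zmod.
HB.instance Definition _ := GRing.isMonoidMorphism.Build _ _ stalk_scal
  stalk_scal_monoid.

Fact stalk_scal_central a (b : stalk_type) : stalk_scal a * b = b * stalk_scal a.
Proof.
have [U [Ux [s ->]]] := germ_surj b.
by rewrite (stalk_scalE Ux) -!germM scal_central.
Qed.

Definition stalk : calg R := CAlg stalk_scal_central.

Lemma germ_scal (U : opens X) (Ux : U x) a : germ Ux (scal _ a) = scal stalk a.
Proof. by rewrite -stalk_scalE. Qed.

End Stalk.
Arguments germ {R X F x U}.


(* Both the structure sheaf of a manifold and an inverse image sheaf consist  *)
(* of the functions s, with s(y) in a given algebra E y, that satisfy at      *)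
(* every point x of their domain a condition P x s depending only on the germ *)
(* of s at x.                                                                 *)
Record local_condition (R : realType) (X : topologicalType) (E : X -> calg R) :=
  LocalCondition {
  lc :> forall x : X, (forall y, E y) -> Prop;
  lc_local : forall x (s t : forall y, E y),
    (\forall y \near x, s y = t y) -> lc x s -> lc x t;
  lc_scal : forall x a, lc x (fun y => scal (E y) a);
  lc_sub : forall x s t, lc x s -> lc x t -> lc x (fun y => s y - t y);
  lc_mul : forall x s t, lc x s -> lc x t -> lc x (fun y => s y * t y)
}.

(* A section over U is encoded by its extension by 0 outside U.               *)
Record lc_section (R : realType) (X : topologicalType) (E : X -> calg R)
    (P : local_condition E) (U : opens X) := LcSection {
  sec_fun :> forall y, E y;
  sec_on : forall x, U x -> P x sec_fun;
  sec_off : forall x, ~ U x -> sec_fun x = 0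
}.

Section SectionSheaf.
Variables (R : realType) (X : topologicalType) (E : X -> calg R).
Variable P : local_condition E.

Definition restrict0 (U : opens X) (s : forall y, E y) : forall y, E y :=
  fun y => if `[< U y >] then s y else 0.

Lemma restrict0_in (U : opens X) s y : U y -> restrict0 U s y = s y.
Proof. by move=> Uy; rewrite /restrict0 asboolT. Qed.

Lemma restrict0_out (U : opens X) s y : ~ U y -> restrict0 U s y = 0.
Proof. by move=> Uy; rewrite /restrict0 asboolF. Qed.

Lemma near_opens (U : opens X) x : U x -> \forall y \near x, U y.
Proof. by move=> Ux; exact: (open_nbhs_nbhs (conj (opens_open U) Ux)). Qed.

Lemma restrict0_on (U : opens X) s x : U x -> P x s -> P x (restrict0 U s).
Proof.
move=> Ux; apply: lc_local; near=> y; rewrite restrict0_in //.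
by near: y; exact: near_opens.
Unshelve. all: by end_near. Qed.

Section Ring.
Variable U : opens X.
Local Notation T := (lc_section P U).
HB.instance Definition _ := gen_eqMixin T.
HB.instance Definition _ := gen_choiceMixin T.

Lemma sec_ext (s t : T) : (forall y, U y -> s y = t y) -> s = t.
Proof.
case: s t => [s s1 s0] [t t1 t0] /= e.
have {}e : s = t.
  apply: functional_extensionality_dep => y.
  by have [Uy|nUy] := pselect (U y); [exact: e|rewrite s0 ?t0].
by case: _ / e t1 t0 => t1 t0; congr LcSection; exact: Prop_irrelevance.
Qed.

Definition sec_scal a : T :=
  LcSection (fun x Ux => restrict0_on Ux (lc_scal P x a))
    (fun x nUx => restrict0_out _ nUx).

Lemma sec_scalE a y : U y -> sec_scal a y = scal (E y) a.
Proof. exact: restrict0_in. Qed.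

Program Definition sec_sub (s t : T) : T :=
  @LcSection _ _ _ P U (fun y => s y - t y) _ _.
Next Obligation. by move=> s t x Ux; apply: lc_sub; exact: sec_on. Qed.
Next Obligation. by move=> s t x nUx /=; rewrite !sec_off // subr0. Qed.

Program Definition sec_mul (s t : T) : T :=
  @LcSection _ _ _ P U (fun y => s y * t y) _ _.
Next Obligation. by move=> s t x Ux; apply: lc_mul; exact: sec_on. Qed.
Next Obligation. by move=> s t x nUx /=; rewrite !sec_off // mulr0. Qed.

Definition sec_opp (s : T) : T := sec_sub (sec_scal 0) s.
Definition sec_add (s t : T) : T := sec_sub s (sec_opp t).

Lemma sec_oppE s y : U y -> sec_opp s y = - s y.
Proof. by move=> Uy; rewrite /= restrict0_in // rmorph0 sub0r. Qed.

Lemma sec_addE s t y : U y -> sec_add s t y = s y + t y.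
Proof. by move=> Uy; rewrite -[LHS]/(s y - sec_opp t y) sec_oppE // opprK. Qed.

Fact sec_addA : associative sec_add.
Proof. by move=> s t u; apply: sec_ext => y Uy; rewrite !sec_addE // addrA. Qed.
Fact sec_addC : commutative sec_add.
Proof. by move=> s t; apply: sec_ext => y Uy; rewrite !sec_addE // addrC. Qed.
Fact sec_add0 : left_id (sec_scal 0) sec_add.
Proof.
by move=> s; apply: sec_ext => y Uy; rewrite sec_addE // sec_scalE // rmorph0 add0r.
Qed.
Fact sec_addN : left_inverse (sec_scal 0) sec_opp sec_add.
Proof.
move=> s; apply: sec_ext => y Uy.
by rewrite sec_addE // sec_oppE // sec_scalE // rmorph0 addNr.
Qed.
HB.instance Definition _ := GRing.isZmodule.Build T
  sec_addA sec_addC sec_add0 sec_addN.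

Fact sec_mulA : associative sec_mul.
Proof. by move=> s t u; apply: sec_ext => y Uy /=; rewrite mulrA. Qed.
Fact sec_mul1 : left_id (sec_scal 1) sec_mul.
Proof.
by move=> s; apply: sec_ext => y Uy /=; rewrite restrict0_in // rmorph1 mul1r.
Qed.
Fact sec_1mul : right_id (sec_scal 1) sec_mul.
Proof.
by move=> s; apply: sec_ext => y Uy /=; rewrite restrict0_in // rmorph1 mulr1.
Qed.
Fact sec_mulDl : left_distributive sec_mul sec_add.
Proof.
move=> s t u; apply: sec_ext => y Uy.
by rewrite sec_addE // -[LHS]/(sec_add s t y * u y) sec_addE // mulrDl.
Qed.
Fact sec_mulDr : right_distributive sec_mul sec_add.
Proof.
move=> s t u; apply: sec_ext => y Uy.
by rewrite sec_addE // -[LHS]/(s y * sec_add t u y) sec_addE // mulrDr.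
Qed.
HB.instance Definition _ := GRing.Zmodule_isPzRing.Build T
  sec_mulA sec_mul1 sec_1mul sec_mulDl sec_mulDr.

Lemma secDE (s t : T) y : (s + t) y = s y + t y.
Proof.
have [Uy|nUy] := pselect (U y); first exact: sec_addE.
by rewrite !sec_off // addr0.
Qed.

Lemma secNE (s : T) y : (- s) y = - s y.
Proof.
have [Uy|nUy] := pselect (U y); first exact: sec_oppE.
by rewrite !sec_off // oppr0.
Qed.

Lemma secME (s t : T) y : (s * t) y = s y * t y.
Proof. by []. Qed.

Lemma sec1E y : U y -> (1 : T) y = 1.
Proof. by move=> Uy; rewrite [LHS]restrict0_in // rmorph1. Qed.

Fact sec_scal_zmod : zmod_morphism sec_scal.
Proof.
move=> a b; apply: sec_ext => y Uy.
by rewrite secDE secNE !sec_scalE // raddfB.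
Qed.
Fact sec_scal_monoid : monoid_morphism sec_scal.
Proof.
split=> // a b; apply: sec_ext => y Uy.
by rewrite secME !sec_scalE // rmorphM.
Qed.
HB.instance Definition _ := GRing.isZmodMorphism.Build _ _ sec_scal sec_scal_zmod.
HB.instance Definition _ := GRing.isMonoidMorphism.Build _ _ sec_scal
  sec_scal_monoid.

Fact sec_scal_central a (s : T) : sec_scal a * s = s * sec_scal a.
Proof. by apply: sec_ext => y Uy; rewrite !secME sec_scalE // scal_central. Qed.

Definition sec_calg : calg R := CAlg sec_scal_central.

End Ring.

Section Restriction.
Variables (U V : opens X) (VU : V `<=` U).

Definition sec_res (s : lc_section P U) : lc_section P V :=
  LcSection (fun x Vx => restrict0_on Vx (sec_on s (VU Vx)))
    (fun x nVx => restrict0_out _ nVx).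

Lemma sec_resE s y : V y -> sec_res s y = s y.
Proof. exact: restrict0_in. Qed.

Fact sec_res_zmod : zmod_morphism sec_res.
Proof.
by move=> s t; apply: sec_ext => y Vy; rewrite !(secDE, secNE, sec_resE).
Qed.
Fact sec_res_monoid : monoid_morphism sec_res.
Proof.
split=> [|s t]; apply: sec_ext => y Vy; last by rewrite !(secME, sec_resE).
by rewrite sec_resE // !sec1E //; exact: VU.
Qed.
HB.instance Definition _ := GRing.isZmodMorphism.Build _ _ sec_res sec_res_zmod.
HB.instance Definition _ := GRing.isMonoidMorphism.Build _ _ sec_res
  sec_res_monoid.
End Restriction.

Program Definition section_sheaf : sheaf R X :=
  @Sheaf R X sec_calg (fun U V VU => sec_res VU) _ _ _ _ _.
Next Obligation.
move=> U V VU a; apply: sec_ext => y Vy.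
by rewrite sec_resE // !sec_scalE //; exact: VU.
Qed.
Next Obligation. by move=> U UU s; apply: sec_ext => y Uy; rewrite sec_resE. Qed.
Next Obligation.
move=> U V W VU WV WU s; apply: sec_ext => y Wy.
by rewrite !sec_resE //; exact: WV.
Qed.
Next Obligation.
move=> U I V VU cov s t e; apply: sec_ext => y /cov[i _ Viy].
by have := congr1 (fun u : lc_section P (V i) => u y) (e i); rewrite /= !restrict0_in.
Qed.
Next Obligation.
move=> U I V VU cov s e.
have agree i j y : V i y -> V j y -> s i y = s j y.
  move=> Viy Vjy.
  have WI : opensI (V i) (V j) `<=` V i by move=> ? [].
  have WJ : opensI (V i) (V j) `<=` V j by move=> ? [].
  have := congr1 (fun u : lc_section P (opensI (V i) (V j)) => u y) (e i j _ WI WJ).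
  by rewrite !sec_resE //; exact: opensI_mem.
have ex y : exists z : E y, (forall i, V i y -> z = s i y) /\ (~ U y -> z = 0).
  have [[i Viy]|nV] := pselect (exists i, V i y).
    by exists (s i y); split=> [j Vjy|[]]; [exact: agree|exact: VU Viy].
  by exists 0; split=> // i Viy; case: nV; exists i.
pose f y := sval (cid (ex y)).
have fE i y : V i y -> f y = s i y by case: (svalP (cid (ex y))) => + _; exact.
have f0 y : ~ U y -> f y = 0 by case: (svalP (cid (ex y))).
have fP x : U x -> P x f.
  move=> /cov[i _ Vix]; apply: lc_local (sec_on (s i) Vix).
  near=> y; rewrite (fE i) //; near: y; exact: near_opens.
exists (LcSection fP f0) => i; apply: sec_ext => y Viy.
by rewrite sec_resE //=; exact: fE.
Unshelve. all: by end_near. Qed.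

End SectionSheaf.

Section InverseImage.
Variables (R : realType) (X Y : topologicalType) (f : X -> Y) (G : sheaf R Y).

Definition from_section (x : X) (s : forall y, stalk G (f y)) : Prop :=
  exists (V : opens Y) (t : G V),
    \forall y \near x, exists Vfy : V (f y), s y = germ Vfy t.

Program Definition from_section_condition :=
  @LocalCondition R X (fun y => stalk G (f y)) from_section _ _ _ _.
Next Obligation.
move=> x s t st [V [u us]]; exists V, u.
by near=> y; have <- : s y = t y; near: y.
Unshelve. all: by end_near. Qed.
Next Obligation.
move=> x a; exists (opensT Y), (scal _ a); apply: nearW => y.
by exists I; rewrite germ_scal.
Qed.
Next Obligation.
move=> x s t [V [v vs]] [W [w wt]].
have VI : opensI V W `<=` V by move=> ? [].
have WI : opensI V W `<=` W by move=> ? [].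
exists (opensI V W), (res VI v - res WI w).
near=> y.
have [Vy ->] : exists Vfy : V (f y), s y = germ Vfy v by near: y.
have [Wy ->] : exists Wfy : W (f y), t y = germ Wfy w by near: y.
by exists (opensI_mem Vy Wy); rewrite germD germN !(germ_res _ (opensI_mem Vy Wy)).
Unshelve. all: by end_near. Qed.
Next Obligation.
move=> x s t [V [v vs]] [W [w wt]].
have VI : opensI V W `<=` V by move=> ? [].
have WI : opensI V W `<=` W by move=> ? [].
exists (opensI V W), (res VI v * res WI w).
near=> y.
have [Vy ->] : exists Vfy : V (f y), s y = germ Vfy v by near: y.
have [Wy ->] : exists Wfy : W (f y), t y = germ Wfy w by near: y.
by exists (opensI_mem Vy Wy); rewrite germM !(germ_res _ (opensI_mem Vy Wy)).
Unshelve. all: by end_near. Qed.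

(* The inverse image sheaf of G by a continuous map f.                        *)
Definition inverse_image : sheaf R X := section_sheaf from_section_condition.

End InverseImage.

Section OpenSubspace.
Variables (X : topologicalType) (U : opens X).

Lemma open_image_val (V : opens (set_type U)) : open (set_val @` V).
Proof.
have [W oW WV] := opens_open V.
suff -> : set_val @` V = W `&` U by apply: openI => //; exact: opens_open.
apply/seteqP; split=> [_ [y Vy <-]|x [Wx Ux]].
  split; last exact: (set_valP y).
  by move: Vy; rewrite /opens_pred -WV.
by exists (exist _ x (mem_set Ux)) => //; rewrite /opens_pred -WV.
Qed.

Definition image_val (V : opens (set_type U)) : opens X := Opens (@open_image_val V).

Lemma image_val_sub (V W : opens (set_type U)) :
  W `<=` V -> image_val W `<=` image_val V.
Proof. exact: image_subset. Qed.

Variables (R : realType) (F : sheaf R X).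

Program Definition sheaf_restr : sheaf R (set_type U) :=
  @Sheaf R (set_type U) (fun V => F (image_val V))
    (fun V W WV => res (image_val_sub WV)) _ _ _ _ _.
Next Obligation. by move=> V W WV a; exact: res_scal. Qed.
Next Obligation. by move=> V VV s; exact: res_id. Qed.
Next Obligation. by move=> V W Z WV ZW ZV s; exact: res_comp. Qed.
Next Obligation.
move=> V I W WV cov s t; apply: (sheaf_sep (V := fun i => image_val (W i))).
by move=> _ [y /cov[i _ Wiy] <-]; exists i => //; exists y.
Qed.
Next Obligation.
move=> V I W WV cov s e.
apply: (sheaf_glue (V := fun i => image_val (W i))) => [|i j Z Zi Zj].
  by move=> _ [y /cov[i _ Wiy] <-]; exists i => //; exists y.
have oZ : open (set_val @^-1` Z : set (set_type U)).
  by exists Z => //; exact: opens_open.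
have pZ k (h : Z `<=` image_val (W k)) : Opens oZ `<=` W k.
  by move=> y /h[z Wz /val_inj <-].
have ZE : Z `<=` image_val (Opens oZ).
  by move=> z Zz; have [y Wy yz] := Zi _ Zz; exists y => //; rewrite /opens_pred /= yz.
rewrite -(res_comp (image_val_sub (pZ i Zi)) ZE) (e i j _ _ (pZ j Zj)).
by rewrite (res_comp _ _ Zj).
Qed.

End OpenSubspace.


Lemma near_eq_differentiable (K : numFieldType) (V W : normedModType K)
    (f g : V -> W) (x : V) :
  (\forall y \near x, f y = g y) -> differentiable f x -> differentiable g x.
Proof.
move=> fg /diff_locallyP[dfc dfx].
have gE : g \o shift x = cst (g x) + 'd f x +o_ 0 id.
  apply/eqaddoP => e e0; move/eqaddoP: dfx => /(_ e e0) fe.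
  have fg0 : \forall y \near (0 : V), f (y + x) = g (y + x).
    by move: fg; rewrite (near_shift 0 x); apply: filterS => y; rewrite /= subr0.
  near=> y.
  have e1 : f (y + x) = g (y + x) by near: y.
  have e2 : f x = g x by exact: nbhs_singleton fg.
  have : `|(f \o shift x - (cst (f x) + 'd f x)) y| <= e * `|id y| by near: y.
  by rewrite !fctE /= e1 e2.
have dE := diff_unique dfc gE.
by apply/diff_locallyP; rewrite dE.
Unshelve. all: by end_near. Qed.

(* A chart with domain cdom; only the values of cmap on cdom and of cinv on   *)
(* cmap @` cdom are relevant.                                                 *)
Record chart (R : realType) (X : topologicalType) (m : nat) := Chart {
  cdom : set X;
  cmap : X -> 'rV[complex_field R]_m;
  cinv : 'rV[complex_field R]_m -> X;
  cdom_open : open cdom;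
  cimg_open : open (cmap @` cdom);
  cmapK : forall x, cdom x -> cinv (cmap x) = x;
  cmap_continuous : forall x, cdom x -> {for x, continuous cmap};
  cinv_continuous : forall x, cdom x -> {for cmap x, continuous cinv}
}.

(* A space with a holomorphic atlas of dimension m, not necessarily Hausdorff *)
(* or paracompact. A function on an open subset of C^m is holomorphic when it *)
(* is C-differentiable at every point.                                        *)
Record atlas_space (R : realType) (m : nat) := AtlasSpace {
  aspace :> topologicalType;
  atlas : set (chart R aspace m);
  atlas_cover : forall x, exists2 c, atlas c & cdom c x;
  atlas_compatible : forall c d, atlas c -> atlas d ->
    forall x, cdom c x -> cdom d x ->
    differentiable (cmap d \o cinv c) (cmap c x)
}.

Definition paracompact (X : topologicalType) : Prop :=
  forall A : set (set X), (forall U, A U -> open U) -> \bigcup_(U in A) U = setT ->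
  exists B : set (set X), [/\ forall V, B V -> open V,
    \bigcup_(V in B) V = setT,
    forall V, B V -> exists2 U, A U & V `<=` U &
    forall x : X, exists2 W, nbhs x W & finite_set [set V | B V /\ V `&` W !=set0]].

Definition complex_manifold (R : realType) (m : nat) (X : atlas_space R m) : Prop :=
  hausdorff_space X /\ paracompact X.

Definition holomorphic_at (R : realType) (m n : nat) (X : atlas_space R m)
    (Y : atlas_space R n) (f : X -> Y) (x : X) : Prop :=
  {for x, continuous f} /\
  forall c d, atlas c -> atlas d -> cdom c x -> cdom d (f x) ->
  differentiable (cmap d \o f \o cinv c) (cmap c x).

Definition holomorphic (R : realType) (m n : nat) (X : atlas_space R m)
    (Y : atlas_space R n) (f : X -> Y) : Prop :=
  forall x, holomorphic_at f x.

Definition biholomorphic (R : realType) (m n : nat) (X : atlas_space R m)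
    (Y : atlas_space R n) (f : X -> Y) : Prop :=
  holomorphic f /\ exists g : Y -> X, [/\ holomorphic g, cancel f g & cancel g f].

(* A topological embedding with closed image which is an immersion.           *)
Record closed_embedding (R : realType) (m n : nat) (X : atlas_space R m)
    (Y : atlas_space R n) (f : X -> Y) : Prop := ClosedEmbedding {
  ce_holomorphic : holomorphic f;
  ce_injective : injective f;
  ce_immersion : forall x c d, atlas c -> atlas d -> cdom c x -> cdom d (f x) ->
    injective ('d (cmap d \o f \o cinv c) (cmap c x));
  ce_initial : forall U : set X, open U -> exists2 V, open V & U = f @^-1` V;
  ce_closed : closed (range f)
}.

Section StructureSheaf.
Variables (R : realType) (m : nat) (X : atlas_space R m).
Local Notation C := (complex_field R).

Definition holomorphic_fun_at (x : X) (f : X -> C) : Prop :=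
  forall c, atlas c -> cdom c x -> differentiable (f \o cinv c) (cmap c x).

Lemma near_cinv (c : chart R X m) x (P : X -> Prop) :
  cdom c x -> (\forall y \near x, P y) ->
  \forall z \near cmap c x, P (cinv c z).
Proof.
move=> cx Px.
have h : cinv c @ cmap c x --> cinv c (cmap c x) := cinv_continuous cx.
by apply: (h P); rewrite cmapK.
Qed.

Program Definition holomorphic_condition :=
  @LocalCondition R X (fun=> complex_calg R) holomorphic_fun_at _ _ _ _.
Next Obligation.
move=> x s t st sx c ac cx; apply: near_eq_differentiable (sx c ac cx).
exact: near_cinv cx st.
Qed.
Next Obligation. by move=> x a c ac cx; exact: differentiable_cst. Qed.
Next Obligation.
by move=> x s t sx tx c ac cx; exact: differentiableB (sx c ac cx) (tx c ac cx).
Qed.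
Next Obligation.
by move=> x s t sx tx c ac cx; exact: differentiableM (sx c ac cx) (tx c ac cx).
Qed.

Definition structure_sheaf : sheaf R X := section_sheaf holomorphic_condition.

Definition eval_germ (x : X) (a : stalk structure_sheaf x) : complex_field R :=
  ls_sec (repr a) x.

Lemma eval_germE (x : X) (U : opens X) (Ux : U x) (s : structure_sheaf U) :
  eval_germ (germ Ux s) = s x.
Proof.
rewrite /eval_germ.
have : germ (ls_mem (repr (germ Ux s))) (ls_sec (repr (germ Ux s))) = germ Ux s.
  by rewrite -[RHS]reprK /germ; case: (repr _).
move: (repr _) => p /germP[W [Wp [WU [Wx]]]].
move=> /(congr1 (fun u : lc_section holomorphic_condition W => u x)).
by rewrite /= !restrict0_in.
Qed.

Lemma eval_germ_zmod x : zmod_morphism (@eval_germ x).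
Proof.
move=> a b; have [U [Ux [s [t [-> ->]]]]] := germ_surj2 a b.
by rewrite -germN -germD !eval_germE secDE secNE.
Qed.

Lemma eval_germ_monoid x : monoid_morphism (@eval_germ x).
Proof.
split=> [|a b]; last first.
  have [U [Ux [s [t [-> ->]]]]] := germ_surj2 a b.
  by rewrite -germM !eval_germE.
rewrite -[1](rmorph1 (scal (stalk structure_sheaf x))).
by rewrite -(germ_scal structure_sheaf (I : opensT X x)) eval_germE sec_scalE.
Qed.

End StructureSheaf.


Section Comorphism.
Variables (R : realType) (m n : nat) (X : atlas_space R m) (Y : atlas_space R n).
Variables (f : X -> Y) (hf : holomorphic f).
Local Notation OX := (structure_sheaf X).
Local Notation OY := (structure_sheaf Y).

Lemma comorphism_on (U : opens X) (s : inverse_image f OY U) x :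
  U x -> holomorphic_fun_at x (fun y => eval_germ (s y)).
Proof.
move=> Ux; have [V [t st]] := sec_on s Ux.
have [Vfx _] := nbhs_singleton st.
apply: (@lc_local _ _ _ (holomorphic_condition X) x (t \o f)).
  by apply: filterS st => y [Vy ->]; rewrite eval_germE.
move=> c ac cx; have [d ad dx] := atlas_cover (f x).
have [fx hfx] := hf x.
pose h := (t \o cinv d) \o (cmap d \o f \o cinv c).
apply: (@near_eq_differentiable _ _ _ h).
  suff : \forall y \near x, cdom d (f y).
    by move/(near_cinv cx); apply: filterS => z dz; rewrite /h /= cmapK.
  exact: fx (open_nbhs_nbhs (conj (cdom_open d) dx)).
apply: differentiable_comp; first exact: hfx.
by rewrite /= cmapK //; exact: (sec_on t Vfx).
Qed.

Program Definition comorphism_sec (U : opens X) (s : inverse_image f OY U) :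
  OX U := @LcSection _ _ _ (holomorphic_condition X) U
    (fun x => eval_germ (s x)) _ _.
Next Obligation. by move=> U s x; exact: comorphism_on. Qed.
Next Obligation.
move=> U s x nUx; rewrite /= sec_off //.
by rewrite -(subrr 0) (eval_germ_zmod 0 0) subrr.
Qed.

Fact comorphism_zmod U : zmod_morphism (@comorphism_sec U).
Proof.
move=> s t; apply: sec_ext => x Ux; rewrite secDE secNE.
by rewrite -[LHS]/(eval_germ ((s - t) x)) secDE secNE eval_germ_zmod.
Qed.
Fact comorphism_monoid U : monoid_morphism (@comorphism_sec U).
Proof.
split=> [|s t]; apply: sec_ext => x Ux; last first.
  by rewrite -[LHS]/(eval_germ ((s * t) x)) secME (eval_germ_monoid _).2.
by rewrite -[LHS]/(eval_germ ((1 : inverse_image f OY U) x)) !sec1E //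
  (eval_germ_monoid _).1.
Qed.
HB.instance Definition _ U := GRing.isZmodMorphism.Build _ _
  (@comorphism_sec U) (@comorphism_zmod U).
HB.instance Definition _ U := GRing.isMonoidMorphism.Build _ _
  (@comorphism_sec U) (@comorphism_monoid U).

(* The canonical morphism from the inverse image of O_Y to O_X, which maps a  *)
(* section s to the function whose value at x is that of the germ s x at f x. *)
Program Definition comorphism : sheaf_mor (inverse_image f OY) OX :=
  @SheafMor R X (inverse_image f OY) OX (fun U => @comorphism_sec U) _ _.
Next Obligation.
move=> U a; apply: sec_ext => x Ux; rewrite /= !restrict0_in //.
by rewrite -(germ_scal OY (I : opensT Y (f x))) eval_germE sec_scalE.
Qed.
Next Obligation.
by move=> U V VU s; apply: sec_ext => x Vx; rewrite /= !restrict0_in.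
Qed.

End Comorphism.

Section OpenAtlas.
Variables (R : realType) (m : nat) (X : atlas_space R m) (U : opens X).
Local Notation T := (set_type U).

Lemma set_val_continuous : continuous (set_val : T -> X).
Proof. exact: initial_continuous. Qed.

Definition to_sub (x0 : T) (x : X) : T :=
  if pselect (U x) is left Ux then exist _ x (mem_set Ux) else x0.

Lemma to_subK x0 x : U x -> set_val (to_sub x0 x) = x.
Proof. by move=> Ux; rewrite /to_sub; case: pselect. Qed.

Lemma set_valK x0 (y : T) : to_sub x0 (set_val y) = y.
Proof. by apply: val_inj; rewrite [LHS]to_subK //; exact: set_valP. Qed.

Lemma to_sub_continuous x0 x : U x -> {for x, continuous (to_sub x0)}.
Proof.
move=> Ux A [_ [[W oW <-] /= Wx WA]]; rewrite to_subK // in Wx.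
have : \forall y \near x, W y /\ U y.
  apply: (open_nbhs_nbhs (conj (openI oW (opens_open U)) (conj Wx Ux))).
by apply: filterS => y [Wy Uy]; apply: WA; rewrite /= to_subK.
Qed.

(* The point x0 only supplies the irrelevant values of the inverse.           *)
Program Definition sub_chart (c : chart R X m) (x0 : T) : chart R T m :=
  @Chart R T m (set_val @^-1` cdom c) (cmap c \o set_val) (to_sub x0 \o cinv c)
    _ _ _ _ _.
Next Obligation. by move=> c x0; exists (cdom c) => //; exact: cdom_open. Qed.
Next Obligation.
move=> c x0; rewrite openE => _ [y cy <-]; rewrite /interior /=.
have h1 : nbhs (cmap c (set_val y)) (cmap c @` cdom c).
  by apply: open_nbhs_nbhs; split; [exact: cimg_open|exists (set_val y)].
have h2 : \forall z \near cmap c (set_val y), U (cinv c z).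
  by apply: near_cinv cy (near_opens (set_valP y)).
near=> z; have [x cx xz] : (cmap c @` cdom c) z by near: z.
have : U (cinv c z) by near: z.
rewrite -xz cmapK // => Ux; exists (exist _ x (mem_set Ux)) => //.
Unshelve. all: by end_near. Qed.
Next Obligation. by move=> c x0 y cy /=; rewrite cmapK // set_valK. Qed.
Next Obligation.
move=> c x0 y cy; apply: continuous_comp; first exact: set_val_continuous.
exact: cmap_continuous.
Qed.
Next Obligation.
move=> c x0 y cy; apply: continuous_comp; first exact: (cinv_continuous cy).
by apply: to_sub_continuous; rewrite /= cmapK //; exact: set_valP.
Qed.

Program Definition open_atlas_space : atlas_space R m :=
  @AtlasSpace R m T [set c' | exists c x0, atlas c /\ c' = sub_chart c x0] _ _.
Next Obligation.
move=> y; have [c ac cy] := atlas_cover (set_val y).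
by exists (sub_chart c y) => //; exists c, y.
Qed.
Next Obligation.
move=> _ _ [c [x0 [ac ->]]] [d [x1 [ad ->]]] y cy dy.
apply: near_eq_differentiable (atlas_compatible ac ad cy dy).
have : \forall z \near cmap c (set_val y), U (cinv c z).
  by apply: near_cinv cy (near_opens (set_valP y)).
by apply: filterS => z Uz; rewrite /= to_subK.
Qed.

End OpenAtlas.


Lemma pair_continuous (T U V : topologicalType) (f : T -> U) (g : T -> V) x :
  {for x, continuous f} -> {for x, continuous g} ->
  {for x, continuous (fun y => (f y, g y))}.
Proof.
move=> cf cg; have fx : f @ x --> f x := cf; have gx : g @ x --> g x := cg.
exact: (cvg_pair fx gx).
Qed.

Section Product.
Variables (R : realType) (m n : nat).
Local Notation C := (complex_field R).

Lemma entrywise_continuous p q (f : 'rV[C]_p -> 'rV[C]_q) :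
  (forall j, (exists i, forall v, f v 0 j = v 0 i) \/
             (forall v w, f v 0 j = f w 0 j)) -> continuous f.
Proof.
move=> fE x A /(nbhs_ballP (f x))[e /= e0 eA].
apply/(nbhs_ballP x); exists e => //=.
move=> y [_ xy]; apply: eA; split=> // i j.
rewrite (ord1 i); have [[k fk]|fk] := fE j; first by rewrite !fk; exact: xy.
by rewrite (fk y x); exact: ballxx.
Qed.

Lemma lsubmx_continuous : continuous (@lsubmx C 1 m n).
Proof.
by apply: entrywise_continuous => j; left; exists (lshift n j) => v; rewrite mxE.
Qed.

Lemma rsubmx_continuous : continuous (@rsubmx C 1 m n).
Proof.
by apply: entrywise_continuous => j; left; exists (rshift m j) => v; rewrite mxE.
Qed.

Definition inlmx (u : 'rV[C]_m) : 'rV[C]_(m + n) := row_mx u 0.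
Definition inrmx (v : 'rV[C]_n) : 'rV[C]_(m + n) := row_mx 0 v.

Lemma row_mx_inE u v : row_mx u v = inlmx u + inrmx v.
Proof. by rewrite add_row_mx addr0 add0r. Qed.

Fact inlmx_linear : linear inlmx.
Proof. by move=> a u v; rewrite /inlmx scale_row_mx add_row_mx scaler0 addr0. Qed.
Fact inrmx_linear : linear inrmx.
Proof. by move=> a u v; rewrite /inrmx scale_row_mx add_row_mx scaler0 addr0. Qed.
HB.instance Definition _ := GRing.isLinear.Build _ _ _ _ inlmx inlmx_linear.
HB.instance Definition _ := GRing.isLinear.Build _ _ _ _ inrmx inrmx_linear.

Lemma inlmx_continuous : continuous inlmx.
Proof.
apply: entrywise_continuous => j; rewrite -(splitK j).
case: (fintype.split j) => k /=.
  by left; exists k => v; rewrite row_mxEl.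
by right=> v w; rewrite !row_mxEr.
Qed.

Lemma inrmx_continuous : continuous inrmx.
Proof.
apply: entrywise_continuous => j; rewrite -(splitK j).
case: (fintype.split j) => k /=; last by left; exists k => v; rewrite row_mxEr.
by right=> v w; rewrite !row_mxEl.
Qed.

Lemma row_mx_continuous : continuous (fun p : 'rV[C]_m * 'rV[C]_n => row_mx p.1 p.2).
Proof.
under eq_fun do rewrite row_mx_inE.
move=> p; apply: cvgD.
  by apply: continuous_comp; [exact: cvg_fst|exact: inlmx_continuous].
by apply: continuous_comp; [exact: cvg_snd|exact: inrmx_continuous].
Qed.

Variable X : atlas_space R m.
Local Notation T := (X * 'rV[C]_n)%type.

Program Definition prod_chart (c : chart R X m) : chart R T (m + n) :=
  @Chart R T (m + n) [set p | cdom c p.1]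
    (fun p => row_mx (cmap c p.1) p.2)
    (fun w => (cinv c (lsubmx w), rsubmx w)) _ _ _ _ _.
Next Obligation.
by move=> c; apply: (open_comp _ (cdom_open c)) => p _; exact: cvg_fst.
Qed.
Next Obligation.
move=> c.
suff -> : [set row_mx (cmap c p.1) p.2 | p in [set p : T | cdom c p.1]] =
    (@lsubmx C 1 m n) @^-1` (cmap c @` cdom c).
  apply: (@open_comp _ _ (@lsubmx C 1 m n)); last exact: cimg_open.
  by move=> w _; exact: lsubmx_continuous.
apply/seteqP; split=> [_ [p cp <-]|w [x cx xw]] /=.
  by rewrite row_mxKl; exists p.1.
by exists (x, rsubmx w) => //=; rewrite xw hsubmxK.
Qed.
Next Obligation. by move=> c [x v] /= cx; rewrite row_mxKl row_mxKr cmapK. Qed.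
Next Obligation.
move=> c [x v] /= cx.
pose g (p : T) := (cmap c p.1, p.2).
apply: (@continuous_comp _ _ _ g (fun p => row_mx p.1 p.2)).
  apply: pair_continuous; last exact: cvg_snd.
  by apply: continuous_comp; [exact: cvg_fst|exact: cmap_continuous].
exact: row_mx_continuous.
Qed.
Next Obligation.
move=> c [x v] /= cx; apply: pair_continuous; last exact: rsubmx_continuous.
apply: (@continuous_comp _ _ _ (@lsubmx C 1 m n) (cinv c)).
  exact: lsubmx_continuous.
by rewrite row_mxKl; exact: cinv_continuous.
Qed.

(* The product of X with C^n.                                                 *)
Program Definition prod_atlas_space : atlas_space R (m + n) :=
  @AtlasSpace R (m + n) T [set prod_chart c | c in @atlas R m X] _ _.
Next Obligation.
move=> [x v]; have [c ac cx] := atlas_cover x.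
by exists (prod_chart c) => //; exists c.
Qed.
Next Obligation.
move=> _ _ [c ac <-] [d ad <-] [x v] /= cx dx.
pose l := inlmx \o ((cmap d \o cinv c) \o @lsubmx C 1 m n).
pose r := inrmx \o @rsubmx C 1 m n.
have -> : cmap (prod_chart d) \o cinv (prod_chart c) = l + r.
  by apply/funext => w; rewrite /= row_mx_inE.
apply: differentiableD.
  apply: differentiable_comp; last first.
    by apply: linear_differentiable; exact: inlmx_continuous.
  apply: differentiable_comp.
    by apply: linear_differentiable; exact: lsubmx_continuous.
  by rewrite row_mxKl; exact: atlas_compatible.
apply: differentiable_comp; apply: linear_differentiable.
  exact: rsubmx_continuous.
exact: inrmx_continuous.
Qed.

Definition zero_section (x : X) : prod_atlas_space := (x, 0).

Lemma zero_section_holomorphic : holomorphic zero_section.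
Proof.
move=> x; split.
  by apply: pair_continuous; [exact: cvg_id|exact: cvg_cst].
move=> c _ ac [d ad <-] /= cx dx.
have -> : cmap (prod_chart d) \o zero_section \o cinv c =
    inlmx \o (cmap d \o cinv c).
  by [].
apply: differentiable_comp; first exact: atlas_compatible.
by apply: linear_differentiable; exact: inlmx_continuous.
Qed.

End Product.

Section Extension.
Variables (R : realType) (m d1 d2 : nat).
Variables (M : atlas_space R m) (M1 : atlas_space R d1) (M2 : atlas_space R d2).
Variables (i1 : M -> M1) (i2 : M -> M2).
Variable phi : sheaf_mor (inverse_image i1 (structure_sheaf M1))
                         (inverse_image i2 (structure_sheaf M2)).
Variables (N1 : opens M1) (N2 : opens M2).
Variable g : open_atlas_space N2 -> open_atlas_space N1.

(* If the germ of s at x is represented by the function t on V, then that of  *)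
(* phi(s) is represented by a function u that coincides with t \o g on a      *)
(* neighbourhood W of i2 x on which t \o g is defined.                        *)
Definition induced_by_pullback : Prop :=
  forall (U : opens M) (s : inverse_image i1 (structure_sheaf M1) U) (x : M),
  U x ->
  forall (V : opens M1) (Vx : V (i1 x)) (t : structure_sheaf M1 V),
  s x = germ Vx t ->
  exists (W : opens M2) (Wx : W (i2 x)) (u : structure_sheaf M2 W),
    (forall z, W z -> exists y : set_type N2,
       [/\ set_val y = z, V (set_val (g y)) & u z = t (set_val (g y))]) /\
    phi U s x = germ Wx u.

Definition inducing_biholomorphism : Prop :=
  [/\ range i1 `<=` N1, range i2 `<=` N2, biholomorphic g,
      forall (y : set_type N2) (x : M), set_val y = i2 x -> set_val (g y) = i1 x &
      induced_by_pullback].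

End Extension.

(* Main.v *)
From HB Require Import structures.
Require Import Defs.
From mathcomp Require Import all_boot all_order all_algebra.
From mathcomp Require Import complex ring lra.
From mathcomp Require Import all_classical all_reals all_analysis.
Set Implicit Arguments. Unset Strict Implicit. Unset Printing Implicit Defensive.
Import Order.TTheory GRing.Theory Num.Theory.
Import numFieldNormedType.Exports.
Local Open Scope classical_set_scope.
Local Open Scope ring_scope.


(** Everything rests on the following fact. A homomorphism of C-algebras from the germs
of holomorphic functions at a point a of C^k to those at a point b of C^l that preserves
the values at these points is the pull-back by a holomorphic map, whose components are
the images of the coordinates ([germ_hom_pullback]). By Hadamard's lemma a holomorphic
function f is f(a) + sum_j (z_j - a_j) f_j with holomorphic f_j ([hadamard]). By
induction on s, the homomorphism and the pull-back agree up to functions that vanish to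
order s at b, and a holomorphic function that vanishes to infinite order at b is 0
near b ([vanish_all_eq0]). So if a sheaf A on M is identified, in two ways, with the
functions near M on complex manifolds that contain M, then the identifications are
compared, near each point of M, by a holomorphic map between the manifolds that is
unique as a germ along M ([transition_ex], [induces_unique]).

Holomorphic means complex differentiable. Hadamard's lemma and the identity theorem are
derived from a maximum principle for functions with finitely many isolated
singularities, near which they are bounded ([maximum_principle]). It is
proved with Goursat's argument for trapezoidal sums in place of integrals, on diamonds in
place of circles. It bounds difference quotients ([lipschitz_off]), and a chain of such
bounds shows that the divided difference of a holomorphic function in one coordinate
is holomorphic ([differentiable_ddiff]), which gives Hadamard's lemma one coordinate at a
time.

For the existence of M', one takes a locally finite cover of M by open sets V_i with local
models in C^(m+n), and a smaller cover by W_i with the closure of W_i in V_i. Germs of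
maps along a closed subset of a paracompact space can be glued, by Godement's
argument ([glue_germs]), so that for all i and j there is one transition map g_ij along
the intersection of the closures of V_i and V_j. The g_ij satisfy the cocycle
conditions near M. In each model, the points over W_j at which these conditions hold
for the finitely many indices that matter form a neighbourhood of the image of W_j
([compatible_near]), and
M' is obtained from these open sets by identifying p with g_ij(p). As the parts over the
closures of the W_i are closed, M' is regular; it is paracompact because it is regular
and has a locally finite cover by open sets with countable bases
([paracompact_of_bases]). A representative of a section of A in one model, as a function
near M on M', does not depend on the model, which identifies A with the inverse image of
the structure sheaf ([glued_thickening]).

For the uniqueness, phi compares the functions on M_1' and M_2'. The local maps from M_2'
to M_1' that induce phi, and those in the other direction that induce its inverse, are
glued in the same way along the closed image of M ([pulls_glue]). Their composites induce
the identity, so they are inverse to each other near M. *)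

(** * Real-valued norms *)

Section RealNorm.
Variable R : realType.
Local Notation C := (complex_field R).

(** As [real_complex], but with the normed field C as codomain, so that its norm and
its topology are inferred. *)
Definition rc (a : R) : C := (a%:C)%C.

Fact rc_zmod : zmod_morphism rc. Proof. exact: (rmorphB (real_complex R)). Qed.
Fact rc_monoid : monoid_morphism rc.
Proof. by split=> // a b; exact: (rmorphM (real_complex R)). Qed.
HB.instance Definition _ := GRing.isZmodMorphism.Build R C rc rc_zmod.
HB.instance Definition _ := GRing.isMonoidMorphism.Build R C rc rc_monoid.

Lemma rcD a b : rc (a + b) = rc a + rc b. Proof. exact: (rmorphD (real_complex R)). Qed.
Lemma rcM a b : rc (a * b) = rc a * rc b. Proof. exact: (rmorphM (real_complex R)). Qed.
Lemma rcN a : rc (- a) = - rc a. Proof. exact: (rmorphN (real_complex R)). Qed.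

Lemma rcI : injective rc. Proof. exact: complexI. Qed.

(** The norms of complex normed modules take values in C. The order of C is partial;
estimates are made with the norm as a real number. *)
Definition nrm (V : normedModType C) (v : V) : R := complex.Re (`|v| : R[i]).

Variable V : normedModType C.
Implicit Types (u v w : V).

Lemma ge0_realC (x : C) : 0 <= x -> x = rc (complex.Re (x : R[i])).
Proof. by case: x => a b h; have /= -> := @ger0_Im _ _ h. Qed.

Lemma nrmE v : `|v| = rc (nrm v) :> C.
Proof. exact: ge0_realC (normr_ge0 v). Qed.

Lemma lecRE (a b : R) : (rc a <= rc b) = (a <= b).
Proof. exact: lecR. Qed.

Lemma ltcRE (a b : R) : (rc a < rc b) = (a < b).
Proof. exact: ltcR. Qed.

Lemma nrm_ge0 v : 0 <= nrm v.
Proof. by rewrite -lecRE -nrmE; exact: normr_ge0. Qed.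

Lemma nrm0 : nrm (0 : V) = 0.
Proof. by rewrite /nrm normr0. Qed.

Lemma nrmN v : nrm (- v) = nrm v.
Proof. by rewrite /nrm normrN. Qed.

Lemma nrmB v w : nrm (v - w) = nrm (w - v).
Proof. by rewrite -nrmN opprB. Qed.

Lemma nrm_eq0 v : (nrm v == 0) = (v == 0).
Proof.
rewrite -[v == 0]normr_eq0 nrmE; apply/eqP/eqP => [->//|].
by move=> /(congr1 (@complex.Re R)).
Qed.

Lemma nrm_gt0 v : (0 < nrm v) = (v != 0).
Proof. by rewrite lt_def nrm_eq0 nrm_ge0 andbT. Qed.

Lemma nrmD v w : nrm (v + w) <= nrm v + nrm w.
Proof. by rewrite -lecRE rcD -!nrmE; exact: ler_normD. Qed.

Lemma nrmDB v w : nrm (v - w) <= nrm v + nrm w.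
Proof. by rewrite -(nrmN w); exact: nrmD. Qed.

Lemma nrm_tri u v w : nrm (u - w) <= nrm (u - v) + nrm (v - w).
Proof. by have := nrmD (u - v) (v - w); rewrite addrA subrK. Qed.

Lemma nrm_perturb u u' v v' (e : R) : nrm (u' - u) <= e -> nrm (v' - v) <= e ->
  nrm (u - v) <= nrm (u' - v') + 2 * e.
Proof.
have := nrm_tri u u' v; have := nrm_tri u' v' v.
by rewrite (nrmB u u'); lra.
Qed.

Lemma nrmZ (a : C) v : nrm (a *: v) = nrm (a : C^o) * nrm v.
Proof. by apply: rcI; rewrite rcM -!nrmE; exact: normrZ. Qed.

Lemma near_nrm (x : V) (P : set V) :
  (\forall y \near x, P y) <-> exists2 d : R, 0 < d & forall y, nrm (y - x) < d -> P y.
Proof.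
split=> [/nbhs_normP[e /= e0 h]|[d d0 h]]; last first.
  apply/nbhs_normP; exists (rc d) => /=; first by rewrite ltcRE.
  by move=> y; rewrite /ball_ /= nrmE ltcRE nrmB => /h.
have [r er] : exists r : R, e = rc r.
  by exists (complex.Re (e : R[i])); exact/ge0_realC/ltW.
rewrite er ltcRE in e0; exists r => // y yx; apply: h.
by rewrite /ball_ /= distrC er nrmE ltcRE.
Qed.

End RealNorm.
Arguments nrm {R V}.

Section ScalarNorm.
Variable R : realType.
Local Notation C := (complex_field R).
Implicit Types z w : C.

Lemma nrmM z w : nrm (z * w) = nrm z * nrm w.
Proof. exact: nrmZ. Qed.

Lemma nrm1 : nrm (1 : C) = 1.
Proof. by rewrite /nrm normr1. Qed.

Lemma nrmX z n : nrm (z ^+ n) = nrm z ^+ n.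
Proof. by elim: n => [|n IH]; rewrite ?nrm1 // !exprS nrmM IH. Qed.

Lemma nrmV z : nrm z^-1 = (nrm z)^-1.
Proof.
have [->|z0] := eqVneq z 0; first by rewrite invr0 nrm0 invr0.
have h : nrm z != 0 by rewrite nrm_eq0.
by apply: (mulfI h); rewrite -nrmM !divff // nrm1.
Qed.

Lemma nrm_real (a : R) : nrm (rc a) = `|a|.
Proof.
apply: rcI; rewrite -nrmE.
have [a0|a0] := lerP 0 a.
  by have h : 0 <= rc a by [rewrite -(lecRE 0 a) in a0]; rewrite (ger0_norm a0) ger0_norm.
have h : rc a < 0 by rewrite -(ltcRE a 0) in a0.
by rewrite (ltr0_norm a0) ltr0_norm // rcN.
Qed.

Lemma nrm_sqrt z :
  nrm z = Num.sqrt (complex.Re (z : R[i]) ^+ 2 + complex.Im (z : R[i]) ^+ 2).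
Proof. by case: z. Qed.

Lemma Re_le_nrm z : `|complex.Re (z : R[i])| <= nrm z.
Proof. by rewrite nrm_sqrt -sqrtr_sqr ler_wsqrtr // lerDl sqr_ge0. Qed.

Lemma Im_le_nrm z : `|complex.Im (z : R[i])| <= nrm z.
Proof. by rewrite nrm_sqrt -sqrtr_sqr ler_wsqrtr // lerDr sqr_ge0. Qed.

Lemma nrm_le_ReIm (z : C) :
  nrm z <= `|complex.Re (z : R[i])| + `|complex.Im (z : R[i])|.
Proof.
rewrite nrm_sqrt; set a := complex.Re _; set b := complex.Im _.
rewrite -(ler_pXn2r (n:=2)) ?nnegrE ?addr_ge0 ?sqrtr_ge0 //.
rewrite sqr_sqrtr ?addr_ge0 ?sqr_ge0 // -(real_normK (num_real a)) -(real_normK (num_real b)).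
by have := normr_ge0 a; have := normr_ge0 b; nra.
Qed.

End ScalarNorm.

Section Differentiability.
Variable R : realType.
Local Notation C := (complex_field R).
Variables V W : normedModType C.

(** The epsilon-delta form of differentiability, with real epsilon and delta. *)
Definition approx_by (f : V -> W) (p : V) (D : V -> W) : Prop :=
  forall e : R, 0 < e -> exists2 d : R, 0 < d &
    forall v, nrm v < d -> nrm (f (p + v) - f p - D v) <= e * nrm v.

Lemma diff_approx (f : V -> W) p : differentiable f p -> approx_by f p ('d f p).
Proof.
move=> df e e0.
have e0' : 0 < rc e by rewrite ltcRE.
have {}h : \forall v \near (0 : V),
    `|f (v + p) - (f p + 'd f p v)| <= rc e * `|v|.
  have /diff_locallyP[_ H] := df.
  by move/eqaddoP: H => /(_ _ e0').
have [d d0 {}h] := (near_nrm _ _).1 h.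
exists d => // v vd; have := h v; rewrite subr0 => /(_ vd).
by rewrite !nrmE -rcM lecRE opprD addrA (addrC v).
Qed.

Lemma approx_diff (f : V -> W) p (D : {linear V -> W}) : continuous D ->
  approx_by f p D -> differentiable f p.
Proof.
move=> cD ap.
have h : f \o shift p = cst (f p) + D +o_ 0 id.
  apply/eqaddoP => e e0.
  have er : e = rc (complex.Re (e : R[i])) by exact/ge0_realC/ltW.
  rewrite er ltcRE in e0.
  have [d d0 {}ap] := ap _ e0.
  apply/(near_nrm (0 : V)); exists d => // v; rewrite subr0 => vd.
  rewrite er !nrmE -rcM lecRE; have := ap v vd.
  by rewrite !fctE /= opprD addrA (addrC v).
have dE := diff_unique cD h.
by apply/diff_locallyP; rewrite dE.
Qed.

End Differentiability.

(** * Cauchy's theorem by trapezoidal sums *)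

(** Holomorphic means complex differentiable at every point. What complex analysis has
to supply below is that bounded holomorphic functions satisfy a maximum principle, and
the integral is replaced by trapezoidal sums over segments: these are exact on affine
functions, which is all that Goursat's argument needs. *)

Section GeometricLimit.
Variable R : realType.
Local Notation C := (complex_field R).

Lemma real_geometric_limit (x : nat -> R) (K : R) :
  (forall n, `|x n.+1 - x n| <= K / 2 ^+ n) ->
  exists L, forall n, `|x n - L| <= 2 * K / 2 ^+ n.
Proof.
move=> xK.
pose lo n := x n - 2 * K / 2 ^+ n; pose hi n := x n + 2 * K / 2 ^+ n.
have K0 : 0 <= K by have := xK 0; rewrite expr0 divr1; exact: le_trans.
have half n : K / 2 ^+ n.+1 = K / 2 ^+ n / 2 by rewrite exprSr invfM mulrA.
have lohi n : lo n <= hi n.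
  by have := divr_ge0 K0 (exprn_ge0 n (ler0n R 2)); rewrite /lo /hi; lra.
have los n : lo n <= lo n.+1.
  have := xK n; rewrite ler_norml => /andP[h _].
  by rewrite /lo -!mulrA half; lra.
have his n : hi n.+1 <= hi n.
  have := xK n; rewrite ler_norml => /andP[_ h].
  by rewrite /hi -!mulrA half; lra.
have lom m n : (m <= n)%N -> lo m <= lo n.
  by move=> /subnK <-; elim: (n - m)%N => // k IH; rewrite addSn (le_trans IH).
have him m n : (m <= n)%N -> hi n <= hi m.
  by move=> /subnK <-; elim: (n - m)%N => // k IH; rewrite addSn (le_trans _ IH).
have bnd m n : lo m <= hi n.
  apply: (le_trans (lom _ _ (leq_maxl m n))).
  by apply: (le_trans (lohi _)); apply: him; exact: leq_maxr.
have ubE n : ubound (range lo) (hi n) by move=> _ [m _ <-].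
have hs : has_sup (range lo) by split; [exists (lo 0%N), 0%N | exists (hi 0%N)].
exists (sup (range lo)) => n.
have h1 : lo n <= sup (range lo) by apply: (sup_upper_bound hs); exists n.
have h2 : sup (range lo) <= hi n by apply: ge_sup => //; exists (lo 0%N), 0%N.
by move: h1 h2; rewrite /lo /hi ler_norml; lra.
Qed.

Lemma geometric_limit (a : nat -> C) (K : R) :
  (forall n, nrm (a n.+1 - a n) <= K / 2 ^+ n) ->
  exists L, forall n, nrm (a n - L) <= 4 * K / 2 ^+ n.
Proof.
move=> aK; pose re n := complex.Re (a n : R[i]); pose im n := complex.Im (a n : R[i]).
have [l hl] : exists l, forall n, `|re n - l| <= 2 * K / 2 ^+ n.
  apply: real_geometric_limit => n; apply: le_trans (aK n).
  apply: le_trans (Re_le_nrm _).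
  by rewrite /re; case: (a n.+1) (a n) => ? ? [].
have [l' hl'] : exists l, forall n, `|im n - l| <= 2 * K / 2 ^+ n.
  apply: real_geometric_limit => n; apply: le_trans (aK n).
  apply: le_trans (Im_le_nrm _).
  by rewrite /im; case: (a n.+1) (a n) => ? ? [].
exists (Complex l l') => n; apply: (le_trans (nrm_le_ReIm _)).
have -> : 4 * K / 2 ^+ n = 2 * K / 2 ^+ n + 2 * K / 2 ^+ n by lra.
have := lerD (hl n) (hl' n).
by rewrite /re /im; case: (a n).
Qed.

Lemma geom_small (K e : R) : 0 <= K -> 0 < e ->
  exists n, forall k, (n <= k)%N -> K / 2 ^+ k < e.
Proof.
move=> K0 e0; have Ke : 0 <= K / e by rewrite divr_ge0 // ltW.
exists (Num.truncn (K / e)).+1 => k nk.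
rewrite ltr_pdivrMr ?exprn_gt0 // mulrC -ltr_pdivrMr //.
apply: (lt_le_trans (truncnS_gt _)).
apply: (@le_trans _ _ (k%:R)); first by rewrite ler_nat.
by rewrite -natrX ler_nat ltnW // ltn_expl.
Qed.

End GeometricLimit.

Section Trapezoids.
Variable R : realType.
Local Notation C := (complex_field R).
Implicit Types (f g : C -> C) (a b c z : C) (P : set C).

Definition mid a b : C := (a + b) / 2.

(** The composite trapezoidal rule with 2^n equal steps, in a recursive form that fits
the subdivision of triangles. *)
Fixpoint trap f n a b : C :=
  if n is n'.+1 then trap f n' a (mid a b) + trap f n' (mid a b) b
  else (b - a) * ((f a + f b) / 2).

Lemma trapN f n a b : trap f n b a = - trap f n a b.
Proof.
elim: n a b => [|n IH] a b /=; first by rewrite (addrC (f b)) -mulNr opprB.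
rewrite (_ : mid b a = mid a b); last by rewrite /mid addrC.
by rewrite (IH (mid a b) b) (IH a (mid a b)) opprD addrC.
Qed.

Lemma trapB f g n a b :
  trap (fun z => f z - g z) n a b = trap f n a b - trap g n a b.
Proof.
elim: n a b => [|n IH] a b /=; last by rewrite !IH; ring.
by rewrite -mulrBr -mulrBl; congr (_ * (_ / 2)); ring.
Qed.

Lemma trapZ k f n a b : trap (fun z => k * f z) n a b = k * trap f n a b.
Proof.
elim: n a b => [|n IH] a b /=; last by rewrite !IH; ring.
by rewrite -mulrDr; ring.
Qed.

Lemma trap_affine k l n a b :
  trap (fun z => k + l * z) n a b = (b - a) * (k + l * mid a b).
Proof.
have two0 : (2 : C) != 0 by rewrite pnatr_eq0.
by elim: n a b => [|n IH] a b /=; rewrite ?IH /mid; field.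
Qed.

Definition midclosed P := forall a b, P a -> P b -> P (mid a b).

Lemma nrm2 : nrm (2 : C) = 2.
Proof. by have := nrm_real (2 : R); rewrite /rc rmorph_nat ger0_norm. Qed.

Lemma nrm_mid a b : nrm (mid a b) <= (nrm a + nrm b) / 2.
Proof. by rewrite /mid nrmM nrmV nrm2; have := nrmD a b; lra. Qed.

Lemma mid_subl a b : mid a b - a = (b - a) / 2.
Proof. by rewrite /mid; have two0 : (2 : C) != 0 by []; field. Qed.

Lemma mid_subr a b : b - mid a b = (b - a) / 2.
Proof. by rewrite /mid; have two0 : (2 : C) != 0 by []; field. Qed.

Lemma trap_bound P f n a b (M : R) : midclosed P -> P a -> P b ->
  (forall z, P z -> nrm (f z) <= M) -> nrm (trap f n a b) <= nrm (b - a) * M.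
Proof.
move=> mP + + fM; elim: n a b => [|n IH] a b Pa Pb /=.
  rewrite nrmM ler_wpM2l ?nrm_ge0 //; apply: (le_trans (nrm_mid (f a) (f b))).
  by have := fM a Pa; have := fM b Pb; lra.
have Pm := mP a b Pa Pb; apply: (le_trans (nrmD _ _)).
apply: (le_trans (lerD (IH _ _ Pa Pm) (IH _ _ Pm Pb))).
by rewrite mid_subl mid_subr nrmM nrmV nrm2; lra.
Qed.

Lemma midclosed_ball z (r : R) : midclosed [set w | nrm (w - z) <= r].
Proof.
move=> a b /= ar br.
have -> : mid a b - z = mid (a - z) (b - z).
  by rewrite /mid; have two0 : (2 : C) != 0 by []; field.
by apply: (le_trans (nrm_mid _ _)); lra.
Qed.

Definition tri f n a b c : C := trap f n a b + trap f n b c + trap f n c a.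

Lemma triS f n a b c :
  tri f n.+1 a b c = tri f n a (mid a b) (mid c a) + tri f n (mid a b) b (mid b c)
   + tri f n (mid c a) (mid b c) c + tri f n (mid a b) (mid b c) (mid c a).
Proof.
rewrite /tri /= (trapN f n (mid a b) (mid c a)) (trapN f n (mid a b) (mid b c)).
by rewrite (trapN f n (mid b c) (mid c a)); ring.
Qed.

(** The one-variable case of [approx_by], with a number in place of a linear map. *)
Definition cdiff f z := exists l : C, forall e : R, 0 < e ->
  exists2 d : R, 0 < d & forall w, nrm (w - z) < d ->
    nrm (f w - f z - l * (w - z)) <= e * nrm (w - z).

Lemma differentiable_cdiff f z : differentiable f z -> cdiff f z.
Proof.
move=> /diff_approx h; exists ('d f z 1) => e /h[d d0 {}h].
exists d => // w wd; have := h (w - z) wd.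
rewrite (addrC z) subrK.
have -> : 'd f z (w - z) = 'd f z 1 * (w - z).
  by rewrite -[w - z in LHS]mulr1 -[(w - z) * 1]/((w - z) *: (1 : C^o)) linearZ /= mulrC.
by [].
Qed.

(** Geometrically convergent sequences suffice: the only limit that is taken is that of
the corners of nested triangles. *)
Definition limclosed P := forall (u : nat -> C) (K : R) L,
  (forall n, P (u n)) -> (forall n, nrm (u n - L) <= K / 2 ^+ n) -> P L.

(** Goursat's lemma for trapezoidal sums instead of integrals. If the sums do not
tend to 0, then neither do those over one of the four half-size triangles,
with a quarter of the defect; at the common limit of the nested triangles the
function is affine up to a small error, and trapezoidal sums are exact on affine
functions. *)
Lemma goursat P f a b c : midclosed P -> limclosed P ->
  (forall z, P z -> cdiff f z) -> P a -> P b -> P c ->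
  forall e : R, 0 < e -> exists N, forall n, (N <= n)%N -> nrm (tri f n a b c) <= e.
Proof.
move=> mP lP df Pa Pb Pc e e0; apply: contrapT => hN.
pose bad (t : C * C * C) (e : R) := ~ exists N, forall n, (N <= n)%N ->
  nrm (tri f n t.1.1 t.1.2 t.2) <= e.
pose d := nrm (b - a) + nrm (c - b) + nrm (a - c).
have d0 : 0 <= d by rewrite !addr_ge0 ?nrm_ge0.
pose good k (t : C * C * C) := [/\ [/\ P t.1.1, P t.1.2 & P t.2], bad t (e / 4 ^+ k) &
  [/\ nrm (t.1.2 - t.1.1) <= d / 2 ^+ k, nrm (t.2 - t.1.2) <= d / 2 ^+ k &
      nrm (t.1.1 - t.2) <= d / 2 ^+ k]].
have half k : d / 2 ^+ k.+1 = d / 2 ^+ k / 2 by rewrite exprSr invfM mulrA.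
have nh z : nrm (z / 2) = nrm z / 2 by rewrite nrmM nrmV nrm2.
have step k t : good k t -> exists t', good k.+1 t' /\
    nrm (t'.1.1 - t.1.1) <= d / 2 ^+ k.
  case: t => [[u v] w] [/= [Pu Pv Pw] B [h1 h2 h3]].
  have two0 : (2 : C) != 0 by [].
  have Puv := mP _ _ Pu Pv; have Pvw := mP _ _ Pv Pw; have Pwu := mP _ _ Pw Pu.
  have s1 : nrm ((v - u) / 2) <= d / 2 ^+ k.+1 by rewrite half nh; lra.
  have s2 : nrm ((w - v) / 2) <= d / 2 ^+ k.+1 by rewrite half nh; lra.
  have s3 : nrm ((u - w) / 2) <= d / 2 ^+ k.+1 by rewrite half nh; lra.
  have s0 : d / 2 ^+ k.+1 <= d / 2 ^+ k.
    by rewrite half; have := divr_ge0 d0 (exprn_ge0 k (ler0n R 2)); lra.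
  have z0 : nrm (u - u) <= d / 2 ^+ k by rewrite subrr nrm0 divr_ge0 ?exprn_ge0.
  have e1 : mid u v - u = (v - u) / 2 := mid_subl u v.
  have e2 : mid v w - mid u v = - ((u - w) / 2) by rewrite /mid; field.
  have e3 : mid w u - mid u v = (w - v) / 2 by rewrite /mid; field.
  have e4 : u - mid w u = (u - w) / 2 := mid_subr w u.
  have e5 : v - mid u v = (v - u) / 2 := mid_subr u v.
  have e6 : mid v w - v = (w - v) / 2 := mid_subl v w.
  have e7 : mid u v - mid v w = (u - w) / 2 by rewrite /mid; field.
  have e8 : mid v w - mid w u = (v - u) / 2 by rewrite /mid; field.
  have e9 : w - mid v w = (w - v) / 2 := mid_subr v w.
  have e10 : mid w u - w = (u - w) / 2 := mid_subl w u.
  have e11 : mid w u - mid v w = - ((v - u) / 2) by rewrite -opprB e8.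
  have e12 : mid u v - mid w u = - ((w - v) / 2) by rewrite -opprB e3.
  have e13 : mid w u - u = - ((u - w) / 2) by rewrite -opprB e4.
  apply: contrapT => no; apply: B.
  have notbad t' : (good k.+1 t' -> False) ->
      [/\ P t'.1.1, P t'.1.2 & P t'.2] ->
      [/\ nrm (t'.1.2 - t'.1.1) <= d / 2 ^+ k.+1, nrm (t'.2 - t'.1.2) <= d / 2 ^+ k.+1 &
        nrm (t'.1.1 - t'.2) <= d / 2 ^+ k.+1] ->
      exists N, forall n, (N <= n)%N -> nrm (tri f n t'.1.1 t'.1.2 t'.2) <= e / 4 ^+ k.+1.
    by move=> ng Pt st; apply: contrapT => bt; apply: ng.
  have [|||N1 H1] := notbad (u, mid u v, mid w u); rewrite /= ?(e1, e3, e4) //.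
    by move=> g; apply: no; exists (u, mid u v, mid w u).
  have [|||N2 H2] := notbad (mid u v, v, mid v w); rewrite /= ?(e5, e6, e7) //.
    move=> g; apply: no; exists (mid u v, v, mid v w); split=> //=.
    by rewrite e1 (le_trans s1).
  have [|||N3 H3] := notbad (mid w u, mid v w, w); rewrite /= ?(e8, e9, e10) //.
    move=> g; apply: no; exists (mid w u, mid v w, w); split=> //=.
    by rewrite e13 nrmN (le_trans s3).
  have [|||N4 H4] := notbad (mid u v, mid v w, mid w u); rewrite /= ?(e2, e11, e12) ?nrmN //.
    move=> g; apply: no; exists (mid u v, mid v w, mid w u); split=> //=.
    by rewrite e1 (le_trans s1).
  exists (N1 + N2 + N3 + N4).+1 => -[//|n]; rewrite ltnS => Nn.
  have e4E : e / 4 ^+ k = e / 4 ^+ k.+1 * 4 by rewrite exprSr invfM mulrA mulfVK.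
  rewrite e4E triS.
  have /H1 /= {}H1 : (N1 <= n)%N by apply: leq_trans Nn; rewrite -!addnA leq_addr.
  have /H2 /= {}H2 : (N2 <= n)%N.
    by apply: leq_trans Nn; rewrite (addnC N1) -!addnA leq_addr.
  have /H3 /= {}H3 : (N3 <= n)%N.
    by apply: leq_trans Nn; rewrite addnAC leq_addl.
  have /H4 /= {}H4 : (N4 <= n)%N by apply: leq_trans Nn; rewrite leq_addl.
  apply: (le_trans (nrmD _ _)); apply: (le_trans (lerD (nrmD _ _) (lexx _))).
  by apply: (le_trans (lerD (lerD (nrmD _ _) (lexx _)) (lexx _))); lra.
pose next k t := xget t [set t' | good k.+1 t' /\ nrm (t'.1.1 - t.1.1) <= d / 2 ^+ k].
pose s := fix s n := if n is k.+1 then next k (s k) else (a, b, c).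
have g0 : good 0%N (a, b, c).
  split=> //=; first by rewrite expr0 divr1.
  by rewrite expr0 divr1 /d; split; have := nrm_ge0 (b - a);
    have := nrm_ge0 (c - b); have := nrm_ge0 (a - c); lra.
have nextP k t : good k t -> good k.+1 (next k t) /\ nrm ((next k t).1.1 - t.1.1) <= d / 2 ^+ k.
  move=> /step; exact: (@xgetPex _ t [set t' | good k.+1 t' /\ nrm (t'.1.1 - t.1.1) <= d / 2 ^+ k]).
have gs k : good k (s k) by elim: k => //= k /nextP[].
have ds k : nrm ((s k.+1).1.1 - (s k).1.1) <= d / 2 ^+ k by have [] := nextP _ _ (gs k).
have [p hp] := geometric_limit ds.
have Pp : P p by apply: (lP _ _ _ _ hp) => n; have [[]] := gs n.
have [l hl] := df p Pp.
pose e' := e / (16 * (d ^+ 2 + 1)).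
have d20 : 0 < d ^+ 2 + 1 by rewrite ltr_wpDl ?sqr_ge0.
have e'0 : 0 < e' by rewrite /e' divr_gt0 // mulr_gt0.
have [del del0 {}hl] := hl e' e'0.
have [k hk] := geom_small (mulr_ge0 (ler0n R 5) d0) del0.
have {hk} hk := hk k (leqnn k).
have [[Pu Pv Pw] B [h1 h2 h3]] := gs k.
apply: B; exists 0%N => n _.
move: (s k) (hp k) Pu Pv Pw h1 h2 h3 => [[u v] w] /= up Pu Pv Pw h1 h2 h3.
set D := d / 2 ^+ k in h1 h2 h3.
have D0 : 0 <= D by rewrite divr_ge0 ?exprn_ge0.
have {}up : nrm (u - p) <= 4 * D by rewrite /D mulrA.
have {}hk : 5 * D < del by rewrite /D mulrA.
pose g z := (f p - l * p) + l * z.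
have -> : tri f n u v w = tri (fun z => f z - g z) n u v w.
  have -> : tri (fun z => f z - g z) n u v w = tri f n u v w - tri g n u v w.
    by rewrite /tri !trapB; ring.
  rewrite [tri g _ _ _ _](_ : _ = 0) ?subr0 // /tri /g !trap_affine /mid.
  by have two0 : (2 : C) != 0 by []; field.
have fg z : [set z | nrm (z - u) <= D] z -> nrm (f z - g z) <= e' * (5 * D).
  move=> /= zu; have zp : nrm (z - p) <= 5 * D.
    by apply: (le_trans (nrm_tri z u p)); lra.
  have -> : f z - g z = f z - f p - l * (z - p) by rewrite /g; ring.
  apply: (le_trans (hl z (le_lt_trans zp hk))).
  by rewrite ler_pM2l.
have ba := trap_bound n (@midclosed_ball u D) _ _ fg.
have uD : nrm (u - u) <= D by rewrite subrr nrm0.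
have vD : nrm (v - u) <= D by [].
have wD : nrm (w - u) <= D by rewrite nrmB.
have t1 := ba _ _ uD vD; have t2 := ba _ _ vD wD; have t3 := ba _ _ wD uD.
have B0 : 0 <= e' * (5 * D) by rewrite mulr_ge0 ?(ltW e'0) // mulr_ge0.
apply: (le_trans (nrmD _ _)); apply: (le_trans (lerD (nrmD _ _) (lexx _))).
apply: (@le_trans _ _ (3 * D * (e' * (5 * D)))).
  have := ler_wpM2r B0 h1; have := ler_wpM2r B0 h2; have := ler_wpM2r B0 h3.
  by move: t1 t2 t3; lra.
have -> : 3 * D * (e' * (5 * D)) = e / 4 ^+ k * (15 * d ^+ 2 / (16 * (d ^+ 2 + 1))).
  rewrite /D /e' (_ : 4 = 2 ^+ 2 :> R); last by rewrite -natrX.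
  rewrite -exprM mulnC exprM.
  have h2k : (2 ^+ k : R) != 0 by rewrite expf_neq0.
  have hd : d ^+ 2 + 1 != 0 by rewrite gt_eqF.
  by move: (2 ^+ k) h2k => q h2k; field; rewrite hd h2k.
have ek : 0 <= e / 4 ^+ k by rewrite divr_ge0 ?exprn_ge0 // ltW.
rewrite -[leRHS]mulr1 ler_wpM2l //.
by rewrite ler_pdivrMr ?mul1r ?mulr_gt0 //; have := sqr_ge0 d; lra.
Qed.

End Trapezoids.

Section Diamond.
Variable R : realType.
Local Notation C := (complex_field R).
Implicit Types (f F : C -> C) (e u v z : C) (P : set C) (r t : R).

Definition reC z : R := complex.Re (z : R[i]).
Definition imC z : R := complex.Im (z : R[i]).
Definition cpx (a b : R) : C := Complex a b.

Lemma reCD u v : reC (u + v) = reC u + reC v. Proof. by case: u v => ? ? []. Qed.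
Lemma reCB u v : reC (u - v) = reC u - reC v. Proof. by case: u v => ? ? []. Qed.
Lemma imCD u v : imC (u + v) = imC u + imC v. Proof. by case: u v => ? ? []. Qed.
Lemma reCZ r u : reC (rc r * u) = r * reC u.
Proof. by case: u => a b; rewrite /reC /= mul0r subr0. Qed.
Lemma imCZ r u : imC (rc r * u) = r * imC u.
Proof. by case: u => a b; rewrite /imC /= mul0r addr0. Qed.

Lemma rc_half : rc (2^-1 : R) = (2 : C)^-1.
Proof. by rewrite fmorphV rmorph_nat. Qed.

Lemma midE u v : mid u v = rc 2^-1 * (u + v).
Proof. by rewrite rc_half mulrC. Qed.

(** For positive t this part of a disc avoids the centre; such sets contain the
quadrilaterals into which the region between two diamonds is divided. *)
Definition cap e t r : set C := [set z : C | nrm z <= r /\ t <= reC (z * e)].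

Lemma cap_midclosed e t r : midclosed (cap e t r).
Proof.
move=> a b [ar ta] [br tb]; split.
  by apply: (le_trans (nrm_mid _ _)); lra.
by rewrite midE -mulrA reCZ mulrDl reCD; lra.
Qed.

Lemma cap_limclosed e t r : limclosed (cap e t r).
Proof.
move=> u K L uP uL.
have K0 : 0 <= K by have := uL 0%N; rewrite expr0 divr1; exact/le_trans/nrm_ge0.
split.
  apply/ler_addgt0Pr => d d0; have [n /(_ n (leqnn n)) hn] := geom_small K0 d0.
  have := nrmD (L - u n) (u n); rewrite subrK nrmB => h.
  by have := uL n; have [] := uP n; lra.
apply/ler_addgt0Pr => d d0.
have [n /(_ n (leqnn n)) hn] := geom_small (mulr_ge0 (nrm_ge0 e) K0) d0.
have [_ h] := uP n.
have -> : reC (L * e) = reC (u n * e) - reC ((u n - L) * e).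
  by rewrite -reCB -mulrBl opprB addrC subrK.
have : reC ((u n - L) * e) <= nrm e * (K / 2 ^+ n).
  apply: (le_trans (ler_norm _)); apply: (le_trans (Re_le_nrm _)).
  by rewrite nrmM mulrC ler_wpM2l ?nrm_ge0.
by rewrite mulrA; lra.
Qed.

Lemma cap_neq0 e t r z : 0 < t -> cap e t r z -> z != 0.
Proof.
move=> t0 [_ tz]; apply/eqP => z0; rewrite z0 mul0r in tz.
by have := lt_le_trans t0 tz; rewrite ltxx.
Qed.

(** The sum over the boundary of the diamond with vertices r, ir, -r, -ir, which
stands for the integral over the circle of radius r. *)
Definition Lam F n r : C :=
  trap F n (cpx r 0) (cpx 0 r) + trap F n (cpx 0 r) (cpx (- r) 0) +
  trap F n (cpx (- r) 0) (cpx 0 (- r)) + trap F n (cpx 0 (- r)) (cpx r 0).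

Lemma nrm_cpx a b : nrm (cpx a b) <= `|a| + `|b|.
Proof. exact: nrm_le_ReIm. Qed.

(** Cauchy's theorem for a quarter of the region between the diamonds of radii r and
r / 2. The function may be singular at 0. *)
Lemma quadrilateral F e r a b : 0 < r ->
  (forall z, nrm z <= r -> z != 0 -> cdiff F z) ->
  cap e r r a -> cap e r r b ->
  forall d : R, 0 < d -> exists N, forall n, (N <= n)%N ->
    nrm (tri F n a b (a / 2) + tri F n b (b / 2) (a / 2)) <= d.
Proof.
move=> r0 dF [na ta] [nb tb] d d0.
have dF' z : cap e (r / 2) r z -> cdiff F z.
  by move=> hz; apply: dF; [case: hz|apply: cap_neq0 hz; lra].
have [mP lP] := (@cap_midclosed e (r / 2) r, @cap_limclosed e (r / 2) r).
have Pa : cap e (r / 2) r a by split=> //; lra.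
have Pb : cap e (r / 2) r b by split=> //; lra.
have half z : cap e r r z -> cap e (r / 2) r (z / 2).
  move=> [nz tz]; split; first by rewrite nrmM nrmV nrm2; have := nrm_ge0 z; lra.
  by rewrite -rc_half (mulrC z) -mulrA reCZ; lra.
have Pa2 := half a (conj na ta); have Pb2 := half b (conj nb tb).
have d20 : 0 < d / 2 by lra.
have [N1 H1] := goursat mP lP dF' Pa Pb Pa2 d20.
have [N2 H2] := goursat mP lP dF' Pb Pb2 Pa2 d20.
exists (N1 + N2)%N => n hn; apply: (le_trans (nrmD _ _)).
have := H1 n (leq_trans (leq_addr _ _) hn).
by have := H2 n (leq_trans (leq_addl _ _) hn); lra.
Qed.

(** The sums over the common sides of the four quadrilaterals cancel. *)
Lemma Lam_half F r : 0 < r -> (forall z, nrm z <= r -> z != 0 -> cdiff F z) ->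
  forall d : R, 0 < d -> exists N, forall n, (N <= n)%N ->
    nrm (Lam F n r - Lam F n (r / 2)) <= d.
Proof.
move=> r0 dF d d0; have d40 : 0 < d / 4 by lra.
have nr : `|r| = r by rewrite gtr0_norm.
have nr' : `|- r| = r by rewrite normrN gtr0_norm.
have side a b c g x y : `|a| + `|b| = r -> `|c| + `|g| = r ->
    a * x - b * y = r -> c * x - g * y = r -> exists N, forall n, (N <= n)%N ->
    nrm (tri F n (cpx a b) (cpx c g) (cpx a b / 2) +
         tri F n (cpx c g) (cpx c g / 2) (cpx a b / 2)) <= d / 4.
  move=> ab cg ta tc; apply: (@quadrilateral F (cpx x y) r) => //.
    by split; [rewrite (le_trans (nrm_cpx _ _)) ?ab|rewrite /reC /= ta].
  by split; [rewrite (le_trans (nrm_cpx _ _)) ?cg|rewrite /reC /= tc].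
have [||||N1 H1] := side r 0 0 r 1 (-1);
  do ?[by rewrite ?(nr, nr', normr0) ?addr0 ?add0r | by ring].
have [||||N2 H2] := side 0 r (- r) 0 (-1) (-1);
  do ?[by rewrite ?(nr, nr', normr0) ?addr0 ?add0r | by ring].
have [||||N3 H3] := side (- r) 0 0 (- r) (-1) 1;
  do ?[by rewrite ?(nr, nr', normr0) ?addr0 ?add0r | by ring].
have [||||N4 H4] := side 0 (- r) r 0 1 1;
  do ?[by rewrite ?(nr, nr', normr0) ?addr0 ?add0r | by ring].
exists (N1 + N2 + N3 + N4)%N => n Nn.
have /H1 {}H1 : (N1 <= n)%N by apply: leq_trans Nn; rewrite -!addnA leq_addr.
have /H2 {}H2 : (N2 <= n)%N.
  by apply: leq_trans Nn; rewrite (addnC N1) -!addnA leq_addr.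
have {}H3 := H3 n (leq_trans (leq_addl (N1 + N2) _) (leq_trans (leq_addr N4 _) Nn)).
have {}H4 := H4 n (leq_trans (leq_addl _ _) Nn).
have half a b : cpx a b / 2 = cpx (a / 2) (b / 2).
  rewrite -rc_half mulrC; apply/eqP; rewrite eq_complex /=.
  by rewrite !mul0r subr0 addr0 !(mulrC 2^-1) !eqxx.
rewrite !half mul0r mulNr in H1 H2 H3 H4.
set q1 := _ + _ in H1; set q2 := _ + _ in H2; set q3 := _ + _ in H3.
set q4 := _ + _ in H4.
have -> : Lam F n r - Lam F n (r / 2) = q1 + q2 + q3 + q4.
  rewrite /q1 /q2 /q3 /q4 /tri /Lam.
  set a := cpx r 0; set b := cpx 0 r; set c := cpx (- r) 0; set g := cpx 0 (- r).
  set a' := cpx (r / 2) 0; set b' := cpx 0 (r / 2).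
  set c' := cpx (- (r / 2)) 0; set g' := cpx 0 (- (r / 2)).
  rewrite (trapN F n a' b') (trapN F n b' c') (trapN F n c' g') (trapN F n g' a').
  rewrite (trapN F n a' b) (trapN F n b' c) (trapN F n c' g) (trapN F n g' a).
  rewrite (trapN F n a' a) (trapN F n b' b) (trapN F n c' c) (trapN F n g' g).
  by ring.
apply: (le_trans (nrmD _ _)); have h1 := nrmD (q1 + q2) q3; have h2 := nrmD q1 q2.
by lra.
Qed.

Lemma Lam_halves F r k : 0 < r -> (forall z, nrm z <= r -> z != 0 -> cdiff F z) ->
  forall d : R, 0 < d -> exists N, forall n, (N <= n)%N ->
    nrm (Lam F n r - Lam F n (r / 2 ^+ k)) <= d.
Proof.
move=> r0 dF; elim: k => [|k IH] d d0.
  by exists 0%N => n _; rewrite expr0 divr1 subrr nrm0 ltW.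
have d20 : 0 < d / 2 by lra.
have [N1 H1] := IH _ d20.
have rk0 : 0 < r / 2 ^+ k by rewrite divr_gt0 ?exprn_gt0.
have rkr : r / 2 ^+ k <= r.
  rewrite ler_pdivrMr ?exprn_gt0 //; apply: ler_peMr; first exact: ltW.
  by rewrite exprn_ege1 // ler1n.
have [N2 H2] := @Lam_half F _ rk0 (fun z zr => dF z (le_trans zr rkr)) _ d20.
exists (N1 + N2)%N => n hn; apply: (le_trans (nrm_tri _ (Lam F n (r / 2 ^+ k)) _)).
have := H1 n (leq_trans (leq_addr _ _) hn).
have := H2 n (leq_trans (leq_addl _ _) hn).
by rewrite exprSr invfM mulrA; lra.
Qed.

Lemma Lam_bound F n r (M : R) : 0 <= r -> 0 <= M ->
  (forall z, nrm z <= r -> r / 2 <= nrm z -> nrm (F z) <= M) ->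
  nrm (Lam F n r) <= 8 * r * M.
Proof.
move=> r0 M0 FM.
have nr : `|r| = r by rewrite ger0_norm.
have nr' : `|- r| = r by rewrite normrN ger0_norm.
have side e a b c g : nrm e <= 2 -> `|a| + `|b| = r -> `|c| + `|g| = r ->
    reC (cpx a b * e) = r -> reC (cpx c g * e) = r ->
    nrm (trap F n (cpx a b) (cpx c g)) <= 2 * r * M.
  move=> e2 ab cg ta tc.
  have Pa : cap e r r (cpx a b) by split; rewrite ?ta // -ab; exact: nrm_cpx.
  have Pc : cap e r r (cpx c g) by split; rewrite ?tc // -cg; exact: nrm_cpx.
  have FM' z : cap e r r z -> nrm (F z) <= M.
    move=> [zr tz]; apply: FM => //.
    have := le_trans tz (le_trans (ler_norm _) (Re_le_nrm _)); rewrite nrmM => h.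
    have := ler_wpM2l (nrm_ge0 z) e2; lra.
  have := trap_bound n (@cap_midclosed e r r) Pa Pc FM'.
  move=> /le_trans; apply; rewrite ler_wpM2r //.
  apply: (le_trans (nrmDB _ _)).
  by have := nrm_cpx a b; have := nrm_cpx c g; lra.
have e2 a b : `|a| = 1 -> `|b| = 1 -> nrm (cpx a b) <= 2.
  by move=> ha hb; apply: (le_trans (nrm_cpx _ _)); lra.
have n1 : `|1 : R| = 1 by rewrite normr1.
have n1' : `|-1 : R| = 1 by rewrite normrN1.
have s0 : nrm (trap F n (cpx r 0) (cpx 0 r)) <= 2 * r * M.
  apply: (side (cpx 1 (-1))); first exact: e2; rewrite ?normr0 ?nr ?nr' ?addr0 ?add0r //; rewrite /reC /=; ring.
have s1 : nrm (trap F n (cpx 0 r) (cpx (- r) 0)) <= 2 * r * M.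
  apply: (side (cpx (-1) (-1))); first exact: e2; rewrite ?normr0 ?nr ?nr' ?addr0 ?add0r //; rewrite /reC /=; ring.
have s2 : nrm (trap F n (cpx (- r) 0) (cpx 0 (- r))) <= 2 * r * M.
  apply: (side (cpx (-1) 1)); first exact: e2; rewrite ?normr0 ?nr ?nr' ?addr0 ?add0r //; rewrite /reC /=; ring.
have s3 : nrm (trap F n (cpx 0 (- r)) (cpx r 0)) <= 2 * r * M.
  apply: (side (cpx 1 1)); first exact: e2; rewrite ?normr0 ?nr ?nr' ?addr0 ?add0r //; rewrite /reC /=; ring.
apply: (le_trans (nrmD _ _)); apply: (le_trans (lerD (nrmD _ _) (lexx _))).
by apply: (le_trans (lerD (lerD (nrmD _ _) (lexx _)) (lexx _))); lra.
Qed.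

End Diamond.

Section CauchyEstimate.
Variable R : realType.
Local Notation C := (complex_field R).
Implicit Types (f F : C -> C) (u v z a b : C).

Lemma trap_inv_rot n u a b : u != 0 ->
  trap (fun z => z^-1) n (u * a) (u * b) = trap (fun z => z^-1) n a b.
Proof.
move=> u0; elim: n a b => [|n IH] a b /=; last first.
  have -> : mid (u * a) (u * b) = u * mid a b by rewrite /mid -mulrDr mulrA.
  by rewrite !IH.
rewrite !invfM; transitivity (u / u * ((b - a) * ((a^-1 + b^-1) / 2))); last first.
  by rewrite divff // mul1r.
by move: (u^-1) (a^-1) (b^-1) => u' a' b'; ring.
Qed.

(** On the segment from 1 to i, traversed with velocity i - 1, the argument increases at
least at unit rate. *)
Lemma im_inv_ge1 (x y : R) : 0 <= x -> 0 <= y -> x + y = 1 ->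
  1 <= imC (cpx (-1) 1 * (cpx x y)^-1).
Proof.
move=> x0 y0 xy; have z0 : cpx x y != 0.
  by apply/eqP => -[hx hy]; move: xy; rewrite hx hy addr0 => /eqP; rewrite eq_sym oner_eq0.
have := mulfVK z0 (cpx (-1) 1).
case: (_ * _^-1) => p q [h1 h2]; rewrite /imC /=.
have n1 : q * (x ^+ 2 + y ^+ 2) = 1.
  have -> : q * (x ^+ 2 + y ^+ 2) = (p * y + q * x) * x - (p * x - q * y) * y by ring.
  by rewrite h1 h2; lra.
have n2 : x ^+ 2 + y ^+ 2 <= 1 by nra.
have n0 : 0 < x ^+ 2 + y ^+ 2.
  by rewrite lt_def addr_ge0 ?sqr_ge0 // andbT; apply/eqP => h; rewrite h mulr0 in n1; lra.
have q0 : 0 <= q by rewrite -(pmulr_lge0 _ n0) n1.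
by nra.
Qed.

Lemma im_trap_inv n (s : R) (a b : C) : 0 <= s ->
  let Q z := exists x y, [/\ z = cpx x y, 0 <= x, 0 <= y & x + y = 1] in
  Q a -> Q b -> b - a = rc s * cpx (-1) 1 -> s <= imC (trap (fun z => z^-1) n a b).
Proof.
move=> s0 Q; elim: n s a b s0 => [|n IH] s a b s0 Qa Qb ab /=.
  have g z : Q z -> 1 <= imC (cpx (-1) 1 * z^-1).
    by move=> [x [y [-> x0 y0 xy]]]; exact: im_inv_ge1.
  rewrite ab -rc_half (mulrC _ (rc _)) mulrACA -rcM mulrDr imCZ imCD.
  by have := g _ Qa; have := g _ Qb; nra.
have hs : 0 <= s / 2 by lra.
have Qm : Q (mid a b).
  case: Qa Qb => [x [y [-> x0 y0 xy]]] [x' [y' [-> x0' y0' xy']]].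
  exists ((x + x') / 2), ((y + y') / 2); split; [|lra..].
  rewrite midE; apply/eqP; rewrite eq_complex /=; apply/andP; split; apply/eqP; ring.
have e1 : mid a b - a = rc (s / 2) * cpx (-1) 1.
  by rewrite mid_subl ab rcM rc_half mulrAC.
have e2 : b - mid a b = rc (s / 2) * cpx (-1) 1.
  by rewrite mid_subr ab rcM rc_half mulrAC.
rewrite imCD; have := IH _ _ _ hs Qa Qm e1; have := IH _ _ _ hs Qm Qb e2; lra.
Qed.

(** A lower bound in place of the value 2 pi i: the four sides contribute equally, since
the sums for 1 / z are invariant under multiplication by a number. *)
Lemma Lam_inv n (r : R) : 0 < r -> 4 <= nrm (Lam (fun z : C => z^-1) n r).
Proof.
move=> r0; pose t := trap (fun z : C => z^-1) n (cpx 1 0) (cpx 0 1).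
have r0' : rc r != 0 by rewrite -[0]/(rc 0) (inj_eq (@rcI R)) gt_eqF.
have rot u a b : u != 0 -> a = u * cpx 1 0 -> b = u * cpx 0 1 ->
    trap (fun z : C => z^-1) n a b = t.
  by move=> u0 -> ->; exact: trap_inv_rot.
have nz (x y : R) : (x != 0) || (y != 0) -> cpx x y != 0.
  by rewrite -negb_and; apply: contra; rewrite eq_complex.
have rn := gt_eqF r0.
have eqC (z w : C) : reC z = reC w -> imC z = imC w -> z = w.
  by case: z w => ? ? [? ?]; rewrite /reC /imC /= => -> ->.
rewrite /Lam (rot (cpx r 0)) ?nz ?rn //; do ?[by apply: eqC; rewrite /reC /imC /=; ring].
rewrite (rot (cpx 0 r)) ?nz ?rn ?orbT //; do ?[by apply: eqC; rewrite /reC /imC /=; ring].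
rewrite (rot (cpx (- r) 0)) ?nz ?oppr_eq0 ?rn //; do ?[by apply: eqC; rewrite /reC /imC /=; ring].
rewrite (rot (cpx 0 (- r))) ?nz ?oppr_eq0 ?rn ?orbT //; do ?[by apply: eqC; rewrite /reC /imC /=; ring].
apply: (le_trans _ (Im_le_nrm _)); apply: (le_trans _ (ler_norm _)).
rewrite -[complex.Im _]/(imC (t + t + t + t)) !imCD.
suff : 1 <= imC t by lra.
apply: im_trap_inv => //.
- by exists 1, 0; split=> //; rewrite addr0.
- by exists 0, 1; split=> //; rewrite add0r.
by apply/eqP; rewrite eq_complex /=; apply/andP; split; apply/eqP; ring.
Qed.

Lemma differentiable_quotient f z w (k : C) : z != w -> differentiable f z ->
  differentiable (fun x => (f x - k) / (x - w)) z.
Proof.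
move=> zw df; have df1 : differentiable (fun x => f x - k) z.
  by apply: differentiableB => //; exact: differentiable_cst.
have d1 : differentiable (fun x : C => x - w) z.
  by apply: differentiableB => //; exact: differentiable_cst.
by apply: differentiableM df1 _; apply: differentiableV; rewrite ?subr_eq0.
Qed.

(** The argument of Cauchy's formula: (f z - f 0) / z is bounded near 0, so that its sums
over small diamonds, hence also those over the large one, tend to 0. This compares
f 0 times the sum of 1 / z with the sum of f z / z. *)
Lemma cauchy_estimate0 f (r M : R) : 0 < r ->
  (forall z, nrm z <= r -> differentiable f z) ->
  (forall z, nrm z <= r -> r / 2 <= nrm z -> nrm (f z) <= M) -> nrm (f 0) <= 4 * M.
Proof.
move=> r0 df fM; pose F z := (f z - f 0) / (z - 0).
have dF z : nrm z <= r -> z != 0 -> cdiff F z.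
  by move=> zr z0; apply: differentiable_cdiff; apply: differentiable_quotient => //; exact: df.
have M0 : 0 <= M.
  have h : nrm (rc r) = r by rewrite nrm_real gtr0_norm.
  by apply: le_trans (fM (rc r) _ _); rewrite ?nrm_ge0 ?h //; lra.
have n0 : nrm (0 : C) = 0 := nrm0 _.
have /differentiable_cdiff[l /(_ 1 ltr01)[del del0 hl]] : differentiable f 0.
  by apply: df; rewrite n0 ltW.
pose B := nrm l + 1; have B0 : 0 <= B by have := nrm_ge0 l; rewrite /B; lra.
have FB z : nrm z < del -> nrm (F z) <= B.
  move=> zd; have [->|z0] := eqVneq z 0; first by rewrite /F subrr mul0r n0.
  have nz : 0 < nrm z by rewrite nrm_gt0.
  have := hl z; rewrite subr0 => /(_ zd); rewrite mul1r => h.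
  rewrite /F subr0 nrmM nrmV ler_pdivrMr //.
  have -> : f z - f 0 = (f z - f 0 - l * z) + l * z by rewrite subrK.
  by apply: (le_trans (nrmD _ _)); rewrite nrmM /B; lra.
apply/ler_addgt0Pr => d d0; have d20 : 0 < d / 2 by lra.
have md0 : 0 < Num.min del (d / (8 * B + 1)).
  by rewrite lt_min del0 divr_gt0 //; lra.
have [k /(_ k (leqnn k))] := geom_small (ltW r0) md0.
rewrite lt_min => /andP[k1 k2].
have [N HN] := Lam_halves k r0 dF d20.
have {}HN := HN N (leqnn N).
set rho := r / 2 ^+ k in k1 k2 HN.
have rho0 : 0 <= rho by rewrite divr_ge0 ?exprn_ge0 // ltW.
have L2 : nrm (Lam F N rho) <= d.
  apply: (@le_trans _ _ (8 * rho * B)).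
    by apply: Lam_bound => // z zr _; apply: FB; exact: le_lt_trans k1.
  move: k2; rewrite ltr_pdivlMr; last lra.
  by lra.
have FE : Lam F N r = Lam (fun z => f z / z) N r - f 0 * Lam (fun z => z^-1) N r.
  have -> : F = (fun z => f z / z - f 0 * z^-1).
    by apply/funext => z; rewrite /F subr0 mulrBl.
  by rewrite /Lam !trapB !trapZ; ring.
have L1 : nrm (Lam (fun z => f z / z) N r) <= 16 * M.
  have -> : 16 * M = 8 * r * (2 * M / r).
    by have rn : r != 0 by [rewrite gt_eqF]; field.
  apply: Lam_bound => [||z zr rz]; first exact: ltW.
    by rewrite divr_ge0 ?mulr_ge0 // ltW.
  have z0 : 0 < nrm z by lra.
  have := fM z zr rz; rewrite nrmM nrmV ler_pdivrMr // => h.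
  rewrite mulrAC ler_pdivlMr //.
  by nra.
have : nrm (f 0 * Lam (fun z => z^-1) N r) <= 16 * M + (d / 2 + d).
  have -> : f 0 * Lam (fun z => z^-1) N r = Lam (fun z => f z / z) N r - Lam F N r.
    by rewrite FE; ring.
  apply: (le_trans (nrmDB _ _)); apply: lerD => //.
  by have := nrmD (Lam F N r - Lam F N rho) (Lam F N rho); rewrite subrK; lra.
rewrite nrmM; have := Lam_inv N r0; have := nrm_ge0 (f 0); nra.
Qed.

Lemma differentiable_shift (V W : normedModType C) (f : V -> W) (c x : V) :
  differentiable f (c + x) -> differentiable (fun y => f (c + y)) x.
Proof.
by move=> df; apply: (@differentiable_comp _ _ _ _ (fun y => c + y) f).
Qed.

(** This weak form of the maximum principle is the only consequence of Cauchy's theorem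
that is used below. *)
Lemma cauchy_estimate f c (r M : R) : 0 < r ->
  (forall z, nrm (z - c) <= r -> differentiable f z) ->
  (forall z, nrm (z - c) <= r -> r / 2 <= nrm (z - c) -> nrm (f z) <= M) ->
  nrm (f c) <= 4 * M.
Proof.
move=> r0 df fM; rewrite -[c in f c]addr0.
apply: (@cauchy_estimate0 (fun z => f (c + z)) r) => // z zr.
  by apply: differentiable_shift; apply: df; rewrite addrC addKr.
by move=> rz; apply: fM; rewrite addrC addKr.
Qed.

End CauchyEstimate.

(** * Isolated singularities of bounded functions *)

Section BoundedFunctions.
Variable R : realType.
Local Notation C := (complex_field R).
Implicit Types (f F : C -> C) (c s u v w z a b : C) (S : seq C) (M B r x : R).

Lemma bernoulli_ineq (q : R) n : 1 <= q -> 1 + n%:R * (q - 1) <= q ^+ n.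
Proof.
move=> q1; elim: n => [|n IH]; first by rewrite mul0r addr0 expr0.
rewrite exprS -[in leLHS]addn1 natrD.
have h : 0 <= n%:R * (q - 1) by rewrite mulr_ge0 // subr_ge0.
by have := ler_wpM2l (le_trans ler01 q1) IH; nra.
Qed.

(** Constant factors disappear on taking n-th roots. *)
Lemma root_le x M (k D : R) : 0 <= x -> 0 <= M -> 0 < k ->
  (forall n, x ^+ n.+1 * k <= M ^+ n.+1 * D) -> x <= M.
Proof.
move=> x0 M0 k0 h; rewrite leNgt; apply/negP => Mx.
have {x0}x0 : 0 < x by exact: le_lt_trans Mx.
have [M1|M1] := eqVneq M 0.
  have := h 0%N; rewrite !expr1 M1 mul0r leNgt => /negP; apply.
  exact: mulr_gt0.
have {M1}M0 : 0 < M by rewrite lt_def M1.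
have q1 : 1 < x / M by rewrite ltr_pdivlMr // mul1r.
have {}h n : (x / M) ^+ n.+1 <= D / k.
  have := h n; rewrite expr_div_n ler_pdivrMr ?exprn_gt0 //.
  by rewrite mulrAC ler_pdivlMr // (mulrC D).
have q0 : 0 < x / M - 1 by rewrite subr_gt0.
pose n := Num.truncn (D / k / (x / M - 1)).
have := le_trans (bernoulli_ineq n.+1 (ltW q1)) (h n).
have := truncnS_gt (D / k / (x / M - 1)); rewrite ltr_pdivrMr // -/n.
by lra.
Qed.

Lemma differentiable_expn f n z : differentiable f z ->
  differentiable (fun z => f z ^+ n) z.
Proof.
move=> df; case: n => [|n]; last by have := differentiableX n df; rewrite exprfctE.
exact: (differentiable_cst (1 : C)).
Qed.

(** Multiplying by (z - s)^2 removes a singularity where f is bounded. *)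
Lemma differentiable_sqr f s B (d : R) : 0 < d ->
  (forall z, nrm (z - s) < d -> nrm (f z) <= B) ->
  differentiable (fun z => f z * (z - s) ^+ 2) s.
Proof.
move=> d0 fB; apply: (@approx_diff R C C _ s (\0 : {linear C -> C})); first exact: cst_continuous.
have B0 : 0 <= B by apply: le_trans (fB s _); rewrite ?nrm_ge0 // subrr nrm0.
move=> e e0; exists (Num.min d (e / (B + 1))).
  by rewrite lt_min d0 divr_gt0 //; lra.
move=> v; rewrite lt_min => /andP[vd ve].
rewrite /= subrr expr0n mulr0 !subr0 (addrC s v) addrK nrmM expr2 nrmM.
have := fB (v + s); rewrite addrK => /(_ vd) h.
rewrite mulrA ler_wpM2r ?nrm_ge0 //.
move: ve; rewrite ltr_pdivlMr; last lra.
by have := nrm_ge0 v; have := nrm_ge0 (f (v + s)); nra.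
Qed.

(** The constant in Cauchy's estimate disappears on taking large powers of f, and so do
the factors (z - s)^2 that remove the singularities. *)
Lemma maximum_principle f c r M S : 0 < r ->
  (forall z, nrm (z - c) <= r -> z \notin S -> differentiable f z) ->
  (forall s, s \in S -> nrm (s - c) <= r -> exists B (d : R), 0 < d /\
     forall z, nrm (z - s) < d -> nrm (f z) <= B) ->
  c \notin S ->
  (forall z, nrm (z - c) <= r -> r / 2 <= nrm (z - c) -> nrm (f z) <= M) ->
  nrm (f c) <= M.
Proof.
move=> r0; have M0 (g : C -> C) (N : R) : (forall z, nrm (z - c) <= r -> r / 2 <= nrm (z - c) ->
    nrm (g z) <= N) -> 0 <= N.
  have h : nrm (rc r) = r by rewrite nrm_real gtr0_norm.
  move=> gN; apply: le_trans (gN (c + rc r) _ _); rewrite ?nrm_ge0 //.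
    by rewrite addrC addKr h.
  by rewrite addrC addKr h; lra.
elim: S f M => [|s S IH] f M df bf cS fM; have M1 := M0 f M fM.
  apply: (@root_le _ _ 1 4); rewrite ?nrm_ge0 ?M1 // => n.
  rewrite mulr1 -nrmX mulrC.
  apply: (@cauchy_estimate _ (fun z => f z ^+ n.+1) c r) => // z zr.
    by apply: differentiable_expn; exact: df.
  by move=> rz; rewrite nrmX lerXn2r ?nnegrE ?nrm_ge0 ?M1 // fM.
move: cS; rewrite inE negb_or => /andP[cs cS].
have [sr|rs] := lerP (nrm (s - c)) r; last first.
  apply: IH => // [z zr zS|z zS zr].
    apply: df; rewrite // inE negb_or zS andbT; apply/eqP => zs.
    by move: zr; rewrite zs leNgt rs.
  by apply: bf; rewrite // inE zS orbT.
pose D := (r + nrm (c - s)) ^+ 2.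
apply: (@root_le _ _ (nrm (c - s) ^+ 2) D); rewrite ?nrm_ge0 ?M1 //.
  by rewrite exprn_gt0 // nrm_gt0 subr_eq0.
move=> n; rewrite -!nrmX -nrmM.
have [B [d [d0 fB]]] := bf s (mem_head _ _) sr.
have powB (g : C -> C) z (b : R) : nrm (g z) <= b -> nrm (g z ^+ n.+1) <= b ^+ n.+1.
  move=> gb; rewrite nrmX lerXn2r ?nnegrE ?nrm_ge0 //.
  by apply: le_trans gb; exact: nrm_ge0.
apply: (IH (fun z => f z ^+ n.+1 * (z - s) ^+ 2)) => //.
- move=> z zr zS; have [->|zs] := eqVneq z s.
    by apply: (@differentiable_sqr (fun z => f z ^+ n.+1) s (B ^+ n.+1) d) => // w wd; apply: powB; exact: fB.
  apply: differentiableM.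
    by apply: differentiable_expn; apply: df; rewrite // inE negb_or zs.
  apply: differentiable_expn.
  by apply: differentiableB => //; exact: differentiable_cst.
- move=> s' s'S s'r; have [|B' [d' [d'0 fB']]] := bf s' _ s'r.
    by rewrite inE s'S orbT.
  exists (B' ^+ n.+1 * (d' + nrm (s' - s)) ^+ 2), d'; split=> // z zd.
  rewrite nrmM (nrmX (z - s)) ler_pM ?nrm_ge0 ?exprn_ge0 ?nrm_ge0 //.
    by apply: powB; exact: fB'.
  rewrite lerXn2r ?nnegrE ?nrm_ge0 ?addr_ge0 ?nrm_ge0 ?ltW //.
  by apply: (le_lt_trans (nrm_tri z s' s)); rewrite ltr_leD.
- move=> z zr rz; rewrite nrmM (nrmX (z - s)) ler_pM ?nrm_ge0 ?exprn_ge0 ?nrm_ge0 //.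
    by apply: powB; exact: fM.
  rewrite /D lerXn2r ?nnegrE ?nrm_ge0 ?addr_ge0 ?nrm_ge0 ?(ltW r0) //.
  by apply: (le_trans (nrm_tri z c s)); rewrite lerD.
Qed.

(** The maximum principle for the difference quotients of f. *)
Lemma lipschitz_off f c r B S : 0 < r ->
  (forall z, nrm (z - c) <= r -> z \notin S -> differentiable f z) ->
  (forall z, nrm (z - c) <= r -> nrm (f z) <= B) ->
  forall z w, nrm (z - c) <= r / 16 -> nrm (w - c) <= r / 16 ->
    z \notin S -> w \notin S -> nrm (f z - f w) <= 16 * B / r * nrm (z - w).
Proof.
move=> r0 df fB z w zr wr zS wS.
have [->|zw] := eqVneq z w; first by rewrite !subrr nrm0 mulr0.
have zw0 : 0 < nrm (z - w) by rewrite nrm_gt0 subr_eq0.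
rewrite -ler_pdivrMr // -nrmV -nrmM.
have in_r y : nrm (y - z) <= r / 2 -> nrm (y - c) <= r * (9 / 16).
  by move=> h; apply: (le_trans (nrm_tri y z c)); lra.
have B0 : 0 <= B by apply: le_trans (fB z _); rewrite ?nrm_ge0 //; lra.
have quo y (k : R) : 0 < k -> nrm (y - c) <= r -> k <= nrm (y - w) ->
    nrm ((f y - f w) / (y - w)) <= 2 * B / k.
  move=> k0 yr yw; rewrite nrmM nrmV ler_pdivrMr ?(lt_le_trans k0) //.
  apply: (@le_trans _ _ (2 * B)).
    by apply: (le_trans (nrmDB _ _)); have := fB y yr; have := fB w; lra.
  by rewrite mulrAC ler_pdivlMr // ler_wpM2l //; lra.
apply: (@maximum_principle (fun y => (f y - f w) / (y - w)) z (r / 2) _ (w :: S)).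
- lra.
- move=> y yz; rewrite inE negb_or => /andP[yw yS].
  by apply: differentiable_quotient => //; apply: df => //; have := in_r y yz; lra.
- move=> s sS sz; have [->|sw] := eqVneq s w.
    have /differentiable_cdiff[l /(_ 1 ltr01)[d d0 hl]] : differentiable f w.
      by apply: df => //; lra.
    exists (nrm l + 1), d; split=> // y yd.
    have [->|yw] := eqVneq y w.
      by rewrite subrr mul0r nrm0; have := nrm_ge0 l; lra.
    rewrite nrmM nrmV ler_pdivrMr ?nrm_gt0 ?subr_eq0 //.
    have -> : f y - f w = (f y - f w - l * (y - w)) + l * (y - w) by rewrite subrK.
    by apply: (le_trans (nrmD _ _)); have := hl y yd; rewrite nrmM; lra.
  have sw0 : 0 < nrm (s - w) by rewrite nrm_gt0 subr_eq0.
  exists (2 * B / (nrm (s - w) / 2)), (Num.min (nrm (s - w) / 2) (r / 4)); split.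
    by rewrite lt_min; apply/andP; split; lra.
  move=> y; rewrite lt_min => /andP[ys yr]; apply: quo; first lra.
    by have := nrm_tri y s c; have := in_r s sz; lra.
  by have := nrm_tri s y w; rewrite (nrmB s y); lra.
- by rewrite inE negb_or zw.
- move=> y yz ry; have -> : 16 * B / r = 2 * B / (r / 8).
    by have rn : r != 0 by [rewrite gt_eqF]; field.
  apply: quo; first lra.
    by have := in_r y yz; lra.
  have := nrm_tri y w z; have := nrm_tri w c z; rewrite (nrmB c z); lra.
Qed.

(** The maximum principle for f / z^k on a disc around z, for large k. *)
Lemma flat_eq0 f r B : 0 < r ->
  (forall z, nrm z <= r -> differentiable f z) ->
  (forall z, nrm z <= r -> nrm (f z) <= B) ->
  (forall k, exists K (d : R), 0 < d /\ forall z, nrm z < d -> nrm (f z) <= K * nrm z ^+ k) ->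
  forall z, nrm z <= r / 16 -> f z = 0.
Proof.
move=> r0 df fB flat z zr.
have [->|z0] := eqVneq z 0.
  have [K [d [d0 h]]] := flat 1%N.
  have := h 0; rewrite nrm0 expr1 mulr0 => /(_ d0).
  by rewrite le_eqVlt ltNge nrm_ge0 orbF nrm_eq0 => /eqP.
have nz : 0 < nrm z by rewrite nrm_gt0.
have B0 : 0 <= B by apply: le_trans (fB z _); rewrite ?nrm_ge0 //; lra.
apply/eqP; rewrite -nrm_eq0 eq_le nrm_ge0 andbT.
apply/ler_addgt0Pr => e e0; rewrite add0r.
have [k /(_ k (leqnn k)) hk] := geom_small B0 e0.
apply: le_trans (ltW hk).
have mp : nrm (f z / z ^+ k) <= B / (3 * nrm z) ^+ k.
  apply: (@maximum_principle (fun y => f y / y ^+ k) z (r / 2) _ [:: 0]).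
  - lra.
  - move=> y yz; rewrite inE => y0; apply: differentiableM.
      by apply: df; have := nrmD (y - z) z; rewrite subrK; lra.
    apply: differentiableV; last by rewrite expf_neq0.
    exact: (@differentiable_expn id).
  - move=> s; rewrite inE => /eqP -> _.
    have [K [d [d0 h]]] := flat k; exists (Num.max K B), (Num.min d r); split.
      by rewrite lt_min d0.
    move=> y; rewrite subr0 lt_min => /andP[yd yr].
    have [->|y0] := eqVneq y 0.
      case: k {hk h} => [|k]; last first.
        by rewrite expr0n invr0 mulr0 nrm0 le_max B0 orbT.
      by rewrite expr0 divr1 le_max fB ?orbT // nrm0 ltW.
    rewrite nrmM nrmV nrmX ler_pdivrMr ?exprn_gt0 ?nrm_gt0 //.
    apply: (le_trans (h y yd)); rewrite ler_wpM2r ?exprn_ge0 ?nrm_ge0 //.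
    by rewrite le_max lexx.
  - by rewrite inE.
  - move=> y yz ry; rewrite nrmM nrmV nrmX.
    have y3 : 3 * nrm z <= nrm y by have := nrm_tri y 0 z; rewrite sub0r nrmN subr0; lra.
    have y0 : 0 < nrm y by lra.
    apply: ler_pM; rewrite ?nrm_ge0 ?invr_ge0 ?exprn_ge0 ?nrm_ge0 //.
      by apply: fB; have := nrmD (y - z) z; rewrite subrK; lra.
    by rewrite lef_pV2 ?posrE ?exprn_gt0 // ?lerXn2r ?nnegrE ?nrm_ge0 //; nra.
move: mp; rewrite nrmM nrmV nrmX ler_pdivrMr ?exprn_gt0 // => /le_trans; apply.
rewrite exprMn invfM mulrA mulfVK ?expf_neq0 ?gt_eqF //.
rewrite ler_wpM2l // lef_pV2 ?posrE ?exprn_gt0 // lerXn2r ?nnegrE //; lra.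
Qed.

End BoundedFunctions.

(** * Hadamard's lemma *)

Section SeveralVariables.
Variables (R : realType) (d : nat).
Local Notation C := (complex_field R).
Local Notation V := 'rV[C]_d.
Implicit Types (f g h : V -> C) (p u v w z : V) (j : 'I_d).

Lemma nrm_coord v i : nrm (v 0 i : C) <= nrm v.
Proof.
rewrite -lecRE -!nrmE [leRHS]mx_normE -[leLHS]nngE num_le.
exact: (le_bigmax _ (fun ij => `|v ij.1 ij.2|%:nng) (0, i)).
Qed.

Lemma nrm_row_le v (r : R) : 0 <= r -> (forall i, nrm (v 0 i : C) <= r) -> nrm v <= r.
Proof.
move=> r0 h; have [v0|v0] := eqVneq (mx_norm v) 0.
  by rewrite /nrm [X in complex.Re X]v0.
have [[i j] vE] := mx_norm_neq0 v0; rewrite /nrm [X in complex.Re X]vE /=.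
by rewrite (ord1 i); exact: h.
Qed.

Definition basis j : V := delta_mx 0 j.

Lemma nrm_basis j : nrm (basis j) <= 1.
Proof.
apply: nrm_row_le => // i; rewrite mxE eqxx /=.
by case: (i == j); rewrite ?nrm1 // nrm0.
Qed.

Lemma nrmZ_basis (t : C) j : nrm (t *: basis j) <= nrm t.
Proof. by rewrite nrmZ ler_piMr ?nrm_ge0 // nrm_basis. Qed.

Lemma row_basis v : v = \sum_j v 0 j *: basis j.
Proof. by rewrite {1}[v]row_sum_delta. Qed.

Definition kill (s : seq 'I_d) v : V := \row_i (if i \in s then 0 else v 0 i).

Lemma kill_linear s : linear (kill s).
Proof.
by move=> a u v; apply/rowP => i; rewrite !mxE; case: ifP; rewrite ?mulr0 ?addr0.
Qed.
HB.instance Definition _ s := GRing.isLinear.Build _ _ _ _ (kill s) (kill_linear s).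

Lemma kill_continuous s : continuous (kill s).
Proof.
apply: entrywise_continuous => i; case si: (i \in s).
  by right=> v w; rewrite !mxE si.
by left; exists i => v; rewrite !mxE si.
Qed.

Lemma nrm_kill s v : nrm (kill s v) <= nrm v.
Proof.
apply: nrm_row_le => [|i]; first exact: nrm_ge0.
by rewrite mxE; case: ifP => _; [rewrite nrm0; exact: nrm_ge0|exact: nrm_coord].
Qed.

Lemma kill1E j v : v = kill [:: j] v + v 0 j *: basis j.
Proof.
apply/rowP => i; rewrite !mxE eqxx /= inE.
by case: eqVneq => [->|_]; rewrite ?mulr1 ?add0r // mulr0 addr0.
Qed.

Lemma differentiable_coordinate j v : differentiable (fun v : V => v 0 j : C) v.
Proof. exact: differentiable_coord. Qed.

Lemma differentiable_line f p v (t : C) : differentiable f (p + t *: v) ->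
  differentiable (fun t : C => f (p + t *: v)) t.
Proof.
by move=> df; apply: (@differentiable_comp _ _ _ _ (fun t : C => p + t *: v) f).
Qed.

(** The set S of parameters leaves room for the points of the line at which g is not
known to be differentiable. *)
Lemma line_lipschitz g p (r B : R) (S : seq C) z w : 0 < r ->
  (forall y, nrm (y - p) <= r -> nrm (g y) <= B) ->
  (forall t : C, nrm (w + t *: (z - w) - p) <= r -> t \notin S ->
     differentiable g (w + t *: (z - w))) ->
  0 \notin S -> 1 \notin S ->
  nrm (z - p) <= r / 64 -> nrm (w - p) <= r / 64 ->
  nrm (g z - g w) <= 32 * B / r * nrm (z - w).
Proof.
move=> r0 gB dg S0 S1 zp wp.
have [->|zw] := eqVneq z w; first by rewrite !subrr !nrm0 mulr0.
have u0 : 0 < nrm (z - w) by rewrite nrm_gt0 subr_eq0.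
have ur : nrm (z - w) <= r / 32.
  by have := nrm_tri z p w; rewrite (nrmB p w); lra.
pose T := r / 2 / nrm (z - w).
have T0 : 0 < T by rewrite divr_gt0 //; lra.
have T16 : 1 <= T / 16.
  by rewrite /T mulrAC ler_pdivlMr // mul1r; lra.
have inr (t : C) : nrm (t - 0) <= T -> nrm (w + t *: (z - w) - p) <= r.
  rewrite subr0 /T ler_pdivlMr // => h.
  by rewrite addrAC; apply: (le_trans (nrmD _ _)); rewrite nrmZ; lra.
have wz : w + (z - w) = z by rewrite addrC subrK.
have := @lipschitz_off R (fun t => g (w + t *: (z - w))) 0 T B S T0.
move=> /(_ _ _ 1 0 _ _ S1 S0); rewrite !scale1r scale0r addr0 wz.
rewrite !subr0 nrm1 mulr1 nrm0 => h.
rewrite (_ : 32 * B / r * nrm (z - w) = 16 * B / T); last first.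
  by rewrite /T; field; rewrite !gt_eqF.
apply: h => //; last by apply: le_trans T16.
  by move=> t tT tS; apply: differentiable_line; apply: dg => //; exact: inr.
by move=> t tT; apply: gB; exact: inr.
Qed.

Definition linform (c : 'I_d -> C) v : C := \sum_i v 0 i * c i.

Lemma linform_linear c : linear (linform c : V -> C^o).
Proof.
move=> a u v; rewrite /linform scaler_sumr -big_split /=.
by apply: eq_bigr => i _; rewrite !mxE mulrDl -mulrA.
Qed.
HB.instance Definition _ c := GRing.isLinear.Build C V C _ (linform c) (linform_linear c).

Lemma linform_continuous c : continuous (linform c).
Proof.
move=> v; have -> : linform c = \sum_i (fun v : V => v 0 i * c i).
  by apply/funext => w; rewrite fct_sumE.
apply: differentiable_continuous; apply: differentiable_sum => i.
by apply: differentiableM; [exact: differentiable_coordinate|exact: differentiable_cst].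
Qed.

Lemma linformE (D : {linear V -> C}) v : D v = linform (fun i => D (basis i)) v.
Proof.
by rewrite {1}[v]row_basis linear_sum; apply: eq_bigr => i _; rewrite linearZ.
Qed.

(** The derivatives D of the approximations, for errors e tending to 0, form a Cauchy
sequence, and the estimate passes to the limit. *)
Lemma differentiable_approx f p (K r : R) : 0 < r ->
  (forall e : R, 0 < e -> exists D : {linear V -> C}, forall v, nrm v <= r ->
     nrm (f (p + v) - f p - D v) <= K * nrm v ^+ 2 + e) ->
  differentiable f p.
Proof.
move=> r0 H.
have K1 : exists2 K' : R, 0 <= K' & K <= K'.
  by exists `|K| => //; exact: ler_norm.
case: K1 => K' K'0 KK'.
have {H} H (e : R) : 0 < e -> exists D : {linear V -> C}, forall v, nrm v <= r ->
     nrm (f (p + v) - f p - D v) <= K' * nrm v ^+ 2 + e.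
  move=> /H[D hD]; exists D => v /hD /le_trans; apply.
  by rewrite lerD2r ler_wpM2r // exprn_ge0 // nrm_ge0.
have p4 n : 0 < (4 ^+ n)^-1 :> R by rewrite invr_gt0 exprn_gt0.
have /choice[D hD] : forall n, exists D : {linear V -> C}, forall v, nrm v <= r ->
    nrm (f (p + v) - f p - D v) <= K' * nrm v ^+ 2 + (4 ^+ n)^-1.
  by move=> n; exact: H.
pose c := (2 * K' * r ^+ 2 + 2) / r.
have c0 : 0 <= c by apply: divr_ge0; [have := sqr_ge0 r; nra | exact: ltW].
have four n : 4 ^+ n = 2 ^+ n * 2 ^+ n :> R by rewrite -exprMn; congr (_ ^+ n); lra.
have step i n : nrm (D n.+1 (basis i) - D n (basis i)) <= c / 2 ^+ n.
  pose v := rc (r / 2 ^+ n) *: basis i.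
  have t0 : 0 < r / 2 ^+ n by rewrite divr_gt0 ?exprn_gt0.
  have vr' : nrm v <= r / 2 ^+ n.
    by apply: (le_trans (nrmZ_basis _ _)); rewrite nrm_real gtr0_norm.
  have vr : nrm v <= r.
    apply: (le_trans vr'); rewrite ler_pdivrMr ?exprn_gt0 //; apply: ler_peMr; first exact: ltW.
    by rewrite exprn_ege1 // ler1n.
  have h1 := hD n v vr; have h2 := hD n.+1 v vr.
  have : nrm (D n.+1 v - D n v) <= 2 * K' * (r / 2 ^+ n) ^+ 2 + 2 * (4 ^+ n)^-1.
    have -> : D n.+1 v - D n v = (f (p + v) - f p - D n v) - (f (p + v) - f p - D n.+1 v) by ring.
    apply: (le_trans (nrmDB _ _)); apply: (le_trans (lerD h1 h2)).
    have : (4 ^+ n.+1)^-1 <= (4 ^+ n)^-1 :> R.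
      rewrite lef_pV2 ?posrE ?exprn_gt0 // exprS.
      by have := exprn_gt0 n (ltr0n R 4); lra.
    have : nrm v ^+ 2 <= (r / 2 ^+ n) ^+ 2.
      by rewrite lerXn2r ?nnegrE ?nrm_ge0 // ltW.
    by move=> /(ler_wpM2l K'0); lra.
  rewrite /v !linearZ /= -scalerDr nrmZ nrm_real gtr0_norm //.
  rewrite -ler_pdivlMl // => /le_trans; apply; rewrite le_eqVlt; apply/orP; left; apply/eqP.
  rewrite /c four; have := exprn_gt0 n (ltr0n R 2); move: (2 ^+ n) => q q0.
  by field; rewrite !gt_eqF.
clearbody c.
have /choice[L hL] : forall i, exists L, forall n, nrm (D n (basis i) - L) <= 4 * c / 2 ^+ n.
  by move=> i; exact: geometric_limit.
apply: (@approx_diff _ _ _ f p (linform L : {linear V -> C})).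
  exact: linform_continuous.
have est v : nrm v <= r -> nrm (f (p + v) - f p - linform L v) <= K' * nrm v ^+ 2.
  move=> vr; apply/ler_addgt0Pr => e e0.
  have h0 : 0 <= 1 + d%:R * nrm v * (4 * c).
    by rewrite addr_ge0 // !mulr_ge0 ?nrm_ge0 ?ler0n.
  have [n /(_ n (leqnn n)) hn] := geom_small h0 e0.
  have -> : f (p + v) - f p - linform L v =
      (f (p + v) - f p - D n v) + (D n v - linform L v) by ring.
  apply: (le_trans (nrmD _ _)).
  have h1 := hD n v vr.
  have h2 : nrm (D n v - linform L v) <= d%:R * nrm v * (4 * c / 2 ^+ n).
    rewrite linformE /linform -sumrB.
    have: forall s : seq 'I_d, nrm (\sum_(i <- s) (v 0 i * D n (basis i) - v 0 i * L i))
        <= (size s)%:R * nrm v * (4 * c / 2 ^+ n).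
      elim=> [|i s IH]; first by rewrite big_nil nrm0 !mul0r.
      rewrite big_cons /=; apply: (le_trans (nrmD _ _)).
      have -> : (size s).+1%:R * nrm v * (4 * c / 2 ^+ n) =
        nrm v * (4 * c / 2 ^+ n) + (size s)%:R * nrm v * (4 * c / 2 ^+ n).
        by rewrite -addn1 natrD; ring.
      apply: lerD => //; rewrite -mulrBr nrmM ler_pM ?nrm_ge0 ?nrm_coord //; exact: hL.
    move=> /(_ (index_enum 'I_d)); rewrite [size _](_ : _ = d) //.
    by rewrite -sum1_size -[RHS](card_ord d) -sum1_card; exact: eq_bigl.
  have h3 : (4 ^+ n)^-1 <= 1 / 2 ^+ n :> R.
    rewrite mul1r lef_pV2 ?posrE ?exprn_gt0 // four.
    by apply: ler_peMr; rewrite ?exprn_ge0 // exprn_ege1 // ler1n.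
  have : (1 + d%:R * nrm v * (4 * c)) / 2 ^+ n =
     1 / 2 ^+ n + d%:R * nrm v * (4 * c / 2 ^+ n) by ring.
  by move: hn; lra.
move=> e e0; exists (Num.min r (e / (K' + 1))).
  by rewrite lt_min r0 divr_gt0 //; lra.
move=> v; rewrite lt_min => /andP[vr ve].
apply: (le_trans (est v (ltW vr))); rewrite expr2 mulrA ler_wpM2r ?nrm_ge0 //.
move: ve; rewrite ltr_pdivlMr; last lra.
by have := nrm_ge0 v; nra.
Qed.

End SeveralVariables.

(** The divided difference of f in the j-th coordinate extends to the hyperplane where
this coordinate is 0 by a partial derivative. Its differentiability across the
hyperplane is not clear, as partial derivatives of a holomorphic function are not yet
known to be holomorphic. It is obtained by successive estimates off the hyperplane:
a bound, a Lipschitz constant, and a second-order expansion with uniform constants,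
which passes to the limit. Each estimate comes from [lipschitz_off] on complex lines,
where the point on the hyperplane and the base point are exceptional, and costs a
constant factor in the radius. *)

Section DividedDifference.
Variables (R : realType) (d : nat).
Local Notation C := (complex_field R).
Local Notation V := 'rV[C]_d.
Variables (f : V -> C) (j : 'I_d) (r B : R).
Hypothesis r0 : 0 < r.
Hypothesis df : forall z : V, nrm z <= r -> differentiable f z.
Hypothesis fB : forall z : V, nrm z <= r -> nrm (f z) <= B.
Implicit Types (u v w z p : V).

Local Notation crd z := (z 0 j : C).

Definition ddiff z : C :=
  if crd z == 0 then 'd f z (basis R j) else (f z - f (kill [:: j] z)) / crd z.

Lemma B_ge0 : 0 <= B.
Proof. by apply: le_trans (nrm_ge0 _) (@fB 0 _); rewrite nrm0 ltW. Qed.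

Lemma crd_line z (t : C) u : crd (z + t *: u) = crd z + t * crd u.
Proof. by rewrite !mxE. Qed.

Lemma crd_basis z (t : C) : crd (z + t *: basis R j) = crd z + t.
Proof. by rewrite crd_line mxE !eqxx mulr1. Qed.

Lemma kill_basis z (t : C) : crd z = 0 -> kill [:: j] (z + t *: basis R j) = z.
Proof.
move=> z0; apply/rowP => i; rewrite !mxE inE eqxx /=.
by case: eqVneq => [->|_]; [rewrite z0|rewrite mulr0 addr0].
Qed.

Lemma ddiff_limit z : nrm z <= r -> crd z = 0 -> forall e : R, 0 < e ->
  exists2 del : R, 0 < del & forall t : C, t != 0 -> nrm t < del ->
    nrm (ddiff (z + t *: basis R j) - ddiff z) <= e.
Proof.
move=> zr z0 e e0; have [del del0 h] := diff_approx (df zr) e0.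
exists del => // t t0 td; rewrite /ddiff crd_basis z0 add0r eqxx (negbTE t0).
rewrite kill_basis //.
have tv : nrm (t *: basis R j) < del by apply: le_lt_trans td; exact: nrmZ_basis.
have := h _ tv; rewrite linearZ /=; set D := 'd f z _ => hh.
have -> : (f (z + t *: basis R j) - f z) / t - D =
    (f (z + t *: basis R j) - f z - t *: D) / t.
  by rewrite -[t *: D]/(t * D); field.
rewrite nrmM nrmV ler_pdivrMr ?nrm_gt0 //; apply: (le_trans hh).
by rewrite ler_wpM2l ?nrmZ_basis // ltW.
Qed.

Lemma ddiff_off z (rho : R) : rho <= r -> nrm z < rho -> forall e : R, 0 < e ->
  exists2 t : C, crd (z + t *: basis R j) != 0 & [/\ nrm (z + t *: basis R j) < rho,
    nrm t <= e & nrm (ddiff (z + t *: basis R j) - ddiff z) <= e].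
Proof.
move=> rhor zr e e0; have [z0|z0] := eqVneq (crd z) 0; last first.
  by exists 0; rewrite scale0r addr0 // subrr !nrm0 ltW.
have zr' : nrm z <= r by apply: ltW; exact: lt_le_trans rhor.
have [del del0 h] := ddiff_limit zr' z0 e0.
pose m := Num.min (Num.min e (del / 2)) ((rho - nrm z) / 2).
have m0 : 0 < m by rewrite !lt_min e0 !divr_gt0 // subr_gt0.
have me : m <= e by rewrite /m !ge_min lexx.
have md : m <= del / 2 by rewrite /m !ge_min lexx orbT.
have mr : m <= (rho - nrm z) / 2 by rewrite /m !ge_min lexx !orbT.
clearbody m; have nm : nrm (rc m) = m by rewrite nrm_real gtr0_norm.
exists (rc m); first by rewrite crd_basis z0 add0r -nrm_gt0 nm.
split; [| by rewrite nm | by apply: h; rewrite -?nrm_gt0 nm //; lra].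
by apply: (le_lt_trans (nrmD _ _)); have := nrmZ_basis (rc m) j; rewrite nm; lra.
Qed.

Lemma differentiable_ddiff_off z : nrm z < r -> crd z != 0 -> differentiable ddiff z.
Proof.
move=> zr z0; pose q z := (f z - f (kill [:: j] z)) / crd z.
apply: (@near_eq_differentiable _ _ _ q).
  apply/near_nrm; exists (nrm (crd z)); first by rewrite nrm_gt0.
  move=> y yz; rewrite /ddiff /q; case: eqVneq => // y0.
  have := nrm_coord (y - z) j; rewrite !mxE y0 sub0r nrmN.
  by move=> h; have := le_lt_trans h yz; rewrite ltxx.
apply: differentiableM.
  apply: differentiableB; first exact: df (ltW zr).
  apply: (@differentiable_comp _ _ _ _ (kill [:: j]) f).
    by apply: linear_differentiable; exact: kill_continuous.
  by apply: df; apply: (le_trans (nrm_kill _ _)); exact: ltW.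
by apply: differentiableV => //; exact: differentiable_coordinate.
Qed.

Let B1 : R := 32 * B / r.
Let r1 : R := r / 64.

Lemma ddiff_bounded_off z : nrm z <= r1 -> crd z != 0 -> nrm (ddiff z) <= B1.
Proof.
move=> zr z0; rewrite /ddiff (negbTE z0) nrmM nrmV ler_pdivrMr ?nrm_gt0 //.
have e : z - kill [:: j] z = crd z *: basis R j by rewrite {1}(kill1E j z) addrC addKr.
have h : nrm (kill [:: j] z) <= r1 by apply: le_trans zr; exact: nrm_kill.
apply: (@le_trans _ _ (B1 * nrm (z - kill [:: j] z))).
  apply: (@line_lipschitz _ _ f 0 r B [::]) => //; rewrite ?subr0 //.
    by move=> y; rewrite subr0; exact: fB.
  by move=> t; rewrite subr0 => tr _; exact: df.
have B0 := B_ge0.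
rewrite ler_wpM2l ?e ?nrmZ_basis //.
by rewrite /B1 divr_ge0 ?mulr_ge0 // ltW.
Qed.

Lemma ddiff_bounded z : nrm z < r1 -> nrm (ddiff z) <= B1.
Proof.
move=> zr; apply/ler_addgt0Pr => e e0.
have r1r : r1 <= r by rewrite /r1; have := r0; lra.
have [t t0 [tr _ te]] := ddiff_off r1r zr e0.
have := ddiff_bounded_off (ltW tr) t0.
have := nrmDB (ddiff (z + t *: basis R j)) (ddiff (z + t *: basis R j) - ddiff z).
by rewrite opprB addrC subrK; lra.
Qed.

(** The parameter at which the line through z in direction u meets the hyperplane. *)
Let cross z u : seq C := if crd u == 0 then [::] else [:: - crd z / crd u].

Lemma crossP z u (t : C) : crd z != 0 -> t \notin cross z u -> crd (z + t *: u) != 0.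
Proof.
move=> z0; rewrite crd_line /cross; have [->|u0] := eqVneq (crd u) 0.
  by rewrite mulr0 addr0.
rewrite inE; apply: contra => /eqP h; apply/eqP; rewrite -(mulfK u0 t).
by congr (_ / _); apply/eqP; rewrite -subr_eq0 opprK addrC h.
Qed.

Lemma cross0 z u : crd z != 0 -> 0 \notin cross z u.
Proof.
move=> z0; rewrite /cross; case: eqVneq => // u0; rewrite inE eq_sym.
by rewrite mulf_neq0 ?oppr_eq0 ?invr_eq0.
Qed.

Lemma cross1 z u : crd (z + u) != 0 -> 1 \notin cross z u.
Proof.
move=> zu0; rewrite /cross; case: eqVneq => // u0; rewrite inE.
apply: contra zu0 => /eqP h; have e : crd u = - crd z.
  by rewrite -[crd u]mul1r h mulfVK.
by rewrite mxE e addrN.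
Qed.

Let r2 : R := r1 / 2.
Let L : R := 32 * B1 / r2.

Lemma r12 : [/\ 0 < r2, r2 < r1 & r1 < r].
Proof. by rewrite /r2 /r1; have := r0; split; lra. Qed.

Lemma ddiff_lipschitz_off z w : crd z != 0 -> crd w != 0 ->
  nrm z <= r2 / 64 -> nrm w <= r2 / 64 -> nrm (ddiff z - ddiff w) <= L * nrm (z - w).
Proof.
move=> z0 w0 zr wr; have [r20 r21 r1r] := r12.
apply: (@line_lipschitz _ _ ddiff 0 r2 B1 (cross w (z - w))) => //.
- by move=> y; rewrite subr0 => yr; apply: ddiff_bounded; lra.
- move=> t; rewrite subr0 => tr tS; apply: differentiable_ddiff_off; first lra.
  exact: crossP.
- exact: cross0.
- by apply: cross1; rewrite addrC subrK.
- by rewrite subr0.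
- by rewrite subr0.
Qed.

Let r3 : R := r2 / 64.

Lemma r3r : [/\ 0 < r3, r3 < r1 & r3 < r].
Proof. by have [? ? ?] := r12; rewrite /r3; split; lra. Qed.

Lemma L_ge0 : 0 <= L.
Proof.
have [? ? ?] := r12.
have B0 := B_ge0.
have B10 : 0 <= B1 by apply: divr_ge0; [exact: mulr_ge0|exact: ltW].
by apply: divr_ge0; [exact: mulr_ge0|exact: ltW].
Qed.

Lemma ddiff_lipschitz z w : nrm z < r3 -> nrm w < r3 ->
  nrm (ddiff z - ddiff w) <= L * nrm (z - w).
Proof.
move=> zr wr; apply/ler_addgt0Pr => e e0; have [r30 _ /ltW r3r] := r3r.
have L0 := L_ge0; have den0 : 0 < 2 * L + 2 by lra.
pose e' := e / (2 * L + 2); have e'0 : 0 < e' by rewrite divr_gt0.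
have eE : e = (2 * L + 2) * e' by rewrite mulrC divfK // gt_eqF.
clearbody e'; have [t t0 [tr te th]] := ddiff_off r3r zr e'0.
have [s s0 [sr se sh]] := ddiff_off r3r wr e'0.
set z' := z + _ in t0 tr th; set w' := w + _ in s0 sr sh.
have h := ddiff_lipschitz_off t0 s0 (ltW tr) (ltW sr).
have zz : nrm (z' - z) <= e'.
  by rewrite /z' addrC addKr; apply: le_trans te; exact: nrmZ_basis.
have ww : nrm (w' - w) <= e'.
  by rewrite /w' addrC addKr; apply: le_trans se; exact: nrmZ_basis.
have h1 : nrm (z' - w') <= nrm (z - w) + 2 * e'.
  by apply: nrm_perturb; rewrite nrmB.
have h2 := nrm_perturb th sh.
have -> : L * nrm (z - w) + e = L * (nrm (z - w) + 2 * e') + 2 * e' by rewrite eE; ring.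
by apply: (le_trans h2); rewrite lerD2r; apply: (le_trans h); exact: ler_wpM2l.
Qed.

Let r4 : R := r3 / 2.

(** The Lipschitz estimate for the difference quotient of ddiff along a line, between a
small parameter and 1. The constant does not depend on the base point. *)
Lemma ddiff_second_order z v : crd z != 0 -> nrm z < r4 -> nrm v <= r4 / 32 ->
  crd (z + v) != 0 ->
  nrm (ddiff (z + v) - ddiff z - 'd ddiff z v) <= 64 * L / r4 * nrm v ^+ 2.
Proof.
move=> z0 zr vr zv0; have [r30 r31 r3r'] := r3r.
have r40 : 0 < r4 by rewrite /r4; lra.
have [->|v0] := eqVneq v 0.
  by rewrite addr0 subrr linear0 subr0 !nrm0 expr0n mulr0.
have nv : 0 < nrm v by rewrite nrm_gt0.
have dz : differentiable ddiff z by apply: differentiable_ddiff_off => //; rewrite /r4 in zr; lra.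
have L0 := L_ge0.
pose T := r4 / nrm v / 2; have T0 : 0 < T by rewrite !divr_gt0.
have inr (t : C) : nrm t <= T -> nrm (z + t *: v) < r3.
  move=> tT; apply: (le_lt_trans (nrmD _ _)); rewrite nrmZ.
  move: tT; rewrite /T mulrAC ler_pdivlMr // => h; move: zr h; rewrite /r4; lra.
have lip (t : C) : nrm t <= T -> nrm (ddiff (z + t *: v) - ddiff z) <= L * (nrm t * nrm v).
  move=> tT; have -> : nrm t * nrm v = nrm (z + t *: v - z) by rewrite addrC addKr nrmZ.
  by apply: ddiff_lipschitz; [exact: inr|move: zr; rewrite /r4; lra].
have app := diff_approx dz.
have Dv : nrm ('d ddiff z v) <= L * nrm v.
  apply/ler_addgt0Pr => e e0.
  have e'0 : 0 < e / nrm v by rewrite divr_gt0.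
  have [del del0 h] := app _ e'0.
  pose t := Num.min T (del / nrm v / 2).
  have t0 : 0 < t by rewrite lt_min T0 !divr_gt0.
  have tT : t <= T by rewrite /t ge_min lexx.
  have tdel : t * nrm v < del.
    apply: (@le_lt_trans _ _ (del / 2)); last lra.
    by rewrite -ler_pdivlMr // /t ge_min mulrAC lexx orbT.
  clearbody t; have nt : nrm (rc t) = t by rewrite nrm_real gtr0_norm.
  have := h (rc t *: v); rewrite nrmZ nt => /(_ tdel).
  rewrite linearZ /= => h1.
  have := lip (rc t); rewrite nt => /(_ tT) h2.
  have : nrm (rc t *: 'd ddiff z v) <= L * (t * nrm v) + e / nrm v * (t * nrm v).
    have := nrmDB (ddiff (z + rc t *: v) - ddiff z)
      (ddiff (z + rc t *: v) - ddiff z - rc t *: 'd ddiff z v).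
    by rewrite opprB addrC subrK; lra.
  rewrite nrmZ nt (_ : _ + _ = t * (L * nrm v + e)); last first.
    by field; rewrite gt_eqF.
  by rewrite ler_pM2l.
pose g (t : C) := (ddiff (z + t *: v) - ddiff z) / (t - 0) - 'd ddiff z v.
have gB (t : C) : nrm (t - 0) <= T -> nrm (g t) <= 2 * L * nrm v.
  rewrite subr0 => tT; apply: (le_trans (nrmDB _ _)).
  suff : nrm ((ddiff (z + t *: v) - ddiff z) / (t - 0)) <= L * nrm v by move: Dv; lra.
  have [->|t0] := eqVneq t 0.
    by rewrite subr0 invr0 mulr0 nrm0 mulr_ge0 // ltW.
  rewrite subr0 nrmM nrmV ler_pdivrMr ?nrm_gt0 //.
  by apply: (le_trans (lip t tT)); rewrite mulrA mulrAC.
have dg (t : C) : nrm (t - 0) <= T -> t \notin 0 :: cross z v -> differentiable g t.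
  rewrite subr0 inE negb_or => tT /andP[t0 tc]; apply: differentiableB; last exact: differentiable_cst.
  apply: (@differentiable_quotient _ (fun t => ddiff (z + t *: v))) => //.
  apply: differentiable_line; apply: differentiable_ddiff_off.
    by have := inr t tT; lra.
  exact: crossP.
have TE : T * (2 * nrm v) = r4 by rewrite /T; field; rewrite gt_eqF.
have T16 : 1 <= T / 16 by rewrite -(ler_pM2r nv); lra.
have gE : ddiff (z + v) - ddiff z - 'd ddiff z v = g 1.
  by rewrite /g scale1r subr0 divr1.
rewrite gE; apply/ler_addgt0Pr => e e0.
have K0 : 0 <= 64 * L / r4 * nrm v ^+ 2.
  by rewrite mulr_ge0 ?sqr_ge0 // divr_ge0 ?(ltW r40) // mulr_ge0.
set K := 64 * L / r4 * nrm v ^+ 2 in K0 *.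
have e'0 : 0 < e / nrm v / 2 by rewrite !divr_gt0.
have [del del0 h] := app _ e'0.
have z0' : 0 < nrm (crd z) by rewrite nrm_gt0.
pose t := Num.min (Num.min (T / 16) (del / nrm v / 2))
  (Num.min (e / (2 * K + 1)) (nrm (crd z) / nrm v / 2)).
have t0 : 0 < t.
  rewrite /t !lt_min; apply/andP; split; apply/andP; split.
  - by rewrite divr_gt0.
  - by rewrite !divr_gt0.
  - by rewrite divr_gt0 // ltr_wpDl // mulr_ge0.
  - by rewrite !divr_gt0.
have tT : t <= T / 16 by rewrite /t !ge_min lexx.
have tdel : t <= del / nrm v / 2 by rewrite /t !ge_min lexx ?orbT.
have te : t <= e / (2 * K + 1) by rewrite /t !ge_min lexx ?orbT.
have tz : t <= nrm (crd z) / nrm v / 2 by rewrite /t !ge_min lexx ?orbT.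
clearbody t; have nt : nrm (rc t) = t by rewrite nrm_real gtr0_norm.
have rt0 : rc t != 0 by rewrite -nrm_gt0 nt.
have tc : rc t \notin 0 :: cross z v.
  rewrite inE negb_or rt0 /= /cross; case: eqVneq => // vj0; rewrite inE.
  apply/eqP => tE; have : nrm (crd z) = t * nrm (crd v).
    by rewrite -nt -nrmM tE divfK // nrmN.
  have := nrm_coord v j; move: tz; rewrite mulrAC ler_pdivlMr //.
  by move=> h1 h2 h3; have := ler_wpM2l (ltW t0) h2; lra.
have c1 : 1 \notin 0 :: cross z v by rewrite inE oner_eq0 /= cross1.
have := lipschitz_off T0 dg gB (z := 1) (w := rc t).
rewrite !subr0 nrm1 nt => /(_ T16 tT c1 tc).
have -> : 16 * (2 * L * nrm v) / T = K.
  have -> : T = r4 / (2 * nrm v) by rewrite -TE mulfK // gt_eqF // mulr_gt0.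
  by rewrite /K; field; rewrite !gt_eqF.
have n1t : nrm (1 - rc t) <= 1 + t by have := nrmDB (1 : C) (rc t); rewrite nrm1 nt.
have gt : nrm (g (rc t)) <= e / 2.
  have := h (rc t *: v); rewrite nrmZ nt.
  have lt : t * nrm v < del.
    by move: tdel; rewrite mulrAC ler_pdivlMr //; lra.
  move=> /(_ lt); rewrite linearZ /= => h1.
  have -> : g (rc t) = (ddiff (z + rc t *: v) - ddiff z - rc t *: 'd ddiff z v) / rc t.
    by rewrite /g subr0 -[rc t *: 'd ddiff z v]/(rc t * 'd ddiff z v); field.
  rewrite nrmM nrmV nt ler_pdivrMr //; apply: (le_trans h1).
  by rewrite le_eqVlt; apply/orP; left; apply/eqP; field; rewrite gt_eqF.
move: te; rewrite ler_pdivlMr; last by rewrite ltr_wpDl // mulr_ge0.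
have := nrm_tri (g 1) (g (rc t)) 0; rewrite !subr0.
have := ler_wpM2l K0 n1t; lra.
Qed.

Let r5 : R := r4 / 32.

Lemma differentiable_ddiff p : nrm p < r5 -> differentiable ddiff p.
Proof.
have [r30 r31 r3r'] := r3r.
have r4E : r4 = r3 / 2 by []; have r5E : r5 = r4 / 32 by [].
have r40 : 0 < r4 by rewrite r4E; lra.
have r54 : r5 < r4 by rewrite r5E; lra.
have r50 : 0 < r5 by rewrite r5E; lra.
have r43 : r4 < r3 by rewrite r4E; lra.
move=> pr; have [p0|p0] := eqVneq (crd p) 0; last first.
  by apply: differentiable_ddiff_off => //; lra.
have L0 := L_ge0; pose K := 64 * L / r4.
have K0 : 0 <= K by apply: divr_ge0; [exact: mulr_ge0|exact: ltW].
apply: (@differentiable_approx _ _ _ _ K (r5 / 2)); first lra.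
move=> e e0; pose e' := e / (2 * L + 2).
have e'0 : 0 < e' by rewrite divr_gt0 //; lra.
have eE : e = (2 * L + 2) * e' by rewrite mulrC divfK // gt_eqF //; lra.
clearbody e'; have [t t0 [tr te th]] := ddiff_off (ltW (lt_trans r43 r3r')) (lt_trans pr r54) e'0.
set z := p + _ in t0 tr th.
have zp : nrm (z - p) <= e'.
  by rewrite /z addrC addKr; apply: le_trans te; exact: nrmZ_basis.
have dz : differentiable ddiff z by apply: differentiable_ddiff_off => //; lra.
clearbody z; exists ('d ddiff z) => v vr.
have pv : nrm (p + v) < r3.
  by apply: (le_lt_trans (nrmD _ _)); move: vr pr r54 r43; lra.
have zv : nrm (z + v) < r3.
  by apply: (le_lt_trans (nrmD _ _)); move: vr tr; rewrite -/r5; lra.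
have est : nrm (ddiff (z + v) - ddiff z - 'd ddiff z v) <= K * nrm v ^+ 2.
  have vr4 : nrm v <= r4 / 32 by move: vr; rewrite -/r5; lra.
  have [zv0|] := eqVneq (crd (z + v)) 0; last exact: ddiff_second_order.
  (* z + v is then the limit of the points z + (1 - t) v off the hyperplane *)
  have vj : crd v = - crd z.
    by move: zv0; rewrite mxE => /eqP; rewrite addrC addr_eq0 => /eqP.
  apply/ler_addgt0Pr => e1 e10.
  pose m := L * nrm v + nrm ('d ddiff z v) + 1.
  have m0 : 0 < m by rewrite ltr_wpDl // addr_ge0 ?nrm_ge0 // mulr_ge0 ?nrm_ge0.
  pose s := Num.min 1 (e1 / m); have s0 : 0 < s by rewrite lt_min ltr01 divr_gt0.
  have s1 : s <= 1 by rewrite /s ge_min lexx.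
  have sm : s * m <= e1 by rewrite -ler_pdivlMr // /s ge_min lexx orbT.
  clearbody s; pose v' := rc (1 - s) *: v.
  have n1s : nrm (rc (1 - s)) = 1 - s by rewrite nrm_real ger0_norm // subr_ge0.
  have rc1s : rc (1 - s) = 1 - rc s by rewrite rcD rcN; congr (_ - _); exact: rmorph1.
  have v'v : nrm v' <= nrm v.
    by rewrite nrmZ n1s ler_piMl ?nrm_ge0 //; lra.
  have zv'0 : crd (z + v') != 0.
    rewrite /v' !mxE vj rc1s (_ : _ + _ = rc s * crd z); last by ring.
    by rewrite mulf_neq0 // -nrm_gt0 nrm_real gtr0_norm.
  have vv' : v - v' = rc s *: v.
    by rewrite /v' rc1s scalerDl scaleNr scale1r opprD opprK addrA subrr add0r.
  have ns : nrm (rc s) = s by rewrite nrm_real gtr0_norm.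
  have zv' : nrm (z + v') < r3.
    by apply: (le_lt_trans (nrmD _ _)); move: vr tr; rewrite -/r5; lra.
  have a1 : nrm (ddiff (z + v) - ddiff (z + v')) <= L * (s * nrm v).
    apply: (le_trans (ddiff_lipschitz zv zv')); rewrite ler_wpM2l //.
    by rewrite opprD addrACA subrr add0r vv' nrmZ ns.
  have a2 := ddiff_second_order t0 tr (le_trans v'v vr4) zv'0.
  have a3 : nrm v' ^+ 2 <= nrm v ^+ 2 by rewrite lerXn2r ?nnegrE ?nrm_ge0.
  have a4 : nrm ('d ddiff z v' - 'd ddiff z v) = s * nrm ('d ddiff z v).
    by rewrite -linearB /= -opprB vv' linearN linearZ nrmN nrmZ ns.
  have -> : ddiff (z + v) - ddiff z - 'd ddiff z v =
    (ddiff (z + v) - ddiff (z + v')) + (ddiff (z + v') - ddiff z - 'd ddiff z v') +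
    ('d ddiff z v' - 'd ddiff z v) by ring.
  apply: (le_trans (nrmD _ _)); apply: (le_trans (lerD (nrmD _ _) (lexx _))).
  rewrite a4; have := ler_wpM2l K0 a3; move: a1 a2 sm; rewrite /m -/K; lra.
have h1 : nrm (ddiff (p + v) - ddiff (z + v)) <= L * e'.
  apply: (le_trans (ddiff_lipschitz pv zv)); rewrite ler_wpM2l //.
  by rewrite opprD addrACA subrr addr0 nrmB.
have h2 : nrm (ddiff z - ddiff p) <= L * e'.
  by apply: (le_trans (ddiff_lipschitz _ _)); [lra | lra | rewrite ler_wpM2l].
have -> : ddiff (p + v) - ddiff p - 'd ddiff z v = (ddiff (p + v) - ddiff (z + v)) +
   (ddiff (z + v) - ddiff z - 'd ddiff z v) + (ddiff z - ddiff p) by ring.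
apply: (le_trans (nrmD _ _)); apply: (le_trans (lerD (nrmD _ _) (lexx _))).
by move: est h1 h2 eE; lra.
Qed.

End DividedDifference.

Section Hadamard.
Variables (R : realType) (d : nat).
Local Notation C := (complex_field R).
Local Notation V := 'rV[C]_d.
Implicit Types (f g h : V -> C) (a z : V).

Lemma near_nrm_le (W : normedModType C) (P : set W) (x : W) :
  (\forall y \near x, P y) -> exists2 r : R, 0 < r & forall y, nrm (y - x) <= r -> P y.
Proof.
move=> /near_nrm[r r0 h]; exists (r / 2); first lra.
by move=> y yx; apply: h; lra.
Qed.

Lemma near_bounded f z : {for z, continuous f} ->
  \forall y \near z, nrm (f y) <= nrm (f z) + 1.
Proof.
move=> cf; have : \forall w \near f z, nrm w <= nrm (f z) + 1.
  apply/near_nrm; exists 1 => // w wz.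
  by have := nrmD (w - f z) (f z); rewrite subrK; lra.
exact: cf.
Qed.

Definition holf f a := \forall z \near a, differentiable f z.

Lemma holf_bounded f a : holf f a -> exists r : R, [/\ 0 < r,
  forall z, nrm (z - a) <= r -> differentiable f z &
  forall z, nrm (z - a) <= r -> nrm (f z) <= nrm (f a) + 1].
Proof.
move=> df; have := near_bounded (differentiable_continuous (nbhs_singleton df)).
move=> /(filterI df) /near_nrm_le[r r0 h].
by exists r; split=> // z /h[].
Qed.

Lemma divided_difference f j : holf f 0 -> exists2 h, holf h 0 &
  \forall z \near (0 : V), f z = f (kill [:: j] z) + (z 0 j : C) * h z.
Proof.
move=> /holf_bounded[r [r0 df fB]].
have df' z : nrm z <= r -> differentiable f z by move=> zr; apply: df; rewrite subr0.
have fB' z : nrm z <= r -> nrm (f z) <= nrm (f 0) + 1 by move=> zr; apply: fB; rewrite subr0.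
exists (ddiff f j).
  apply/near_nrm; exists (r / 64 / 2 / 64 / 2 / 32); first by rewrite !divr_gt0.
  by move=> z; rewrite subr0; exact: (differentiable_ddiff j r0 df' fB').
apply/near_nrm; exists 1 => // z _; rewrite /ddiff; case: eqVneq => [z0|z0].
  by rewrite z0 mul0r addr0; congr f; rewrite [LHS](kill1E j) z0 scale0r addr0.
by rewrite mulrC divfK // addrC subrK.
Qed.

Lemma holf_kill s f : holf f 0 -> holf (f \o kill s) 0.
Proof.
move=> /near_nrm[r r0 h]; apply/near_nrm; exists r => // z; rewrite subr0 => zr.
apply: differentiable_comp.
  by apply: linear_differentiable; exact: kill_continuous.
by apply: h; rewrite subr0; apply: le_lt_trans zr; exact: nrm_kill.
Qed.

Lemma holf_ext f g a : (\forall z \near a, f z = g z) -> holf f a -> holf g a.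
Proof.
move=> /near_join; rewrite /holf => fg df; near=> z.
apply: (@near_eq_differentiable _ _ _ f); first by near: z.
by near: z.
Unshelve. all: by end_near. Qed.

Lemma holfD f g a : holf f a -> holf g a -> holf (fun z => f z + g z) a.
Proof. by move=> df dg; near do apply: differentiableD. Unshelve. all: by end_near. Qed.

Lemma holfB f g a : holf f a -> holf g a -> holf (fun z => f z - g z) a.
Proof. by move=> df dg; near do apply: differentiableB. Unshelve. all: by end_near. Qed.

Lemma holf_cst (k : C) a : holf (fun=> k) a.
Proof. by apply/near_nrm; exists 1 => // z _; exact: differentiable_cst. Qed.

Lemma holf_coord j a : holf (fun z : V => z 0 j : C) a.
Proof. by apply/near_nrm; exists 1 => // z _; exact: differentiable_coordinate. Qed.

(** The coordinates are replaced by 0 one after the other; each step is a divided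
difference. *)
Lemma hadamard0 f : holf f 0 -> exists2 fs : 'I_d -> V -> C, forall j, holf (fs j) 0 &
  \forall z \near (0 : V), f z = f 0 + \sum_j (z 0 j : C) * fs j z.
Proof.
move=> df; suff [fs dfs fE] : exists2 fs : 'I_d -> V -> C, forall j, holf (fs j) 0 &
    \forall z \near (0 : V), f z = f (kill (enum 'I_d) z) + \sum_j (z 0 j : C) * fs j z.
  exists fs => //; apply: filterS fE => z ->; congr (f _ + _).
  by apply/rowP => i; rewrite !mxE mem_enum.
elim: (enum 'I_d) => [|j s [fs dfs fE]].
  exists (fun _ _ => 0) => [j|]; first exact: holf_cst.
  apply/near_nrm; exists 1 => // z _; rewrite big1 ?addr0 => [|j _]; last by rewrite mulr0.
  by congr f; apply/rowP => i; rewrite !mxE.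
have [h dh hE] := divided_difference j (holf_kill s df).
exists (fun i => if i == j then fun z => fs i z + h z else fs i) => [i|].
  by case: eqP => // _; exact: holfD.
near=> z.
have -> : f z = f (kill s z) + \sum_j (z 0 j : C) * fs j z by near: z.
have -> : f (kill s z) = f (kill s (kill [:: j] z)) + (z 0 j : C) * h z by near: z.
have -> : kill s (kill [:: j] z) = kill (j :: s) z.
  by apply/rowP => i; rewrite !mxE !inE; case: (i \in s); rewrite ?orbT ?orbF.
rewrite -addrA; congr (_ + _); rewrite (bigD1 j) //= [RHS](bigD1 j) //= eqxx.
rewrite addrA mulrDr [X in _ = X + _]addrC; congr (_ + _).
by apply: eq_bigr => i /negbTE ->.
Unshelve. all: by end_near. Qed.

Lemma near_translate (W : normedModType C) (P : set W) (a : W) :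
  (\forall z \near (0 : W), P (a + z)) -> \forall z \near a, P z.
Proof.
move=> /near_nrm[r r0 h]; apply/near_nrm; exists r => // z za.
by have := h (z - a); rewrite subr0 (addrC a) subrK; exact.
Qed.

Lemma near_translateV (W : normedModType C) (P : set W) (a : W) :
  (\forall z \near a, P z) -> \forall z \near (0 : W), P (a + z).
Proof.
move=> /near_nrm[r r0 h]; apply/near_nrm; exists r => // z.
by rewrite subr0 => zr; apply: h; rewrite addrC addKr.
Qed.

Lemma hadamard f a : holf f a -> exists2 fs : 'I_d -> V -> C, forall j, holf (fs j) a &
  \forall z \near a, f z = f a + \sum_j ((z 0 j : C) - a 0 j) * fs j z.
Proof.
move=> df; have df0 : holf (fun z => f (a + z)) 0.
  by apply: filterS (near_translateV df) => z; exact: differentiable_shift.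
have [fs dfs fE] := hadamard0 df0.
exists (fun j z => fs j (z - a)) => [j|].
  apply: near_translate; apply: filterS (dfs j) => z dz.
  have := @differentiable_shift R V C (fs j) (- a) (a + z); rewrite addKr => /(_ dz).
  by under eq_fun do rewrite addrC.
apply: near_translate; apply: filterS fE => z; rewrite addr0 => ->; congr (_ + _).
by apply: eq_bigr => j _; rewrite !mxE [a 0 j + _]addrC addrK [a + z]addrC addrK.
Qed.

Definition vanish a k h := exists K : R, exists2 del : R, 0 < del &
  forall z, nrm (z - a) < del -> nrm (h z) <= K * nrm (z - a) ^+ k.

Lemma vanish_ext a k g h : (\forall z \near a, g z = h z) -> vanish a k g -> vanish a k h.
Proof.
move=> /near_nrm[r r0 gh] [K [del del0 hK]]; exists K, (Num.min r del).
  by rewrite lt_min r0.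
by move=> z; rewrite lt_min => /andP[zr zd]; rewrite -gh //; exact: hK.
Qed.

Lemma vanishD a k g h : vanish a k g -> vanish a k h -> vanish a k (fun z => g z + h z).
Proof.
move=> [K [del del0 hK]] [K' [del' del'0 hK']]; exists (K + K'), (Num.min del del').
  by rewrite lt_min del0.
move=> z; rewrite lt_min => /andP[/hK h1 /hK' h2].
by apply: (le_trans (nrmD _ _)); rewrite mulrDl lerD.
Qed.

Lemma vanish_sum (I : Type) a k (s : seq I) (hs : I -> V -> C) :
  (forall j, vanish a k (hs j)) -> vanish a k (fun z => \sum_(j <- s) hs j z).
Proof.
move=> hv; elim: s => [|j s IH].
  by exists 0, 1 => // z _; rewrite big_nil nrm0 mul0r.
apply: vanish_ext (vanishD (hv j) IH).
by apply/near_nrm; exists 1 => // z _; rewrite big_cons.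
Qed.

Lemma vanishM a k l g h : vanish a k g -> vanish a l h ->
  vanish a (k + l) (fun z => g z * h z).
Proof.
move=> [K [del del0 hK]] [K' [del' del'0 hK']]; exists (K * K'), (Num.min del del').
  by rewrite lt_min del0.
move=> z; rewrite lt_min => /andP[/hK h1 /hK' h2].
by rewrite nrmM exprD mulrACA ler_pM ?nrm_ge0.
Qed.

Lemma vanish_diff a h : differentiable h a -> h a = 0 -> vanish a 1 h.
Proof.
move=> /diff_approx app ha.
have [M [M0 hM]] : exists M : R, 0 <= M /\ forall v, nrm ('d h a v) <= M * nrm v.
  exists (\sum_j nrm ('d h a (basis R j))); split; first by rewrite sumr_ge0 // => j; rewrite nrm_ge0.
  move=> v; rewrite linformE /linform.
  elim/big_rec2 : _ => [|j y z _ h']; first by rewrite nrm0 mul0r.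
  apply: (le_trans (nrmD _ _)); rewrite mulrDl lerD // nrmM mulrC.
  by rewrite ler_wpM2l ?nrm_ge0 ?nrm_coord.
have [del del0 h'] := app 1 ltr01.
exists (M + 1), del => // z zd; have := h' (z - a) zd.
rewrite (addrC a) subrK ha subr0 mul1r expr1 => h1.
have := nrmD (h z - 'd h a (z - a)) ('d h a (z - a)); rewrite subrK.
by have := hM (z - a); lra.
Qed.

Lemma vanish_cont a h : {for a, continuous h} -> vanish a 0 h.
Proof.
move=> /near_bounded /near_nrm[r r0 hr]; exists (nrm (h a) + 1), r => // z zr.
by rewrite expr0 mulr1; exact: hr.
Qed.

(** The identity theorem: restriction to complex lines reduces it to the case of
one variable. *)
Lemma vanish_all_eq0 a h : holf h a -> (forall k, vanish a k h) ->
  \forall z \near a, h z = 0.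
Proof.
move=> /holf_bounded[r [r0 dh hB]] hv; apply/near_nrm; exists (r / 16); first lra.
move=> z za; have [->|zna] := eqVneq z a.
  have [K [del del0 hK]] := hv 1%N; have := hK a; rewrite subrr nrm0 expr1 mulr0 => /(_ del0).
  by rewrite le_eqVlt ltNge nrm_ge0 orbF nrm_eq0 => /eqP.
have u0 : 0 < nrm (z - a) by rewrite nrm_gt0 subr_eq0.
pose T := r / nrm (z - a); have T0 : 0 < T by rewrite divr_gt0.
have inr (t : C) : nrm t <= T -> nrm (a + t *: (z - a) - a) <= r.
  by move=> tT; rewrite addrC addKr nrmZ -ler_pdivlMr.
have := @flat_eq0 R (fun t => h (a + t *: (z - a))) T (nrm (h a) + 1) T0.
move=> /(_ _ _ _ 1); rewrite scale1r (addrC a) subrK; apply => //.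
- by move=> t tT; apply: differentiable_line; apply: dh; exact: inr.
- by move=> t tT; apply: hB; exact: inr.
- move=> k; have [K [del del0 hK]] := hv k.
  exists (K * nrm (z - a) ^+ k), (del / nrm (z - a)); split; first by rewrite divr_gt0.
  move=> t td; have := hK (a + t *: (z - a)); rewrite addrC addKr nrmZ.
  rewrite -ltr_pdivlMr // => /(_ td); rewrite exprMn => /le_trans; apply.
  by rewrite [_ * nrm t ^+ k]mulrAC mulrA.
- by rewrite nrm1 /T mulrAC ler_pdivlMr // mul1r ltW.
Qed.

End Hadamard.

(** * Homomorphisms of algebras of germs *)

(** The relation Phi f f' expresses that the homomorphism maps the germ of f at a to that
of f' at b. Working with functions and a relation avoids the choice of
representatives. *)

Section GermHomomorphism.
Variables (R : realType) (d1 d2 : nat).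
Local Notation C := (complex_field R).
Local Notation V1 := 'rV[C]_d1.
Local Notation V2 := 'rV[C]_d2.
Variables (a : V1) (b : V2) (Phi : (V1 -> C) -> (V2 -> C) -> Prop) (g : 'I_d1 -> V2 -> C).

Definition row_fun (w : V2) : V1 := \row_j g j w.

Lemma row_fun_differentiable w : (forall j, differentiable (g j) w) ->
  differentiable row_fun w.
Proof.
move=> dg; have -> : row_fun = \sum_j (fun w => g j w *: (delta_mx 0 j : V1)).
  apply/funext => v; rewrite fct_sumE; apply/rowP => i; rewrite mxE summxE.
  rewrite (bigD1 i) //= !mxE !eqxx mulr1 big1 ?addr0 // => j ji.
  by rewrite !mxE eq_sym (negbTE ji) mulr0.
by apply: differentiable_sum => j; exact: differentiableZl.
Qed.

Hypothesis Phi_total : forall f, holf f a -> exists f', Phi f f'.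
Hypothesis Phi_fun : forall f1 f2 f' f'', Phi f1 f' -> Phi f2 f'' ->
  (\forall z \near a, f1 z = f2 z) -> \forall w \near b, f' w = f'' w.
Hypothesis Phi_hol : forall f f', Phi f f' -> holf f' b.
Hypothesis Phi_value : forall f f', Phi f f' -> f' b = f a.
Hypothesis PhiD : forall f1 f1' f2 f2', Phi f1 f1' -> Phi f2 f2' ->
  Phi (fun z => f1 z + f2 z) (fun w => f1' w + f2' w).
Hypothesis PhiM : forall f1 f1' f2 f2', Phi f1 f1' -> Phi f2 f2' ->
  Phi (fun z => f1 z * f2 z) (fun w => f1' w * f2' w).
Hypothesis Phi_cst : forall k, Phi (fun=> k) (fun=> k).
Hypothesis Phi_coord : forall j, Phi (fun z => z 0 j) (g j).

Lemma row_fun_base : row_fun b = a.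
Proof. by apply/rowP => j; rewrite mxE (Phi_value (Phi_coord j)). Qed.

Lemma row_fun_hol : \forall w \near b, differentiable row_fun w.
Proof.
have : \forall w \near b, forall j, differentiable (g j) w.
  apply: (@filter_forall _ _ (fun j w => differentiable (g j) w) (nbhs b)) => j.
  exact: Phi_hol (Phi_coord j).
by apply: filterS => w; exact: row_fun_differentiable.
Qed.

Let near_row (P : set V1) : (\forall z \near a, P z) -> \forall w \near b, P (row_fun w).
Proof.
have c : row_fun @ b --> row_fun b := differentiable_continuous (nbhs_singleton row_fun_hol).
by rewrite row_fun_base in c; exact: (c P).
Qed.

Lemma Phi_sum (s : seq 'I_d1) (fs : 'I_d1 -> V1 -> C) (fs' : 'I_d1 -> V2 -> C) :
  (forall j, Phi (fs j) (fs' j)) ->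
  Phi (fun z => \sum_(j <- s) fs j z) (fun w => \sum_(j <- s) fs' j w).
Proof.
move=> h; elim: s => [|j s IH].
  under eq_fun do rewrite big_nil; under [X in Phi _ X]eq_fun do rewrite big_nil.
  exact: Phi_cst.
under eq_fun do rewrite big_cons; under [X in Phi _ X]eq_fun do rewrite big_cons.
exact: PhiD.
Qed.

(** The two sides agree modulo functions that vanish to order k, by induction on k and
Hadamard's lemma, and therefore they agree near b. *)
Lemma germ_hom_pullback f f' : holf f a -> Phi f f' ->
  \forall w \near b, f' w = f (row_fun w).
Proof.
have holc f1 : holf f1 a -> holf (f1 \o row_fun) b.
  move=> /near_row; apply: filterS2 row_fun_hol => w dr df1.
  exact: differentiable_comp.
have van k f1 f1' : holf f1 a -> Phi f1 f1' ->
    vanish b k (fun w => f1' w - f1 (row_fun w)).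
  elim: k f1 f1' => [|k IH] f1 f1' hf1 P1.
    apply: vanish_cont; apply: differentiable_continuous.
    exact: nbhs_singleton (holfB (Phi_hol P1) (holc _ hf1)).
  have [fs hfs f1E] := hadamard hf1.
  have /choice[fs' Pfs] : forall j, exists f', Phi (fs j) f'.
    by move=> j; exact: Phi_total.
  have P2 : Phi (fun z => f1 a + \sum_j ((z 0 j : C) - a 0 j) * fs j z)
      (fun w => f1 a + \sum_j (g j w - a 0 j) * fs' j w).
    apply: PhiD => //; apply: Phi_sum => j; apply: PhiM => //.
    exact: (PhiD (Phi_coord j) (Phi_cst (- a 0 j))).
  have f1'E := Phi_fun P1 P2 f1E; have f1E' := near_row f1E.
  pose hs j w := (g j w - a 0 j) * (fs' j w - fs j (row_fun w)).
  apply: (@vanish_ext _ _ b k.+1 (fun w => \sum_j hs j w)).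
    near=> w.
    have -> : f1' w = f1 a + \sum_j (g j w - a 0 j) * fs' j w by near: w.
    have -> : f1 (row_fun w) = f1 a + \sum_j ((row_fun w) 0 j - a 0 j) * fs j (row_fun w).
      by near: w; exact: f1E'.
    rewrite opprD addrACA subrr add0r -sumrB; apply: eq_bigr => j _.
    by rewrite /hs mxE mulrBr.
  apply: vanish_sum => j; apply: (@vanishM _ _ b 1 k); last exact: IH.
  have hg := Phi_hol (Phi_coord j).
  apply: vanish_diff; last by rewrite (Phi_value (Phi_coord j)) subrr.
  by apply: differentiableB; [exact: nbhs_singleton hg|exact: differentiable_cst].
move=> hf P; have := vanish_all_eq0 (holfB (Phi_hol P) (holc _ hf)) (fun k => van k _ _ hf P).
by apply: filterS => w /eqP; rewrite subr_eq0 => /eqP.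
Unshelve. all: by end_near. Qed.

End GermHomomorphism.

(** * Sections and germs of the structure sheaf *)

Section Germs.
Variables (R : realType) (d : nat) (Y : atlas_space R d).
Local Notation C := (complex_field R).
Local Notation OY := (structure_sheaf Y).
Implicit Types (x y z : Y) (c : chart R Y d) (N : opens Y).

Definition mk_sec N (h : Y -> C) (hO : forall x, N x -> holomorphic_fun_at x h) : OY N :=
  @LcSection _ _ _ (holomorphic_condition Y) N (@restrict0 _ _ (fun=> complex_calg R) N h)
    (fun x Nx => @restrict0_on _ _ _ (holomorphic_condition Y) N h x Nx (hO x Nx))
    (fun x nOx => restrict0_out _ nOx).

Lemma mk_secE N h hO x : N x -> @mk_sec N h hO x = h x.
Proof. exact: restrict0_in. Qed.

Lemma germ_eqP N N' x (Nx : N x) (Nx' : N' x) (s : OY N) (t : OY N') :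
  germ Nx s = germ Nx' t <-> \forall z \near x, s z = t z.
Proof.
split=> [/germP[W [WO [WO' [Wx e]]]]|].
  near=> z; have Wz : W z by near: z; exact: near_opens.
  have := congr1 (fun u : lc_section (holomorphic_condition Y) W => u z) e.
  by rewrite /= !restrict0_in.
move=> st; pose W0 := [set z | s z = t z].
pose W := opensI (opensI N N') (Opens (open_interior W0)).
have WO : W `<=` N by move=> z [[]].
have WO' : W `<=` N' by move=> z [[]].
apply/germP; exists W, WO, WO'; split; first by split.
by apply: sec_ext => z Wz; rewrite !sec_resE //; case: Wz => _ /interior_subset.
Unshelve. all: by end_near. Qed.

Lemma chart_near c x : cdom c x ->
  \forall w \near cmap c x, cdom c (cinv c w) /\ cmap c (cinv c w) = w.
Proof.
move=> cx; have : \forall w \near cmap c x, (cmap c @` cdom c) w.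
  by apply: open_nbhs_nbhs; split; [exact: cimg_open|exists x].
by apply: filterS => _ [y cy <-]; rewrite !cmapK.
Qed.

Lemma near_cmap c x (P : set 'rV[C]_d) : cdom c x ->
  (\forall w \near cmap c x, P w) -> \forall z \near x, P (cmap c z).
Proof. by move=> cx; exact: (cmap_continuous cx). Qed.

Lemma near_cdom c x : cdom c x -> \forall z \near x, cdom c z.
Proof. by move=> cx; apply: open_nbhs_nbhs; split=> //; exact: cdom_open. Qed.

Lemma holomorphic_fun_chart c x (f : 'rV[C]_d -> C) : atlas c -> cdom c x ->
  differentiable f (cmap c x) -> holomorphic_fun_at x (f \o cmap c).
Proof.
move=> ac cx df c' ac' c'x.
rewrite -[_ \o cinv c']/(f \o (cmap c \o cinv c')).
apply: differentiable_comp; first exact: atlas_compatible.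
by rewrite /= cmapK.
Qed.

Lemma chart_section c x (f : 'rV[C]_d -> C) : atlas c -> cdom c x ->
  holf f (cmap c x) -> exists (N : opens Y) (Nx : N x) (t : OY N),
    N `<=` cdom c /\ forall z, N z -> t z = f (cmap c z).
Proof.
move=> ac cx hf; pose P := [set z | cdom c z /\ differentiable f (cmap c z)].
have Px : P^° x by apply: filterI; [exact: near_cdom|exact: (near_cmap cx hf)].
pose N := Opens (open_interior P).
have hO z : N z -> holomorphic_fun_at z (f \o cmap c).
  by move=> /interior_subset[cz dz]; exact: holomorphic_fun_chart.
exists N, Px, (mk_sec hO); split; first by move=> z /interior_subset[].
by move=> z Nz; rewrite mk_secE.
Qed.

Lemma holf_section c x N (t : OY N) : atlas c -> cdom c x -> N x ->
  holf (t \o cinv c) (cmap c x).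
Proof.
move=> ac cx Nx; near=> w.
have [cw wE] : cdom c (cinv c w) /\ cmap c (cinv c w) = w by near: w; exact: chart_near.
have Ow : N (cinv c w) by near: w; exact: near_cinv cx (near_opens Nx).
by rewrite -wE; exact: (sec_on t Ow).
Unshelve. all: by end_near. Qed.

(** Germs are described by functions on all of Y, whose values far from x are
irrelevant. *)
Definition germ_of x (a : stalk OY x) (h : Y -> C) :=
  exists (N : opens Y) (Nx : N x) (t : OY N), a = germ Nx t /\ \forall z \near x, t z = h z.

Lemma germ_of_eq x (a b : stalk OY x) h h' : germ_of a h -> germ_of b h' ->
  (\forall z \near x, h z = h' z) <-> a = b.
Proof.
move=> [N [Nx [t [-> th]]]] [N' [Nx' [t' [-> th']]]]; rewrite germ_eqP; split=> e.
  by apply: filterS3 th th' e => z -> ->.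
by apply: filterS3 th th' e => z <- <-.
Qed.

Let germ_of_op (op : C -> C -> C) x (a b c : stalk OY x) h h' :
  (forall N (Nx : N x) (s t : OY N), a = germ Nx s -> b = germ Nx t ->
     exists u : OY N, c = germ Nx u /\ forall z, N z -> u z = op (s z) (t z)) ->
  germ_of a h -> germ_of b h' -> germ_of c (fun z => op (h z) (h' z)).
Proof.
move=> ex [N [Nx [t [e th]]]] [N' [Nx' [t' [e' th']]]].
have NI : opensI N N' `<=` N by move=> ? [].
have NI' : opensI N N' `<=` N' by move=> ? [].
pose NIx : opensI N N' x := conj Nx Nx'.
have [||u [cu uE]] := ex _ NIx (res NI t) (res NI' t'); rewrite ?germ_res //.
exists (opensI N N'), NIx, u; split=> //.
by apply: filterS3 th th' (near_opens NIx) => z <- <- Nz; rewrite uE // !sec_resE.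
Qed.

Lemma germ_ofD x (a b : stalk OY x) h h' : germ_of a h -> germ_of b h' ->
  germ_of (a + b) (fun z => h z + h' z).
Proof.
apply: (germ_of_op (op := +%R)) => N Nx s t -> ->.
by exists (s + t); rewrite germD; split=> // z _; rewrite secDE.
Qed.

Lemma germ_ofM x (a b : stalk OY x) h h' : germ_of a h -> germ_of b h' ->
  germ_of (a * b) (fun z => h z * h' z).
Proof.
apply: (germ_of_op (op := *%R)) => N Nx s t -> ->.
by exists (s * t); rewrite germM; split=> // z _; rewrite secME.
Qed.

Lemma germ_of_scal x k : germ_of (scal (stalk OY x) k) (fun=> k).
Proof.
exists (opensT _), I, (scal _ k); split; first by rewrite germ_scal.
by apply: nearW => z; rewrite sec_scalE.
Qed.

Lemma germ_of_val x (a : stalk OY x) h : germ_of a h -> eval_germ a = h x.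
Proof. by move=> [N [Nx [t [-> th]]]]; rewrite eval_germE (nbhs_singleton th). Qed.

End Germs.

(** * Local models of a thickening *)

Section Thickening.
Variables (R : realType) (M : topologicalType) (A : sheaf R M).
Local Notation C := (complex_field R).
Variable val : forall V : opens M, A V -> M -> C.

(** A map [temb] to a complex manifold, together with an identification of the
stalks of A with those of the inverse image of the structure sheaf that comes
from an isomorphism of sheaves over [tdom]. Describing the isomorphism by the
germs of the images of sections makes it possible to treat A, its restrictions
and inverse image sheaves alike. *)
Record thickening (d : nat) (Y : atlas_space R d) := Thickening {
  tdom : opens M;
  temb : M -> Y;
  tgerm : forall V : opens M, A V -> forall y, stalk (structure_sheaf Y) (temb y);
  temb_continuous : forall y, tdom y -> {for y, continuous temb};
  tgermD : forall (V : opens M) (a b : A V) y, tdom y -> V y ->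
    tgerm (a + b) y = tgerm a y + tgerm b y;
  tgermM : forall (V : opens M) (a b : A V) y, tdom y -> V y ->
    tgerm (a * b) y = tgerm a y * tgerm b y;
  tgerm_scal : forall (V : opens M) k y, tdom y -> V y ->
    tgerm (scal (A V) k) y = scal (stalk (structure_sheaf Y) (temb y)) k;
  tgerm_res : forall (V W : opens M) (WV : W `<=` V) (a : A V) y, tdom y -> W y ->
    tgerm (res WV a) y = tgerm a y;
  tgerm_local : forall (V : opens M) (a : A V) y, tdom y -> V y ->
    from_section y (tgerm a);
  tgerm_lift : forall y, tdom y -> forall (N : opens Y) (Ny : N (temb y))
    (t : structure_sheaf Y N), exists (V : opens M) (Vy : V y) (a : A V),
    forall y', V y' -> tdom y' /\ exists Ny' : N (temb y'), tgerm a y' = germ Ny' t;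
  tgerm_inj : forall (V : opens M) (a b : A V) y, tdom y -> V y ->
    tgerm a y = tgerm b y ->
    exists (W : opens M) (WV : W `<=` V), W y /\ res WV a = res WV b;
  tgerm_val : forall (V : opens M) (a : A V) y, tdom y -> V y ->
    eval_germ (tgerm a y) = val a y
}.

(** Near a given point of M a single chart of the manifold suffices. *)
Record local_model (d : nat) := LocalModel {
  lm_space : atlas_space R d;
  lm_thick :> thickening lm_space;
  lm_chart : chart R lm_space d;
  lm_atlas : atlas lm_chart
}.

Definition mdom d (L : local_model d) y := tdom L y /\ cdom (lm_chart L) (temb L y).

Definition memb d (L : local_model d) y : 'rV[C]_d := cmap (lm_chart L) (temb L y).

(** Coordinates turn germs at all points of M into functions of one type, so that
they can be compared for different local models. *)
Definition rep d (L : local_model d) y (V : opens M) (a : A V) (f : 'rV[C]_d -> C) :=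
  germ_of (tgerm L a y) (f \o cmap (lm_chart L)).

Section Representation.
Variables (d : nat) (L : local_model d).
Implicit Types (f g : 'rV[C]_d -> C) (y : M).
Local Notation c := (lm_chart L).

Lemma mdom_near y : mdom L y -> \forall y' \near y, mdom L y'.
Proof.
move=> [Ty cy]; apply: filterI; first exact: near_opens.
exact: (temb_continuous Ty) (near_cdom cy).
Qed.

Lemma memb_continuous y : mdom L y -> {for y, continuous (memb L)}.
Proof.
move=> [Ty cy]; apply: continuous_comp; first exact: temb_continuous.
exact: cmap_continuous.
Qed.

Lemma rep_hol y V (a : A V) f : mdom L y -> rep L y a f -> holf f (memb L y).
Proof.
move=> [Ty cy] [N [Ny [t [e tf]]]].
apply: holf_ext (holf_section t (lm_atlas L) cy Ny).
near=> w; have [_ wE] : cdom c (cinv c w) /\ cmap c (cinv c w) = w.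
  by near: w; exact: chart_near.
rewrite -[in RHS]wE /=; near: w; exact: near_cinv cy tf.
Unshelve. all: by end_near. Qed.

Lemma rep_ex y (V : opens M) (a : A V) : mdom L y -> V y ->
  exists f, \forall y' \near y, rep L y' a f.
Proof.
move=> hy Vy; have [N [t ta]] := tgerm_local a hy.1 Vy; exists (t \o cinv c).
near=> y'; have [Ny' e] : exists Ny' : N (temb L y'), tgerm L a y' = germ Ny' t by near: y'.
have [Ty' cy'] : mdom L y' by near: y'; exact: mdom_near.
exists N, Ny', t; split=> //; apply: filterS (near_cdom cy') => z cz /=.
by rewrite cmapK.
Unshelve. all: by end_near. Qed.

Lemma rep_lift y f : mdom L y -> holf f (memb L y) ->
  exists (V : opens M) (a : A V), V y /\ forall y', V y' -> mdom L y' /\ rep L y' a f.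
Proof.
move=> [Ty cy] hf; have [N [Ny [t [Nc tf]]]] := chart_section (lm_atlas L) cy hf.
have [V [Vy [a ha]]] := tgerm_lift Ty Ny t.
exists V, a; split=> // y' /ha[Ty' [Ny' e]]; split; first by split=> //; exact: Nc.
by exists N, Ny', t; split=> //; apply: filterS (near_opens Ny').
Qed.

Lemma rep_fun y V (a : A V) f g : mdom L y -> rep L y a f -> rep L y a g ->
  \forall w \near memb L y, f w = g w.
Proof.
move=> [Ty cy] ra rb; have h := (germ_of_eq ra rb).2 erefl; near=> w.
have [_ wE] : cdom c (cinv c w) /\ cmap c (cinv c w) = w.
  by near: w; exact: chart_near.
by rewrite -wE; near: w; exact: near_cinv cy h.
Unshelve. all: by end_near. Qed.

Lemma rep_near y V (a : A V) f g : mdom L y ->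
  (\forall w \near memb L y, f w = g w) -> rep L y a f -> rep L y a g.
Proof.
move=> [Ty cy] fg [N [Ny [t [e tf]]]]; exists N, Ny, t; split=> //.
by apply: filterS2 tf (near_cmap cy fg) => z -> /= ->.
Qed.

Lemma rep_res y (V W : opens M) (WV : W `<=` V) (a : A V) f : mdom L y -> W y ->
  rep L y (res WV a) f <-> rep L y a f.
Proof. by move=> [Ty _] Wy; rewrite /rep tgerm_res. Qed.

Lemma rep_inj y (V : opens M) (a b : A V) f : mdom L y -> V y ->
  rep L y a f -> rep L y b f ->
  exists (W : opens M) (WV : W `<=` V), W y /\ res WV a = res WV b.
Proof.
move=> [Ty cy] Vy ra rb; apply: (tgerm_inj Ty Vy).
by apply: (germ_of_eq ra rb).1; exact: nearW.
Qed.

Lemma repD y (V : opens M) (a b : A V) f g : mdom L y -> V y ->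
  rep L y a f -> rep L y b g -> rep L y (a + b) (fun w => f w + g w).
Proof. by move=> [Ty _] Vy; rewrite /rep tgermD //; exact: germ_ofD. Qed.

Lemma repM y (V : opens M) (a b : A V) f g : mdom L y -> V y ->
  rep L y a f -> rep L y b g -> rep L y (a * b) (fun w => f w * g w).
Proof. by move=> [Ty _] Vy; rewrite /rep tgermM //; exact: germ_ofM. Qed.

Lemma rep_scal y (V : opens M) k : mdom L y -> V y -> rep L y (scal (A V) k) (fun=> k).
Proof. by move=> [Ty _] Vy; rewrite /rep tgerm_scal //; exact: germ_of_scal. Qed.

Lemma rep_val y (V : opens M) (a : A V) f : mdom L y -> V y -> rep L y a f ->
  f (memb L y) = val a y.
Proof. by move=> [Ty _] Vy /germ_of_val; rewrite tgerm_val. Qed.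

End Representation.

(** The stalks of the structure sheaves of two local models at y are both identified with
that of A; g is a map that induces this comparison. *)
Definition induces d1 d2 (L1 : local_model d1) (L2 : local_model d2) y
    (g : 'rV[C]_d2 -> 'rV[C]_d1) :=
  forall (V : opens M) (a : A V) f, V y -> rep L1 y a f -> rep L2 y a (f \o g).

Lemma induces_id d (L : local_model d) y : induces L L y id.
Proof. by []. Qed.

Lemma induces_comp d1 d2 d3 (L1 : local_model d1) (L2 : local_model d2)
    (L3 : local_model d3) y g h :
  induces L1 L2 y g -> induces L2 L3 y h -> induces L1 L3 y (g \o h).
Proof. by move=> ig ih V a f Vy r; exact: ih (ig _ _ _ Vy r). Qed.

Section Transition.
Variables (d1 d2 : nat) (L1 : local_model d1) (L2 : local_model d2).

(** Coordinate functions determine the map. *)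
Lemma induces_unique y g h : mdom L1 y -> mdom L2 y ->
  induces L1 L2 y g -> induces L1 L2 y h -> \forall w \near memb L2 y, g w = h w.
Proof.
move=> h1 h2 ig ih.
suff : \forall w \near memb L2 y, forall j, g w 0 j = h w 0 j.
  by apply: filterS => w gh; apply/rowP.
apply: (@filter_forall _ _ (fun j w => g w 0 j = h w 0 j) (nbhs (memb L2 y))) => j.
have [V [a [Vy /(_ y Vy)[_ r]]]] := rep_lift h1 (holf_coord j (memb L1 y)).
exact: (rep_fun h2 (ig _ _ _ Vy r) (ih _ _ _ Vy r)).
Qed.

Lemma induces_base y g : mdom L1 y -> mdom L2 y -> induces L1 L2 y g ->
  g (memb L2 y) = memb L1 y.
Proof.
move=> h1 h2 ig; apply/rowP => j.
have [V [a [Vy /(_ y Vy)[_ r]]]] := rep_lift h1 (holf_coord j (memb L1 y)).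
by have := rep_val h2 Vy (ig _ _ _ Vy r); rewrite -(rep_val h1 Vy r).
Qed.

Lemma induces_near y g h : mdom L2 y -> (\forall w \near memb L2 y, g w = h w) ->
  induces L1 L2 y g -> induces L1 L2 y h.
Proof.
move=> h2 gh ig V a f Vy r; apply: rep_near h2 _ (ig _ _ _ Vy r).
by apply: filterS gh => w /= ->.
Qed.

(** The coordinates of L1, as germs of functions, lift to sections of A, which are
represented in L2 by certain functions. These are the components of g, not only at y
but at all nearby points, where [germ_hom_pullback] applies. *)
Lemma transition_ex y : mdom L1 y -> mdom L2 y ->
  exists2 g, \forall w \near memb L2 y, differentiable g w &
    \forall y' \near y, induces L1 L2 y' g.
Proof.
move=> h1 h2.
have /choice[p hp] : forall j : 'I_d1, exists p : {V : opens M & A V}, projT1 p y /\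
    forall y', projT1 p y' -> mdom L1 y' /\ rep L1 y' (projT2 p) (fun z => z 0 j).
  move=> j; have [V [a h]] := rep_lift h1 (holf_coord j (memb L1 y)).
  by exists (existT _ V a).
have /choice[g hg] : forall j, exists f, \forall y' \near y, rep L2 y' (projT2 (p j)) f.
  by move=> j; apply: rep_ex => //; have [] := hp j.
exists (row_fun g).
  have : \forall w \near memb L2 y, forall j, differentiable (g j) w.
    apply: (@filter_forall _ _ (fun j w => differentiable (g j) w) (nbhs (memb L2 y))) => j.
    exact: rep_hol h2 (nbhs_singleton (hg j)).
  by apply: filterS => w; exact: row_fun_differentiable.
have {}hg : \forall y' \near y, forall j, rep L2 y' (projT2 (p j)) (g j).
  exact: filter_forall.
have hV : \forall y' \near y, forall j, projT1 (p j) y'.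
  by apply: filter_forall => j; apply: near_opens; have [] := hp j.
near=> y'.
have h1' : mdom L1 y' by near: y'; exact: mdom_near.
have h2' : mdom L2 y' by near: y'; exact: mdom_near.
have g' : forall j, rep L2 y' (projT2 (p j)) (g j) by near: y'.
have V' : forall j, projT1 (p j) y' by near: y'.
move=> V a f Vy r.
pose Phi (f1 : 'rV[C]_d1 -> C) (f2 : 'rV[C]_d2 -> C) :=
  exists (W : opens M) (b : A W), [/\ W y', rep L1 y' b f1 & rep L2 y' b f2].
have [f' /nbhs_singleton r'] := rep_ex a h2' Vy.
have common f1 f1' f2 f2' : Phi f1 f1' -> Phi f2 f2' ->
    exists (W : opens M) (b b' : A W), [/\ W y', rep L1 y' b f1, rep L2 y' b f1',
      rep L1 y' b' f2 & rep L2 y' b' f2'].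
  move=> [W1 [b1 [W1y r1 r1']]] [W2 [b2 [W2y r2 r2']]].
  have WI1 : opensI W1 W2 `<=` W1 by move=> ? [].
  have WI2 : opensI W1 W2 `<=` W2 by move=> ? [].
  by exists (opensI W1 W2), (res WI1 b1), (res WI2 b2); split=> //; apply/rep_res.
have pull : \forall w \near memb L2 y', f' w = f (row_fun g w).
  apply: (@germ_hom_pullback _ _ _ (memb L1 y') (memb L2 y') Phi) => //.
  - move=> f1 hf1; have [W [b [Wy /(_ y' Wy)[_ rb]]]] := rep_lift h1' hf1.
    by have [f2 /nbhs_singleton rb'] := rep_ex b h2' Wy; exists f2, W, b.
  - move=> f1 f2 f1' f2' P1 P2 f12; have [W [b [b' [Wy r1 r1' r2 r2']]]] := common _ _ _ _ P1 P2.
    have [W' [WV [Wy' e]]] := rep_inj h1' Wy (rep_near h1' f12 r1) r2.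
    apply: (rep_fun h2'); first by apply/(rep_res WV b) => //; exact: r1'.
    by rewrite e; apply/rep_res.
  - by move=> f1 f1' [W [b [Wy rb rb']]]; exact: rep_hol h2' rb'.
  - move=> f1 f1' [W [b [Wy rb rb']]].
    by rewrite (rep_val h2' Wy rb') -(rep_val h1' Wy rb).
  - move=> f1 f1' f2 f2' P1 P2; have [W [b [b' [Wy r1 r1' r2 r2']]]] := common _ _ _ _ P1 P2.
    by exists W, (b + b'); split=> //; exact: repD.
  - move=> f1 f1' f2 f2' P1 P2; have [W [b [b' [Wy r1 r1' r2 r2']]]] := common _ _ _ _ P1 P2.
    by exists W, (b * b'); split=> //; exact: repM.
  - by move=> k; exists (opensT M), (scal _ k); split=> //; exact: rep_scal.
  - move=> j; exists (projT1 (p j)), (projT2 (p j)); split=> //.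
    by have [_ /(_ y' (V' j))[]] := hp j.
  - exact: rep_hol h1' r.
  - by exists V, a.
exact: rep_near h2' pull r'.
Unshelve. all: by end_near. Qed.

Lemma induces_differentiable y g : mdom L1 y -> mdom L2 y -> induces L1 L2 y g ->
  \forall w \near memb L2 y, differentiable g w.
Proof.
move=> h1 h2 ig; have [h dh /nbhs_singleton ih] := transition_ex h1 h2.
have gh := near_join (induces_unique h1 h2 ih ig); near=> w.
apply: (@near_eq_differentiable _ _ _ h); first by near: w.
by near: w.
Unshelve. all: by end_near. Qed.

End Transition.

End Thickening.

Section ThickeningOfIso.
Variables (R : realType) (M : topologicalType) (A : sheaf R M).
Local Notation C := (complex_field R).
Variable val : forall V : opens M, A V -> M -> C.
Variables (d : nat) (Y : atlas_space R d) (i : M -> Y).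
Local Notation OY := (structure_sheaf Y).
Variable alpha : sheaf_mor A (inverse_image i OY).
Hypothesis i_cont : continuous i.
Hypothesis alpha_iso : sheaf_iso alpha.
Hypothesis alpha_val : forall (V : opens M) (a : A V) y, V y ->
  eval_germ (alpha V a y) = val a y.

Lemma germ_irr (Z : topologicalType) (F : sheaf R Z) (z : Z) (N : opens Z)
  (Nz Nz' : N z) (s : F N) : germ Nz s = germ Nz' s.
Proof. by rewrite (Prop_irrelevance Nz Nz'). Qed.

Lemma pull_section (N : opens Y) (t : OY N) :
  exists (V : opens M) (s : inverse_image i OY V), V = i @^-1` N :> set M /\
    forall y (Ny : N (i y)), s y = germ Ny t.
Proof.
have oV : open (i @^-1` N) by apply: open_comp (opens_open N) => y _; exact: i_cont.
pose f y : stalk OY (i y) := if pselect (N (i y)) is left h then germ h t else 0.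
have fE y (Ny : N (i y)) : f y = germ Ny t.
  by rewrite /f; case: pselect => // h; exact: germ_irr.
have f_on y : Opens oV y -> from_section y f.
  move=> Vy; exists N, t; apply: filterS (near_opens Vy) => y' Ny'.
  by exists Ny'; exact: fE.
have f_off y : ~ Opens oV y -> f y = 0 by move=> nV; rewrite /f; case: pselect.
by exists (Opens oV), (@LcSection _ _ _ (from_section_condition i OY) (Opens oV) f f_on f_off).
Qed.

Lemma thickening_of_iso : exists T : thickening val Y, tdom T = opensT M /\ temb T = i /\
  forall V (a : A V) y (N : opens Y) (Ny : N (temb T y)) (Ny' : N (i y)) (t : OY N),
    tgerm T a y = germ Ny t <-> alpha V a y = germ Ny' t.
Proof.
have [beta [ab ba]] := alpha_iso.
unshelve refine (let T := @Thickening R M A val d Y (opensT M) i (fun V a y => alpha V a y)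
  _ _ _ _ _ _ _ _ _ in _).
- by move=> y _; exact: i_cont.
- by move=> V a b y _ Vy; rewrite raddfD secDE.
- by move=> V a b y _ Vy; rewrite rmorphM secME.
- by move=> V k y _ Vy; rewrite mor_scal; exact: (@sec_scalE _ _ _ (from_section_condition i OY)).
- by move=> V W WV a y _ Wy; rewrite mor_res; exact: (@sec_resE _ _ _ (from_section_condition i OY)).
- by move=> V a y _ Vy; exact: (sec_on (alpha V a) Vy).
- move=> y _ N Ny t; have [V [s [VE sE]]] := pull_section t.
  have Vy : V y by rewrite /opens_pred VE.
  exists V, Vy, (beta V s) => y' Vy'; split=> //.
  have Ny' : N (i y') by move: Vy'; rewrite /opens_pred VE.
  by exists Ny'; rewrite ba.
- move=> V a b y _ Vy e.
  have [N [t ta]] := sec_on (alpha V a) Vy; have [N' [t' tb]] := sec_on (alpha V b) Vy.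
  have [Ny eA] := nbhs_singleton ta; have [Ny' eB] := nbhs_singleton tb.
  have /near_join tt' : \forall z \near i y, t z = t' z.
    by apply/(germ_eqP Ny Ny' t t'); rewrite -eA -eB.
  have : \forall y' \near y, alpha V a y' = alpha V b y'.
    have c : i @ y --> i y by exact: i_cont.
    have {}tt' : \forall y' \near y, \forall z \near i y', t z = t' z := c _ tt'.
    apply: filterS3 ta tb tt' => y' [h ->] [h' ->] tt'.
    exact/germ_eqP.
  move=> ab'.
  pose W := opensI V (Opens (open_interior [set y' | alpha V a y' = alpha V b y'])).
  have WV : W `<=` V by move=> ? [].
  exists W, WV; split; first by split.
  apply: (can_inj (ab W)); rewrite !mor_res; apply: sec_ext => y' Wy'.
  by rewrite !sec_resE //; case: Wy' => _ /interior_subset.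
- by move=> V a y _ Vy; exact: alpha_val.
- exists T; split=> //; split=> // V a y N Ny Ny' t.
  by rewrite (germ_irr Ny Ny').
Qed.

End ThickeningOfIso.

Section ThickeningOfRestriction.
Variables (R : realType) (m : nat) (M : atlas_space R m) (A : sheaf R M).
Local Notation C := (complex_field R).
Variable val : forall V : opens M, A V -> M -> C.
Hypothesis val_res : forall (V W : opens M) (WV : W `<=` V) (a : A V) y, W y ->
  val (res WV a) y = val a y.
Variables (U : opens M) (d : nat) (Y : atlas_space R d) (x0 : set_type U).
Local Notation AU := (sheaf_restr U A).
Variable T : thickening (fun V (a : AU V) y => val (a : A (image_val V)) (set_val y)) Y.
Hypothesis T_dom : tdom T = opensT _.

Lemma open_trace (V : opens M) : open (set_val @^-1` V : set (set_type U)).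
Proof. by exists V => //; exact: opens_open. Qed.

Definition trace V := Opens (open_trace V).

Lemma trace_image (V : opens M) : image_val (trace V) `<=` V.
Proof. by move=> _ [y Vy <-]. Qed.

Lemma thickening_of_restriction : exists T' : thickening val Y,
  tdom T' = U /\ temb T' = temb T \o to_sub x0.
Proof.
have Tall y : tdom T y by rewrite T_dom.
have img y : U y -> forall V : opens M, V y -> trace V (to_sub x0 y).
  by move=> Uy V Vy; rewrite /opens_pred /= to_subK.
unshelve refine (let T' := @Thickening R M A val d Y U (temb T \o to_sub x0)
  (fun V a y => @tgerm _ _ _ _ _ _ T (trace V) (res (@trace_image V) a) (to_sub x0 y))
  _ _ _ _ _ _ _ _ _ in _).
- move=> y Uy; apply: continuous_comp; first exact: to_sub_continuous.
  exact: temb_continuous.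
- by move=> V a b y Uy Vy; rewrite raddfD; apply: tgermD => //; exact: img.
- by move=> V a b y Uy Vy; rewrite rmorphM; apply: tgermM => //; exact: img.
- move=> V k y Uy Vy; rewrite res_scal.
  exact: (@tgerm_scal _ _ _ _ _ _ T (trace V) k _ (Tall _) (img _ Uy _ Vy)).
- move=> V W WV a y Uy Wy.
  have tWV : trace W `<=` trace V by move=> z; exact: WV.
  have -> : res (@trace_image W) (res WV a) =
      res (image_val_sub tWV) (res (@trace_image V) a).
    by rewrite !(res_comp _ _ (subset_trans (@trace_image W) WV)).
  by apply: (@tgerm_res _ _ _ _ _ _ T (trace V) (trace W) tWV) => //; exact: img.
- move=> V a y Uy Vy.
  have [N [t ta]] := @tgerm_local _ _ _ _ _ _ T (trace V) (res (@trace_image V) a) _ (Tall _)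
    (img _ Uy _ Vy).
  have c : to_sub x0 @ y --> to_sub x0 y by exact: to_sub_continuous.
  by exists N, t; exact: (c _ ta).
- move=> y Uy N Ny t.
  have [V [Vy [a ha]]] := tgerm_lift (Tall (to_sub x0 y)) Ny t.
  exists (image_val V); have Vy' : image_val V y by exists (to_sub x0 y); rewrite ?to_subK.
  exists Vy', a => y' [z Vz zy']; have Uy' : U y' by rewrite -zy'; exact: set_valP.
  split=> //; have [_ [Nz e]] := ha z Vz.
  have zE : to_sub x0 y' = z by rewrite -zy' set_valK.
  rewrite /= zE; exists Nz; rewrite -e.
  have tV : trace (image_val V) `<=` V by move=> w [v Vv /val_inj <-].
  rewrite -[RHS](@tgerm_res _ _ _ _ _ _ T V (trace (image_val V)) tV) //; last first.
    exact: (ex_intro2 _ _ z Vz erefl).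
  by rewrite (Prop_irrelevance (@trace_image (image_val V)) (image_val_sub tV)).
- move=> V a b y Uy Vy e.
  have [W [WV [Wy e']]] := tgerm_inj (Tall _) (img _ Uy _ Vy) e.
  have WV' : image_val W `<=` V by move=> _ [z Wz <-]; exact: (WV z Wz).
  exists (image_val W), WV'; split; first by exists (to_sub x0 y); rewrite ?to_subK.
  have := e'; rewrite /= !(res_comp _ _ WV'); exact.
- move=> V a y Uy Vy.
  rewrite (@tgerm_val _ _ _ _ _ _ T (trace V) _ _ (Tall _) (img _ Uy _ Vy)).
  rewrite to_subK // val_res //.
  by exists (to_sub x0 y); [exact: img|rewrite to_subK].
by exists T'.
Qed.

End ThickeningOfRestriction.

Lemma bijective_sheaf_iso (R : realType) (X : topologicalType) (F G : sheaf R X)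
  (f : sheaf_mor F G) : (forall U, bijective (f U)) -> sheaf_iso f.
Proof.
move=> bf; have ex U : exists g : G U -> F U, cancel (f U) g /\ cancel g (f U).
  by have [g ? ?] := bf U; exists g.
pose g U := sval (cid (ex U)); have gK U : cancel (f U) (g U) /\ cancel (g U) (f U) := svalP (cid (ex U)).
have gz U : zmod_morphism (g U) by exact: can2_zmod_morphism (gK U).1 (gK U).2.
have gm U : monoid_morphism (g U) by exact: can2_monoid_morphism (gK U).1 (gK U).2.
pose g' U : {rmorphism G U -> F U} := HB.pack (g U)
  (GRing.isZmodMorphism.Build _ _ (g U) (gz U)) (GRing.isMonoidMorphism.Build _ _ (g U) (gm U)).
have g_scal U a : g' U (scal (G U) a) = scal (F U) a.
  by apply: (can_inj (gK U).1); rewrite /= (gK U).2 mor_scal.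
have g_res (U V : opens X) (VU : V `<=` U) (s : G U) : g' V (res VU s) = res VU (g' U s).
  by apply: (can_inj (gK V).1); rewrite /= (gK V).2 mor_res (gK U).2.
by exists (SheafMor g_scal g_res); split=> U; [exact: (gK U).1|exact: (gK U).2].
Qed.

(** Conversely, a thickening over all of M comes from an isomorphism of sheaves: it is
injective and surjective locally, and sections of A can be glued. *)

Section IsoOfThickening.
Variables (R : realType) (M : topologicalType) (A : sheaf R M).
Local Notation C := (complex_field R).
Variable val : forall V : opens M, A V -> M -> C.
Variables (d : nat) (Y : atlas_space R d) (T : thickening val Y).
Hypothesis T_dom : tdom T = opensT M.
Local Notation i := (temb T).
Local Notation OY := (structure_sheaf Y).
Implicit Types V W : opens M.

Let Tall y : tdom T y. Proof. by rewrite T_dom. Qed.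

Fact tsec_on V (a : A V) y : V y -> from_section y (restrict0 V (tgerm T a)).
Proof.
move=> Vy; apply: (restrict0_on (P := from_section_condition i OY)) => //.
exact: tgerm_local.
Qed.

Definition tsec V (a : A V) : inverse_image i OY V :=
  @LcSection _ _ _ (from_section_condition i OY) V (restrict0 V (tgerm T a))
    (fun y Vy => tsec_on a Vy) (fun y nVy => restrict0_out _ nVy).

Lemma tsecE V (a : A V) y : V y -> tsec a y = tgerm T a y.
Proof. exact: restrict0_in. Qed.

Lemma tgermN V (a : A V) y : V y -> tgerm T (- a) y = - tgerm T a y.
Proof.
move=> Vy; apply/eqP; rewrite -addr_eq0 -tgermD // addNr.
by rewrite -(rmorph0 (scal (A V))) tgerm_scal // rmorph0.
Qed.

Fact tsec_zmod V : zmod_morphism (@tsec V).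
Proof.
move=> a b; apply: sec_ext => y Vy.
by rewrite secDE secNE !tsecE // tgermD // tgermN.
Qed.

Fact tsec_monoid V : monoid_morphism (@tsec V).
Proof.
split=> [|a b]; apply: sec_ext => y Vy; last by rewrite secME !tsecE // tgermM.
rewrite tsecE // -(rmorph1 (scal (A V))) tgerm_scal // rmorph1.
by rewrite sec1E.
Qed.

HB.instance Definition _ V := GRing.isZmodMorphism.Build _ _ (@tsec V) (@tsec_zmod V).
HB.instance Definition _ V := GRing.isMonoidMorphism.Build _ _ (@tsec V) (@tsec_monoid V).

Program Definition tmor : sheaf_mor A (inverse_image i OY) :=
  @SheafMor R M A (inverse_image i OY) (fun V => @tsec V) _ _.
Next Obligation.
move=> V a; apply: sec_ext => y Vy.
rewrite tsecE // tgerm_scal //; exact/esym/(@sec_scalE _ _ _ (from_section_condition i OY)).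
Qed.
Next Obligation.
move=> V W WV a; apply: sec_ext => y Wy; rewrite tsecE // tgerm_res //.
by rewrite [RHS](sec_resE (P := from_section_condition i OY)) // tsecE //; exact: WV.
Qed.

Lemma tsec_inj V : injective (@tsec V).
Proof.
move=> a b e.
have /choice[W hW] : forall y : {y | V y}, exists W : opens M, W (sval y) /\
    exists WV : W `<=` V, res WV a = res WV b.
  move=> [y Vy]; have : tgerm T a y = tgerm T b y by rewrite -!tsecE // e.
  by move=> /(tgerm_inj (Tall y) Vy)[W [WV [Wy e']]]; exists W; split=> //; exists WV.
have WV y : W y `<=` V by have [_ []] := hW y.
apply: (@sheaf_sep _ _ A _ _ _ WV) => [y Vy|y].
  by exists (exist _ y Vy) => //; have [] := hW (exist _ y Vy).
by have [_ [h]] := hW y; rewrite (Prop_irrelevance (WV y) h).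
Qed.

Lemma tsec_local V (s : inverse_image i OY V) y : V y -> exists (W : opens M) (a : A W),
  [/\ W `<=` V, W y & forall y', W y' -> tgerm T a y' = s y'].
Proof.
move=> Vy; have [N [t st]] := sec_on s Vy; have [Ny _] := nbhs_singleton st.
have [V' [Vy' [a ha]]] := tgerm_lift (Tall y) Ny t.
pose W := opensI (opensI V V') (Opens (open_interior
   [set y' | exists Ny' : N (i y'), s y' = germ Ny' t])).
have WV' : W `<=` V' by move=> ? [[]].
exists W, (res WV' a); split; first by move=> ? [[]].
  by split; first by split.
move=> y' Wy'; rewrite tgerm_res //; have [_ /interior_subset[Ny1 ->]] := Wy'.
by have [_ [Ny2 ->]] := ha y' (WV' _ Wy'); exact: germ_irr.
Qed.

Lemma tsec_surj V (s : inverse_image i OY V) : exists a, tsec a = s.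
Proof.
have /choice[p hp] : forall y : {y | V y}, exists p : {W : opens M & A W},
    [/\ projT1 p `<=` V, projT1 p (sval y) & forall y', projT1 p y' -> tgerm T (projT2 p) y' = s y'].
  by move=> [y Vy]; have [W [a h]] := tsec_local s Vy; exists (existT _ W a).
have WV y : projT1 (p y) `<=` V by have [] := hp y.
have [|y z W Wy Wz|a ha] := @sheaf_glue _ _ A _ _ _ WV _ (fun y => projT2 (p y)).
- by move=> y Vy; exists (exist _ y Vy) => //; have [] := hp (exist _ y Vy).
- apply: tsec_inj; apply: sec_ext => w Ww; rewrite !tsecE // !tgerm_res //.
  have [_ _ ey] := hp y; have [_ _ ez] := hp z.
  by rewrite ey ?ez //; [exact: Wz|exact: Wy].
exists a; apply: sec_ext => y Vy; rewrite tsecE //.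
have [_ Wy <-] := hp (exist _ y Vy); last exact: Wy.
by rewrite -ha tgerm_res.
Qed.

Lemma iso_of_thickening : exists alpha : sheaf_mor A (inverse_image i OY),
  sheaf_iso alpha /\ forall V (a : A V) y, V y -> alpha V a y = tgerm T a y.
Proof.
exists tmor; split; last by move=> V a y Vy; exact: tsecE.
apply: bijective_sheaf_iso => V.
have /choice[h hK] := @tsec_surj V.
by exists h => // a; apply: tsec_inj; rewrite hK.
Qed.

End IsoOfThickening.

(** * Locally finite covers *)

Lemma near_pull (X Y : topologicalType) (f : X -> Y) (x : X) (y : Y) (P : set Y) :
  f @ x --> y -> nbhs y P -> nbhs x (fun z => P (f z)).
Proof. exact. Qed.

Section LocallyFinite.
Variable X : topologicalType.
Implicit Types (x y : X) (U V W N : set X) (B : set (set X)).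

Lemma finite_near (T I : Type) (F : set_system T) (D : set I) (P : I -> set T) :
  Filter F -> finite_set D -> (forall i, D i -> F (P i)) ->
  F [set x | forall i, D i -> P i x].
Proof.
move=> FF Dfin h; have [S DS] := (@finite_fsetP {classic I} D).1 Dfin.
apply: filterS (@filter_bigI T {classic I} S P F FF _) => [x hx i Di|i iS].
  by apply: hx; rewrite -DS.
by apply: h; rewrite DS.
Qed.

Lemma near_all (x : X) (P : set X) : (forall y, P y) -> nbhs x P.
Proof. by move=> h; exact: nearW. Qed.

Lemma closurePn N x : ~ closure N x <-> \forall y \near x, ~ N y.
Proof.
split=> [|h clO]; last by have [y [Oy]] := clO _ h.
move=> /existsNP[W /not_implyP[Wx /set0P/negP]]; rewrite negbK => /eqP OW.
by apply: filterS Wx => y Wy Oy; have : (N `&` W) y by []; rewrite OW.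
Qed.

Definition locally_finite (I : Type) (V : I -> set X) : Prop :=
  forall x, exists2 W, nbhs x W & finite_set [set i | V i `&` W !=set0].

(** Only the finitely many members that meet a neighbourhood of x matter. The filter F
allows for points p of another space that are mapped close to x. *)
Lemma locally_finite_near (I T : Type) (F : set_system T) (V : I -> set X) (r : T -> X) x
    (P : I -> set T) : Filter F -> r @ F --> x -> locally_finite V ->
  (forall i, F [set p | V i (r p) -> P i p]) ->
  F [set p | forall i, V i (r p) -> P i p].
Proof.
move=> FF rx lf h; have [W Wx fin] := lf x.
have fn := finite_near FF fin (fun i _ => h i); have rW : F [set p | W (r p)] := rx _ Wx.
by apply: filterS2 fn rW => p hp Wp i Vi; apply: hp => //; exists (r p).
Qed.

Lemma locally_finite_closure (I : Type) (V : I -> set X) x : locally_finite V ->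
  closure (\bigcup_i V i) x -> exists i, closure (V i) x.
Proof.
move=> lf clx; apply: contrapT => no.
suff : \forall y \near x, ~ (\bigcup_i V i) y by move/closurePn.
have h i : \forall y \near x, V i y -> False.
  have : ~ closure (V i) x by move=> h; apply: no; exists i.
  by move/closurePn.
have H := @locally_finite_near I X (nbhs x) V id x (fun _ _ => False) (nbhs_filter x) cvg_id lf h.
by apply: filterS H => y hy [i _ Vi]; exact: hy Vi.
Qed.

Lemma paracompactP (P : set X -> Prop) : paracompact X ->
  (forall x, exists2 N, open N & N x /\ P N) -> (forall N N', N `<=` N' -> P N' -> P N) ->
  exists B, [/\ forall V, B V -> open V /\ P V, \bigcup_(V in B) V = setT &
    locally_finite (fun V : {V | B V} => sval V)].
Proof.
move=> pX cov Pmono; have [| |B [Bo Bc Br Bf]] := pX [set N | open N /\ P N].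
- by move=> U [].
- by apply/seteqP; split=> // x _; have [N oO [Ox PO]] := cov x; exists N.
exists B; split=> // [V BV|x].
  by split; [exact: Bo|have [U [_ PU] VU] := Br V BV; exact: Pmono PU].
have [W Wx fin] := Bf x; exists W => //.
apply: sub_finite_set (finite_preimage (f := fun V : {V | B V} => sval V) _ fin).
  by move=> [V BV] /= h.
by move=> [V BV] [V' BV'] _ _ /= e; case: _ / e BV' => BV'; congr exist; exact: Prop_irrelevance.
Qed.

Hypothesis pX : paracompact X.
Hypothesis hX : hausdorff_space X.

Lemma hausdorff_near x y : x <> y -> exists N, [/\ open N, N y & \forall z \near x, ~ N z].
Proof.
move=> xy; apply: contrapT => no; apply: xy; apply: hX => P Q Px.
rewrite nbhsE => -[N [oO Oy] OQ].
have : ~ \forall z \near x, ~ N z by move=> h; apply: no; exists N.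
move=> h; apply: contrapT => PQ; apply: h; apply: filterS Px => z Pz Oz.
by apply: PQ; exists z; split=> //; exact: OQ.
Qed.

(** In a locally finite cover by sets that are contained in U or stay away from x, the
union of the latter stays away from x. *)
Lemma paracompact_regular x U : nbhs x U -> exists2 V, open V & V x /\ closure V `<=` U.
Proof.
move=> Ux; pose away N := \forall z \near x, ~ N z.
have [| |B [BP Bc Bf]] := paracompactP (P := fun N => N `<=` U \/ away N) pX.
- move=> y; have [<-|xy] := pselect (x = y).
    exists (U^°); first exact: open_interior.
    by rewrite -?nbhs_interior; split=> //; left; exact: interior_subset.
  by have [N [oO Oy aO]] := hausdorff_near xy; exists N => //; split=> //; right.
- move=> N N' ON' [h|h]; [left; exact: subset_trans h|right].
  have {}h : \forall z \near x, ~ N' z := h.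
  by rewrite /away; near=> z => /ON'; near: z.
pose S := [set z | exists V : {V | B V}, away (sval V) /\ sval V z].
have oS : open S.
  rewrite openE => z [[V BV] [/= aV Vz]]; rewrite /interior.
  apply: filterS (open_nbhs_nbhs (conj (BP _ BV).1 Vz)) => w Vw.
  by exists (exist _ V BV).
have nS : \forall z \near x, ~ S z.
  have h (V : {V | B V}) : \forall z \near x, sval V z -> ~ away (sval V).
    have [aV|naV] := pselect (away (sval V)); last exact: nearW.
    by have {}aV : \forall z \near x, ~ sval V z := aV; apply: filterS aV => z nz /nz.
  have H := @locally_finite_near _ X (nbhs x) _ id x (fun i _ => ~ away (sval i)) (nbhs_filter x) cvg_id Bf h.
  by apply: filterS H => z hz [V [aV Vz]]; exact: hz Vz aV.
exists ((~` S)^°); first exact: open_interior.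
split=> // y cly; have : (\bigcup_(V in B) V) y by rewrite Bc.
move=> [V BV Vy]; have [_ [VU|aV]] := BP V BV; first exact: VU.
have Sy : S y by exists (exist _ V BV).
have [z [/interior_subset nSz Sz]] := cly S (open_nbhs_nbhs (conj oS Sy)).
by [].
Unshelve. all: by end_near. Qed.

(** A second refinement yields the shrinking W: its members are grouped according to a
member of V that contains their closure, and closure commutes with locally finite
unions. *)
Lemma nested_covers (U : X -> set X) : (forall x, nbhs x (U x)) ->
  exists (I : Type) (c : I -> X) (V W : I -> opens X),
    [/\ forall i, closure (V i) `<=` U (c i), forall i, closure (W i) `<=` V i,
        forall x, exists i, W i x & locally_finite V].
Proof.
move=> hU; have [| |B1 [B1P B1c B1f]] := paracompactP
   (P := fun N => exists x, closure N `<=` U x) pX.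
- move=> x; have [V oV [Vx clV]] := paracompact_regular (hU x).
  by exists V => //; split=> //; exists x.
- by move=> N N' /closureS ON' [x h]; exists x; exact: subset_trans h.
pose I := {V | B1 V}.
have oI (i : I) : open (sval i) by case: i => V BV; have [] := B1P V BV.
have [| |B2 [B2P B2c B2f]] := paracompactP
   (P := fun N => exists i : I, closure N `<=` sval i) pX.
- move=> x; have : (\bigcup_(V in B1) V) x by rewrite B1c.
  move=> [V BV Vx]; have := paracompact_regular (open_nbhs_nbhs (conj (B1P _ BV).1 Vx)).
  by move=> [N oO [Ox h]]; exists N => //; split=> //; exists (exist _ V BV).
- by move=> N N' /closureS ON' [x h]; exists x; exact: subset_trans h.
have /choice[k hk] : forall N : {N | B2 N}, exists i : I, closure (sval N) `<=` sval i.
  by move=> [N BN]; have [] := B2P N BN.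
have /choice[c hc] : forall i : I, exists x, closure (sval i) `<=` U x.
  by move=> [V BV]; have [] := B1P V BV.
pose W (i : I) := [set z | exists N : {N | B2 N}, k N = i /\ sval N z].
have oW i : open (W i).
  rewrite openE => z [[N BO] [kO Oz]]; rewrite /interior.
  apply: filterS (open_nbhs_nbhs (conj (B2P _ BO).1 Oz)) => w Ow.
  by exists (exist _ N BO).
exists I, c, (fun i => Opens (oI i)), (fun i => Opens (oW i)); split=> //.
- move=> i x clx; pose f (N : {N | k N = i}) := sval (sval N).
  have ff : locally_finite f.
    move=> y; have [N Ny fin] := B2f y; exists N => //.
    apply: sub_finite_set (finite_preimage (f := fun N : {N | k N = i} => sval N) _ fin).
      by move=> o.
    by move=> [V BV] [V' BV'] _ _ /= e; case: _ / e BV' => BV'; congr exist; exact: Prop_irrelevance.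
  have [|[N kO] h] := locally_finite_closure ff (x := x).
    by apply: closureS clx => z [N [kO Oz]]; exists (exist _ N kO).
  by move: (hk N _ h); rewrite kO.
- move=> x; have : (\bigcup_(V in B2) V) x by rewrite B2c.
  by move=> [N BO Ox]; exists (k (exist _ N BO)), (exist _ N BO).
Qed.

End LocallyFinite.

Section GluingGerms.
Variables (X Y : topologicalType) (T : Type).
Hypothesis pX : paracompact X.
Hypothesis hX : hausdorff_space X.
Variables (Z : set X) (s : X -> Y) (r : Y -> X) (g : X -> Y -> T).
Hypothesis Zclosed : closed Z.
Hypothesis r_cont : forall x, Z x -> r @ s x --> x.
Hypothesis g_near : forall x, Z x ->
  \forall x' \near x, Z x' -> \forall p \near s x', g x' p = g x p.

(** Sections over a closed subset Z of a paracompact space extend to a neighbourhood;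
here they are germs of maps, and Z is placed in Y by a section s of r. On a member V of a locally
finite cover one uses a single g (k V) that is correct on the closure of V, so that
near a point of Z all the available choices agree. *)
Lemma glue_germs : (Y -> T) -> exists h : Y -> T, forall x, Z x ->
  \forall p \near s x, h p = g x p.
Proof.
move=> h0.
pose G x := [set x' | Z x' -> \forall p \near s x', g x' p = g x p].
pose fine (N : set X) := (exists x, Z x /\ closure N `<=` G x) \/ N `&` Z = set0.
have [| |B [BP Bc Bf]] := paracompactP (P := fine) pX.
- move=> x; have [Zx|nZx] := pselect (Z x).
    have [V oV [Vx h]] := paracompact_regular pX hX (g_near Zx).
    by exists V => //; split=> //; left; exists x.
  exists (~` Z); first exact: closed_openC.
  by split=> //; right; rewrite setICl.
- move=> N N' ON' [[x [Zx h]]|h].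
    by left; exists x; split=> //; exact: subset_trans (closureS ON') h.
  by right; apply/seteqP; split=> // z [/ON' Oz Zz]; rewrite -h.
pose I := {V | B V /\ exists x, Z x /\ closure V `<=` G x}.
have /choice[k hk] : forall V : I, exists x, Z x /\ closure (sval V) `<=` G x.
  by move=> [V []].
have If : locally_finite (fun V : I => sval V).
  move=> x; have [W Wx fin] := Bf x; exists W => //.
  pose f (V : I) : {V | B V} := exist _ (sval V) (svalP V).1.
  apply: sub_finite_set (finite_preimage (f := f) _ fin); first by move=> [V BV].
  move=> [V BV] [V' BV'] _ _ [] /= e; case: _ / e BV' => BV'; congr exist.
  exact: Prop_irrelevance.
exists (fun p => if pselect (exists V : I, sval V (r p)) is left h
  then g (k (sval (cid h))) p else h0 p) => x Zx.
have agree : \forall p \near s x, forall V : I, sval V (r p) -> g (k V) p = g x p.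
  apply: (@locally_finite_near X I Y (nbhs (s x)) _ r x) => //; first exact: r_cont.
  move=> V; have [clx|nclx] := pselect (closure (sval V) x).
    have [_ hG] := hk V; by apply: filterS (hG x clx Zx) => p e _; exact: esym e.
  have nV : \forall p \near s x, ~ sval V (r p) := r_cont Zx ((closurePn _ _).1 nclx).
  by apply: filterS nV => p nVp /nVp.
have : (\bigcup_(V in B) V) x by rewrite Bc.
move=> [V BV Vx]; have [oV [hV|hV]] := BP V BV; last first.
  by have : (V `&` Z) x by []; rewrite hV.
have rV : \forall p \near s x, V (r p) := r_cont Zx (open_nbhs_nbhs (conj oV Vx)).
apply: filterS2 agree rV => p hp Vp; case: pselect => [ex|[]].
  exact: hp (svalP (cid ex)).
by exists (exist _ V (conj BV hV)).
Qed.

End GluingGerms.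

Section CountableBases.
Variables (X : topologicalType) (I : Type) (D : I -> set X) (base : I -> nat -> set X).
Implicit Types (x y z : X) (i k l : I) (U V W : set X).

Definition regular := forall x U, nbhs x U -> exists2 V, open V & V x /\ closure V `<=` U.

Lemma regular_hausdorff : regular -> (forall x y, x <> y -> nbhs x (~` [set y])) ->
  hausdorff_space X.
Proof.
move=> reg T1 x y xy; apply: contrapT => /T1 /reg[V oV [Vx clV]].
have /closurePn nV : ~ closure V y by move=> /clV /=.
by have [z [Vz /(_ Vz)]] := xy V _ (open_nbhs_nbhs (conj oV Vx)) nV.
Qed.

Hypothesis reg : regular.
Hypothesis D_open : forall i, open (D i).
Hypothesis D_cover : forall x, exists i, D i x.
Hypothesis D_fin : locally_finite D.
Hypothesis base_open : forall i n, open (base i n).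
Hypothesis base_small : forall i x U, D i x -> nbhs x U ->
  exists n, base i n x /\ base i n `<=` U.

Let meets i k := exists2 x, D i x & D k x.

Let countable_meets i : countable [set k | meets i k].
Proof.
pose good := [set n | finite_set [set k | D k `&` base i n !=set0]].
apply: (@sub_countable _ _ _ (\bigcup_(n in good) [set k | D k `&` base i n !=set0])).
  apply: subset_card_le => k [x Dix Dkx]; have [W Wx fin] := D_fin x.
  have [n [nx nW]] := base_small Dix Wx; exists n; last by exists x.
  by apply: sub_finite_set fin => l [z [Dlz nz]]; exists z; split=> //; exact: nW.
apply: bigcup_countable => // n; exact: finite_set_countable.
Qed.

(** The class of i for the equivalence relation generated by [meets]. *)
Let conn i : set I := [set k | forall P : set I, P i ->
  (forall l k, P l -> meets l k -> P k) -> P k].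

Let conn_refl i : conn i i. Proof. by move=> P. Qed.

Let conn_step i l k : conn i l -> meets l k -> conn i k.
Proof. by move=> il lk P Pi Ps; exact: (Ps l k (il P Pi Ps) lk). Qed.

Let conn_trans i k l : conn i k -> conn k l -> conn i l.
Proof. by move=> ik kl; apply: kl => // l1 l2; exact: conn_step. Qed.

Let conn_sym i k : conn i k -> conn k i.
Proof.
move=> ik; apply: (ik (fun l => conn l i)) => // l1 l2 h [x x1 x2].
by apply: conn_trans h; apply: (conn_step (@conn_refl l2)); exists x.
Qed.

Let conn_eq i k : conn i k -> conn i = conn k.
Proof.
move=> ik; apply/seteqP; split=> l; apply: conn_trans => //; exact: conn_sym.
Qed.

Let countable_conn i : countable (conn i).
Proof.
pose S := fix S n : set I := if n is n'.+1 then \bigcup_(l in S n') [set k | meets l k]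
  else [set i].
apply: (@sub_countable _ _ _ (\bigcup_n S n)).
  apply: subset_card_le => k; apply; first by exists 0%N.
  by move=> l k' [n _ Sl] lk; exists n.+1 => //; exists l.
apply: bigcup_countable => // n _; elim: n => [|n IH]; first exact: countable1.
exact: bigcup_countable.
Qed.

(** A regular space with a locally finite cover by open sets with countable bases
is a disjoint union of open subsets with countable bases. On each of these, a cover
by sets U d that contain the closures of basic sets b d, enumerated by natural
numbers, is made locally finite by removing from U d the closures of the earlier
sets b d'. *)
Lemma paracompact_of_bases : paracompact X.
Proof.
move=> A Aopen Acov; pose b (d : I * nat) := base d.1 d.2.
pose small d := exists U, A U /\ closure (b d) `<=` U.
have /choice[U hU] : forall d, exists U, small d -> A U /\ closure (b d) `<=` U.
  move=> d; have [[U hU]|] := pselect (small d); first by exists U.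
  by exists set0.
pose E (K : set I) : set (I * nat) := [set d | K d.1 /\ small d].
have Ecount i : countable (E (conn i)).
  apply: (@sub_countable _ _ _ (conn i `*` setT)); last exact: countableX.
  by apply: subset_card_le => -[k n] [].
have /choice[f hf] : forall K : set I, exists f : I * nat -> nat,
    countable (E K) -> {in E K &, injective f}.
  move=> K; have [/countable_injP[f fi]|nK] := pselect (countable (E K)).
    by exists f.
  by exists (fun=> 0%N).
pose Y (K : set I) := \bigcup_(k in K) D k.
pose R (K : set I) d := [set y | [/\ U d y, Y K y &
  forall d', E K d' -> (f K d' < f K d)%N -> ~ closure (b d') y]].
have Efin i n : finite_set [set d | E (conn i) d /\ (f (conn i) d < n)%N].
  have inj : {in [set d | E (conn i) d /\ (f (conn i) d < n)%N] &, injective (f (conn i))}.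
    move=> d d' /set_mem[Ed _] /set_mem[Ed' _]; apply: (hf _ (Ecount i)); exact/mem_set.
  rewrite -(eq_finite_set (inj_card_eq inj)); apply: sub_finite_set (finite_II n).
  by move=> _ [d [_ dn] <-].
have Rin i y : D i y -> exists d, [/\ E (conn i) d, b d y & U d y].
  move=> Diy; have [V AV Vy] : (\bigcup_(V in A) V) y by rewrite Acov.
  have [W oW [Wy clW]] := reg (open_nbhs_nbhs (conj (Aopen V AV) Vy)).
  have [n [ny nW]] := base_small Diy (open_nbhs_nbhs (conj oW Wy)).
  have sm : small (i, n) by exists V; split=> //; apply: subset_trans clW; exact: closureS.
  exists (i, n); split; [split=> //; exact: conn_refl|by []|].
  by apply: (hU _ sm).2; exact: subset_closure.
have Yopen K : open (Y K) by apply: bigcup_open => k _; exact: D_open.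
exists [set V | exists i d, E (conn i) d /\ V = R (conn i) d]; split.
- move=> _ [i [d [Ed ->]]]; rewrite openE => y [Uy Yy hy]; rewrite /interior.
  have h1 : \forall z \near y, U d z.
    by apply: (open_nbhs_nbhs (conj (Aopen _ (hU _ Ed.2).1) Uy)).
  have h2 : \forall z \near y, Y (conn i) z by apply: open_nbhs_nbhs.
  have h3 : \forall z \near y, forall d', E (conn i) d' /\ (f (conn i) d' < f (conn i) d)%N ->
      ~ closure (b d') z.
    apply: (finite_near (nbhs_filter y) (Efin i _)) => d' [Ed' lt].
    apply: open_nbhs_nbhs; split; last exact: hy.
    by apply: closed_openC; exact: closed_closure.
  by apply: filterS3 h1 h2 h3 => z ? ? hz; split=> // d' Ed' lt; exact: hz.
- apply/seteqP; split=> // y _; have [i Diy] := D_cover y.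
  pose P n := `[< exists d, [/\ E (conn i) d, U d y & f (conn i) d = n] >].
  have exP : exists n, P n.
    by have [d [Ed _ Ud]] := Rin i y Diy; exists (f (conn i) d); apply/asboolP; exists d.
  case: (ex_minnP exP) => n /asboolP[d [Ed Ud dn]] nmin.
  exists (R (conn i) d); first by exists i, d.
  split=> //; first by exists i => //; exact: conn_refl.
  move=> d' Ed'; rewrite dn ltnNge => /negP lt cl; apply: lt; apply: nmin.
  by apply/asboolP; exists d'; split=> //; exact: (hU _ Ed'.2).2.
- move=> _ [i [d [Ed ->]]]; exists (U d); first exact: (hU _ Ed.2).1.
  by move=> y [].
- move=> y; have [i Diy] := D_cover y; have [d [Ed bd _]] := Rin i y Diy.
  exists (D i `&` b d).
    by apply: filterI; apply: open_nbhs_nbhs; split=> //; exact: base_open.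
  apply: sub_finite_set (finite_image (R (conn i)) (Efin i (f (conn i) d).+1)).
  move=> _ [[i' [d' [Ed' ->]]] [z [[Uz [k ik Dkz] hz] [Diz bz]]]].
  have e : conn i' = conn i by apply: conn_eq; apply: conn_step ik _; exists z.
  rewrite e in Ed' hz *; exists d' => //; split=> //.
  rewrite ltnS leqNgt; apply/negP => lt; apply: (hz d Ed lt).
  exact: subset_closure.
Qed.

End CountableBases.

Section BaseOfRow.
Variables (R : realType) (d : nat).
Local Notation C := (complex_field R).
Local Notation V := 'rV[C]_d.

Lemma countable_base : exists b : nat -> set V, (forall n, open (b n)) /\
  forall x U, nbhs x U -> exists n, b n x /\ b n `<=` U.
Proof.
pose T := ({ffun 'I_d -> rat * rat} * nat)%type.
pose pt (t : T) : V := \row_i cpx (ratr (t.1 i).1) (ratr (t.1 i).2).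
pose bt (t : T) := [set v : V | nrm (v - pt t) < (t.2.+1%:R)^-1].
exists (fun n => if unpickle n is Some t then bt t else set0); split.
  move=> n; case: (unpickle n) => [t|]; last exact: open0.
  rewrite openE => v vt; rewrite /interior; apply/(@near_nrm R V v); exists ((t.2.+1%:R)^-1 - nrm (v - pt t)).
    by rewrite subr_gt0.
  by move=> w wv; apply: (le_lt_trans (nrm_tri w v (pt t))); rewrite -ltrBrDr.
move=> x U /near_nrm[r r0 h].
pose N := Num.truncn (2 / r); pose e : R := (N.+1%:R)^-1.
have e0 : 0 < e by rewrite invr_gt0.
have er : 2 * e <= r.
  rewrite /e ler_pdivrMr // mulrC -ler_pdivrMr //; exact/ltW/truncnS_gt.
have app (a : R) : exists q : rat, `|a - ratr q| < e / 3.
  have /rat_in_itvoo[q] : a - e / 3 < a + e / 3 by lra.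
  by rewrite in_itv /= => /andP[q1 q2]; exists q; rewrite ltr_norml; lra.
have /choice[q hq] : forall i : 'I_d, exists q : rat * rat,
    nrm (x 0 i - cpx (ratr q.1) (ratr q.2)) <= 2 / 3 * e.
  move=> i; have [q1 h1] := app (reC (x 0 i)); have [q2 h2] := app (imC (x 0 i)).
  exists (q1, q2); apply: (le_trans (nrm_le_ReIm _)).
  by move: h1 h2; rewrite /reC /imC /=; case: (x 0 i) => /= u v; lra.
pose t : T := ([ffun i => q i], N).
have xt : nrm (x - pt t) < e.
  apply: (@le_lt_trans _ _ (2 / 3 * e)); last lra.
  by apply: nrm_row_le => [|i]; [lra|rewrite !mxE ffunE].
exists (pickle t); rewrite pickleK; split=> // v vt; apply: h.
have vt' : nrm (v - pt t) < e := vt.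
by have := nrm_tri v (pt t) x; rewrite (nrmB (pt t)); lra.
Qed.

End BaseOfRow.

(** * Gluing local models *)

Lemma diff_injective (K : numFieldType) (U V : normedModType K) (F : U -> V) (G : V -> U) a :
  differentiable F a -> differentiable G (F a) -> (\forall x \near a, G (F x) = x) ->
  injective ('d F a).
Proof.
move=> dF dG GF v w e.
suff cancel_d u : 'd G (F a) ('d F a u) = u by rewrite -(cancel_d v) e cancel_d.
rewrite -[LHS](congr1 (fun f => f u) (diff_comp dF dG)).
rewrite -deriveE; last exact: differentiable_comp.
rewrite (near_eq_derive (g := id)); last exact: GF.
by rewrite derive_id.
Qed.

Section GluedSpace.
Variables (R : realType) (m n : nat) (M : atlas_space R m) (A : sheaf R M).
Local Notation C := (complex_field R).
Local Notation E := 'rV[C]_(m + n).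
Variable val : forall V : opens M, A V -> M -> C.
Variables (I : Type) (V W : I -> opens M) (L : I -> local_model val (m + n)).
Variable ch : I -> chart R M m.
Implicit Types (i j k l : I) (y : M) (p q : E).

Local Notation s i := (memb (L i)).
Definition proj i p : M := cinv (ch i) (lsubmx p).
Local Notation pr := proj.

Hypothesis V_dom : forall i y, closure (V i) y -> mdom (L i) y.
Hypothesis W_sub : forall i, closure (W i) `<=` V i.
Hypothesis W_cover : forall y, exists i, W i y.
Hypothesis V_fin : locally_finite V.
Hypothesis ch_atlas : forall i, atlas (ch i).
Hypothesis ch_dom : forall i y, mdom (L i) y -> cdom (ch i) y.
Hypothesis L_emb : forall i y, mdom (L i) y -> s i y = inlmx n (cmap (ch i) y).

Variable g : I -> I -> E -> E.
Hypothesis g_ind : forall i j y, closure (V i) y -> closure (V j) y ->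
  induces (L i) (L j) y (g i j).

Lemma proj_emb i y : mdom (L i) y -> pr i (s i y) = y.
Proof. by move=> h; rewrite L_emb // /proj row_mxKl cmapK //; exact: ch_dom. Qed.

Lemma proj_continuous i y : mdom (L i) y ->
  \forall p \near s i y, {for p, continuous (pr i)}.
Proof.
move=> h; have cy := ch_dom h.
have c : lsubmx @ s i y --> cmap (ch i) y.
  have -> : cmap (ch i) y = lsubmx (s i y) by rewrite L_emb // row_mxKl.
  exact: lsubmx_continuous.
have : \forall p \near s i y, cdom (ch i) (cinv (ch i) (lsubmx p)) /\
    cmap (ch i) (cinv (ch i) (lsubmx p)) = lsubmx p := c _ (chart_near cy).
apply: filterS => p [cp pE]; apply: continuous_comp; first exact: lsubmx_continuous.
by rewrite -pE; exact: cinv_continuous.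
Qed.

Lemma W_V i y : W i y -> closure (V i) y.
Proof. by move=> Wy; apply/subset_closure/W_sub/subset_closure. Qed.

Lemma clW_V i y : closure (W i) y -> closure (V i) y.
Proof. by move=> /W_sub Vy; exact: subset_closure. Qed.

Lemma g_base i j y : closure (V i) y -> closure (V j) y -> g i j (s j y) = s i y.
Proof. by move=> iy jy; exact: induces_base (V_dom iy) (V_dom jy) (g_ind iy jy). Qed.

Lemma g_cvg i j y : closure (V i) y -> closure (V j) y -> g i j @ s j y --> s i y.
Proof.
move=> iy jy; rewrite -(g_base iy jy); apply: differentiable_continuous.
exact: nbhs_singleton (induces_differentiable (V_dom iy) (V_dom jy) (g_ind iy jy)).
Qed.

Lemma proj_cvg j y : closure (V j) y -> pr j @ s j y --> y.
Proof.
move=> jy; rewrite -{2}(proj_emb (V_dom jy)).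
exact: nbhs_singleton (proj_continuous (V_dom jy)).
Qed.

(** The indices of the pieces that contain the point with coordinates p in the j-th
model: the i-th piece consists of what lies over the closure of W i, and the transition
map to the i-th model is meaningful over V i. That the pieces are closed makes the
glued space a Hausdorff space. *)
Definition pieces j p : set I := [set i | V i (pr j p) /\ closure (W i) (pr i (g i j p))].
Local Notation J := pieces.

Definition pieces_at y : set I := [set i | closure (W i) y].

Lemma pieces_at_finite y : finite_set (pieces_at y).
Proof.
have [N Ny fin] := V_fin y; apply: sub_finite_set fin => i /W_sub Vy.
by exists y; split=> //; exact: nbhs_singleton.
Qed.

Lemma pieces_near j y : closure (V j) y -> \forall p \near s j y, J j p `<=` pieces_at y.
Proof.
move=> jy.
have h i : \forall p \near s j y, V i (pr j p) ->
    closure (W i) (pr i (g i j p)) -> pieces_at y i.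
  have [iy|niy] := pselect (closure (W i) y); first by apply: near_all => p _ _; exact: iy.
  have [Viy|nViy] := pselect (closure (V i) y).
    have nW : \forall z \near y, ~ closure (W i) z.
      by apply: open_nbhs_nbhs; split=> //; apply: closed_openC; exact: closed_closure.
    have : \forall p \near s j y, ~ closure (W i) (pr i (g i j p)).
      exact: (g_cvg Viy jy (proj_cvg Viy nW)).
    by apply: filterS => p np _ /np.
  have : \forall p \near s j y, ~ V i (pr j p) := proj_cvg jy ((closurePn _ _).1 nViy).
  by apply: filterS => p np /np.
have H := locally_finite_near (nbhs_filter (s j y)) (proj_cvg jy) V_fin h.
by apply: filterS H => p hp i [Vi Wi]; exact: hp.
Qed.

(** What makes the relation between the models an equivalence relation with closed
graph at the point p of the j-th model. *)
Definition compatible j p := [/\ {for p, continuous (pr j)}, g j j p = p,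
  finite_set (J j p), \forall p' \near p, J j p' `<=` J j p &
  forall i, J j p i -> [/\ J i (g i j p) = J j p, differentiable (g i j) p &
    forall l, J j p l -> g l i (g i j p) = g l j p]].

(** Near the image of M the transition maps compose as they should, by the uniqueness of
germs of transition maps. Only the finitely many pieces at y are involved. *)
Lemma compatible_near j y : W j y -> \forall p \near s j y, compatible j p /\ W j (pr j p).
Proof.
move=> Wjy; have jy := W_V Wjy; have hj := V_dom jy.
have fin := pieces_at_finite y.
have n1 := proj_continuous hj.
have n2 : \forall p \near s j y, g j j p = p.
  by apply: filterS (induces_unique hj hj (g_ind jy jy) (@induces_id _ _ _ _ _ (L j) y)) => p ->.
have n3 := pieces_near jy; have n3' := near_join n3.
have n4 : \forall p \near s j y, W j (pr j p) := proj_cvg jy (near_opens Wjy).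
have n5 : \forall p \near s j y, forall i, pieces_at y i -> [/\ V i (pr j p),
    differentiable (g i j) p, {for g i j p, continuous (pr i)} & J i (g i j p) `<=` pieces_at y].
  apply: (finite_near (nbhs_filter _) fin) => i Wi.
  have iy := clW_V Wi; have hi := V_dom iy; have c := g_cvg iy jy.
  have a1 : \forall p \near s j y, V i (pr j p) := proj_cvg jy (near_opens (W_sub Wi)).
  have a2 := induces_differentiable hi hj (g_ind iy jy).
  have a3 : \forall p \near s j y, {for g i j p, continuous (pr i)} := c _ (proj_continuous hi).
  have a4 : \forall p \near s j y, J i (g i j p) `<=` pieces_at y := c _ (pieces_near iy).
  by near=> p; split; near: p.
have n6 : \forall p \near s j y, forall i, pieces_at y i -> forall l, pieces_at y l ->
    V l (pr i (g i j p)) /\ g l i (g i j p) = g l j p.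
  apply: (finite_near (nbhs_filter _) fin) => i Wi.
  apply: (finite_near (nbhs_filter _) fin) => l Wl.
  have iy := clW_V Wi; have hi := V_dom iy; have c := g_cvg iy jy.
  have ly := clW_V Wl; have hl := V_dom ly.
  have a1 : \forall p \near s j y, V l (pr i (g i j p)).
    exact: (c _ (proj_cvg iy (near_opens (W_sub Wl)))).
  have a2 := induces_unique hl hj (induces_comp (g_ind ly iy) (g_ind iy jy)) (g_ind ly jy).
  by near=> p; split; near: p.
near=> p; have b3 : J j p `<=` pieces_at y by near: p.
have b3' : \forall p' \near p, J j p' `<=` pieces_at y by near: p.
have b5 : forall i, pieces_at y i -> [/\ V i (pr j p),
    differentiable (g i j) p, {for g i j p, continuous (pr i)} & J i (g i j p) `<=` pieces_at y].
  by near: p.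
have b6 : forall i, pieces_at y i -> forall l, pieces_at y l ->
    V l (pr i (g i j p)) /\ g l i (g i j p) = g l j p by near: p.
split; last by near: p.
split; [by near: p | by near: p | exact: sub_finite_set fin | | ].
  have u : \forall p' \near p, forall l, pieces_at y l -> J j p' l -> J j p l.
    apply: (finite_near (nbhs_filter _) fin) => l ly.
    have [Vl dl cl _] := b5 l ly.
    have [Wl|nWl] := pselect (closure (W l) (pr l (g l j p))).
      by apply: near_all => p' _; split.
    have cc : (pr l \o g l j) @ p --> pr l (g l j p).
      exact: (continuous_comp (differentiable_continuous dl) cl).
    have oW : open (~` closure (W l)) by apply: closed_openC; exact: closed_closure.
    have : \forall p' \near p, ~ closure (W l) (pr l (g l j p')).
      exact: (cc _ (open_nbhs_nbhs (conj oW nWl))).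
    by apply: filterS => p' np' [_ /np'].
  by apply: filterS2 b3' u => p' h1 h2 l Jl; exact: h2 (h1 _ Jl) Jl.
move=> i /b3 iy; have [Vi di ci Ji] := b5 i iy; split=> //.
  apply/seteqP; split=> l Jl.
    have ly := Ji l Jl; have [Vl _ _ _] := b5 l ly; have [_ e] := b6 i iy l ly.
    by case: Jl => _; rewrite e.
  by have [Vl e] := b6 i iy l (b3 l Jl); case: Jl => _ Wl; split=> //; rewrite e.
by move=> l /b3 ly; have [] := b6 i iy l ly.
Unshelve. all: by end_near. Qed.

Definition model j : set E := [set p | compatible j p /\ W j (pr j p)]^°.
Local Notation Om := model.

Lemma model_open j : open (Om j). Proof. exact: open_interior. Qed.
Lemma modelP j p : Om j p -> compatible j p /\ W j (pr j p).
Proof. exact: interior_subset. Qed.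
Lemma model_near j p : Om j p -> \forall p' \near p, Om j p'.
Proof. by move=> h; apply: open_nbhs_nbhs; split=> //; exact: model_open. Qed.

Lemma emb_model j y : W j y -> Om j (s j y).
Proof. exact: compatible_near. Qed.

Lemma pieces_self j p : Om j p -> J j p j.
Proof.
move=> /modelP[[_ gp _ _ _] Wp]; split; first by apply/W_sub/subset_closure.
by rewrite gp; exact: subset_closure.
Qed.

(** The points of the glued space will be the equivalence classes of points of models,
as sets of pairs. The class of p consists of the images of p in the models of its
pieces. *)
Definition cls j p : set (I * E) := [set x | [/\ Om x.1 x.2, J j p x.1 & x.2 = g x.1 j p]].

Lemma cls_self j p : Om j p -> cls j p (j, p).
Proof. by move=> h; split=> //=; [exact: pieces_self|have [[_ ->]] := modelP h]. Qed.

Lemma cls_eq j p i q : Om j p -> cls j p (i, q) -> cls i q = cls j p.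
Proof.
move=> /modelP[[_ _ _ _ H] _] [/= Oq Ji ->]; have [JE _ e] := H i Ji.
apply/seteqP; split=> -[l r] [/= hl Jl rE].
  by rewrite JE in Jl; split; [exact: hl|exact: Jl|rewrite rE; exact: e].
by split; [exact: hl|rewrite JE; exact: Jl|rewrite rE; exact/esym/e].
Qed.

Lemma cls_inv j p i q : Om j p -> Om i q -> cls i q = cls j p -> J j p i /\ q = g i j p.
Proof.
by move=> hp hq e; have := cls_self hq; rewrite e => -[].
Qed.

Lemma cls_inj j p q : Om j p -> Om j q -> cls j p = cls j q -> p = q.
Proof.
by move=> hp hq /(cls_inv hq hp)[_ ->]; have [[_ ->]] := modelP hq.
Qed.

Lemma pieces_open i q j : Om i q -> J i q j -> Om j (g j i q) ->
  \forall q' \near q, [/\ Om i q', Om j (g j i q') & cls j (g j i q') = cls i q'].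
Proof.
move=> hq Jj hj; have [[cq _ _ _ H] _] := modelP hq; have [_ dj _] := H j Jj.
have n1 := model_near hq.
have n2 : \forall q' \near q, Om j (g j i q').
  have c : g j i @ q --> g j i q := differentiable_continuous dj.
  exact: (near_pull c (model_near hj)).
have n3 : \forall q' \near q, V j (pr i q').
  exact: (near_pull (cq : pr i @ q --> pr i q) (near_opens Jj.1)).
near=> q'; have h1 : Om i q' by near: q'.
have h2 : Om j (g j i q') by near: q'.
split=> //; apply: cls_eq => //; split=> //=; split; first by near: q'.
by have [_ Wj] := modelP h2; exact: subset_closure.
Unshelve. all: by end_near. Qed.

Definition glued := {K : set (I * E) | exists j p, Om j p /\ K = cls j p}.
HB.instance Definition _ := gen_eqMixin glued.
HB.instance Definition _ := gen_choiceMixin glued.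
Implicit Types x z : glued.

Definition at_pt x j p := Om j p /\ sval x = cls j p.

Lemma at_ex x : exists j p, at_pt x j p.
Proof. by case: x => K [j [p [h e]]]; exists j, p. Qed.

Lemma at_mk j p : Om j p -> exists x, at_pt x j p.
Proof. by move=> h; unshelve eexists (exist _ (cls j p) _); [exists j, p|]. Qed.

Lemma at_unique j p x z : at_pt x j p -> at_pt z j p -> x = z.
Proof.
case: x z => K hK [K' hK'] [_ /= e] [_ /= e'].
have KK : K' = K by rewrite e e'.
by move: hK'; rewrite KK => hK'; congr exist; exact: Prop_irrelevance.
Qed.

Lemma at_inj x j p q : at_pt x j p -> at_pt x j q -> p = q.
Proof. by move=> [hp ep] [hq eq]; apply: (cls_inj hp hq); rewrite -ep. Qed.

Lemma at_change x i q j p : at_pt x i q -> at_pt x j p -> J i q j /\ p = g j i q.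
Proof. by move=> [hq eq] [hp ep]; apply: cls_inv => //; rewrite -eq -ep. Qed.

Lemma at_near x i q j p : at_pt x i q -> at_pt x j p ->
  \forall q' \near q, forall x', at_pt x' i q' -> at_pt x' j (g j i q').
Proof.
move=> hq hp; have [Jj pE] := at_change hq hp; rewrite pE in hp.
by apply: filterS (pieces_open hq.1 Jj hp.1) => q' [h1 h2 e] x' [_ e']; split; rewrite // e e'.
Qed.

Definition glued_open (S : set glued) := forall x j p, at_pt x j p -> S x ->
  \forall p' \near p, forall x', at_pt x' j p' -> S x'.

Lemma glued_openT : glued_open setT.
Proof. by move=> x j p _ _; apply: near_all. Qed.

Lemma glued_openI : setI_closed glued_open.
Proof.
move=> S T hS hT x j p h [Sx Tx]; apply: filterS2 (hS _ _ _ h Sx) (hT _ _ _ h Tx).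
by move=> p' h1 h2 x' hx'; split; [exact: h1|exact: h2].
Qed.

Lemma glued_open_bigU (T : Type) (f : T -> set glued) :
  (forall t, glued_open (f t)) -> glued_open (\bigcup_t f t).
Proof.
move=> hf x j p h [t _ ftx]; apply: filterS (hf t _ _ _ h ftx) => p' hp' x' hx'.
by exists t => //; exact: hp'.
Qed.

HB.instance Definition _ := isOpenTopological.Build glued
  glued_openT glued_openI glued_open_bigU.

(** One model suffices, as changes of models are defined near each point and
continuous. *)
Lemma near_glued x j p (P : set glued) : at_pt x j p ->
  (\forall z \near x, P z) <-> \forall p' \near p, forall x', at_pt x' j p' -> P x'.
Proof.
move=> h; split=> [[B [gB Bx BP]]|hP].
  by apply: filterS (gB _ _ _ h Bx) => p' hp' x' /hp' /BP.
pose S0 := [set p' | Om j p' /\ forall x', at_pt x' j p' -> P x']^°.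
exists [set x' | exists2 p', S0 p' & at_pt x' j p']; split.
- move=> x1 i q h1 [p' S0p' h1'].
  have near1 := at_near h1 h1'.
  have [[_ _ _ _ H] _] := modelP h1.1; have [Jj pE] := at_change h1 h1'.
  have [_ dj _] := H j Jj.
  have near2 : \forall q' \near q, S0 (g j i q').
    have c : g j i @ q --> g j i q := differentiable_continuous dj.
    rewrite -pE in c; exact: (near_pull c (open_nbhs_nbhs (conj (open_interior _) S0p'))).
  by apply: filterS2 near1 near2 => q' a b x' /a; exists (g j i q').
- by exists p => //; apply: filterI => //; exact: model_near h.1.
- by move=> x' [p' /interior_subset[_]]; exact.
Qed.

Definition gcoord j x : E := xget 0 [set p | at_pt x j p].
Definition gpoint x0 j p : glued := xget x0 [set x | at_pt x j p].

Lemma gcoordE x j p : at_pt x j p -> gcoord j x = p.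
Proof.
move=> h; apply: (at_inj (x := x) (j := j)) => //.
by apply: (@xgetPex _ 0 [set p | at_pt x j p]); exists p.
Qed.

Lemma gpointE x0 j p : Om j p -> at_pt (gpoint x0 j p) j p.
Proof. by move=> /at_mk; exact: (@xgetPex _ x0 [set x | at_pt x j p]). Qed.

Program Definition gchart j x0 : chart R glued (m + n) :=
  @Chart R glued (m + n) [set x | exists p, at_pt x j p] (gcoord j) (gpoint x0 j) _ _ _ _ _.
Next Obligation.
move=> j x0; rewrite openE => x [p h]; rewrite /interior.
by apply/(near_glued _ h); apply: near_all => p' x' h'; exists p'.
Qed.
Next Obligation.
move=> j x0; rewrite [X in open X](_ : _ = Om j); first exact: model_open.
apply/seteqP; split=> [_ [x [p h] <-]|p hp]; first by rewrite (gcoordE h); case: h.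
by have [x h] := at_mk hp; exists x; [exists p|exact: gcoordE].
Qed.
Next Obligation.
move=> j x0 x [p h]; rewrite (gcoordE h); apply: at_unique (h).
by apply: gpointE; case: h.
Qed.
Next Obligation.
move=> j x0 x [p h] P; rewrite (gcoordE h) => hP; apply: (near_glued _ h).2.
by apply: filterS hP => p' Pp' x' h'; rewrite /= (gcoordE h').
Qed.
Next Obligation.
move=> j x0 x [p h] P; rewrite (gcoordE h).
have -> : gpoint x0 j p = x by apply: at_unique (h); apply: gpointE; case: h.
move=> /((near_glued _ h).1) hP; have hO := model_near h.1.
by apply: filterS2 hP hO => p' Pp' hp'; apply: Pp'; exact: gpointE.
Qed.

Lemma gchart_transition i j x0 x1 x q : at_pt x i q -> (exists p, at_pt x j p) ->
  J i q j /\ \forall q' \near q, g j i q' = (cmap (gchart j x1) \o cinv (gchart i x0)) q'.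
Proof.
move=> hi [p hj]; have [Jj pE] := at_change hi hj; split=> //.
apply: filterS2 (at_near hi hj) (model_near hi.1) => q' hq' Oq' /=.
by rewrite (gcoordE (hq' _ (gpointE x0 Oq'))).
Qed.

Program Definition glued_space : atlas_space R (m + n) :=
  @AtlasSpace R (m + n) glued [set c | exists j x0, c = gchart j x0] _ _.
Next Obligation.
by move=> x; have [j [p h]] := at_ex x; exists (gchart j x); [exists j, x|exists p].
Qed.
Next Obligation.
move=> _ _ [i [x0 ->]] [j [x1 ->]] x [q hq] dx.
rewrite /= (gcoordE hq); have [Jj e] := gchart_transition x0 x1 hq dx.
apply: near_eq_differentiable e _.
by have [[_ _ _ _ H] _] := modelP hq.1; have [_ dg _] := H j Jj.
Qed.

(** A point in the closure of a closed ball of a model lies in that model, by the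
closedness condition on the pieces. *)
Lemma glued_regular : regular glued_space.
Proof.
move=> x U hU; have [j [p h]] := at_ex x.
have : \forall p' \near p, (forall x', at_pt x' j p' -> U x') /\ Om j p'.
  by apply: filterI; [exact: (near_glued _ h).1 hU|exact: model_near h.1].
move=> /near_nrm_le[r r0 hr].
exists [set x' | exists p', nrm (p' - p) < r /\ at_pt x' j p'].
  rewrite openE => z [p' [pr' hz]]; rewrite /interior; apply/(near_glued _ hz).
  apply/near_nrm; exists (r - nrm (p' - p)) => [|p'' h'' x' hx']; first by rewrite subr_gt0.
  exists p''; split=> //; apply: (le_lt_trans (nrm_tri p'' p' p)).
  by rewrite -ltrBrDr.
split; first by exists p; rewrite subrr nrm0.
move=> z; apply: contraPP => nUz; apply/closurePn.
have [i [q hz]] := at_ex z; apply/(near_glued _ hz).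
have [[_ _ _ us H] _] := modelP hz.1.
have [Jj|nJj] := pselect (J i q j); last first.
  apply: filterS us => q' Jq' x' hx' [p' [_ hp']].
  by apply/nJj/Jq'; have [] := at_change hx' hp'.
have [_ dg _] := H j Jj.
have [le|lt] := lerP (nrm (g j i q - p)) r.
  have [hU' hO'] := hr _ le; case: nUz.
  apply: hU'; split=> //.
  have := cls_eq (p := q) (j := i) (i := j) (q := g j i q) hz.1.
  by rewrite (hz.2) => -> //; split=> //=; case: Jj.
have : \forall q' \near q, r < nrm (g j i q' - p).
  have c : g j i @ q --> g j i q := differentiable_continuous dg.
  have far : \forall w \near g j i q, r < nrm (w - p).
    apply/near_nrm; exists (nrm (g j i q - p) - r) => [|w hw]; first by rewrite subr_gt0.
    by have := nrm_tri (g j i q) w p; rewrite (nrmB (g j i q) w); move: hw; lra.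
  exact: (near_pull c far).
apply: filterS => q' lt' x' hx' [p' [pr' hp']].
by have [_ e] := at_change hx' hp'; move: pr'; rewrite e ltNge (ltW lt').
Qed.

Lemma glued_T1 (x z : glued) : x <> z -> nbhs x (~` [set z]).
Proof.
move=> xz; have [j [p h]] := at_ex x; apply/(near_glued _ h).
have [[p0 h0]|no] := pselect (exists p0, at_pt z j p0); last first.
  by apply: near_all => p' x' h' e; apply: no; exists p'; rewrite -e.
have p0p : p <> p0.
  by move=> e; apply: xz; apply: (at_unique h); rewrite e.
have np : \forall p' \near p, p' <> p0.
  apply: (near_nrm _ _).2; exists (nrm (p - p0)) => [|p' lt e].
    by rewrite nrm_gt0 subr_eq0; apply/eqP.
  by move: lt; rewrite e nrmB ltxx.
apply: filterS np => p' np' x' h' e; apply: np'.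
by have xz' : x' = z := e; rewrite xz' in h'; exact: at_inj h' h0.
Qed.

(** The domains of the charts are a locally finite cover, as the finite set of
pieces of a point does not grow in a neighbourhood. *)
Lemma glued_manifold : complex_manifold glued_space.
Proof.
split; first exact: regular_hausdorff glued_regular glued_T1.
have [b [bo bs]] := @countable_base R (m + n).
apply: (@paracompact_of_bases glued_space I (fun j => [set x | exists p, at_pt x j p])
  (fun j (k : nat) => [set x | exists p, b k p /\ at_pt x j p])).
- exact: glued_regular.
- move=> j; rewrite openE => x [p h]; rewrite /interior.
  by apply/(near_glued _ h); apply: near_all => p' x' h'; exists p'.
- by move=> x; have [j [p h]] := at_ex x; exists j, p.
- move=> x; have [j [p h]] := at_ex x; have [[_ _ fin us _] _] := modelP h.1.
  exists [set x' | exists p', J j p' `<=` J j p /\ at_pt x' j p'].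
    by apply/(near_glued _ h); apply: filterS us => p' us' x' h'; exists p'.
  apply: sub_finite_set fin => i [x' [[q hq] [p' [us' hp']]]].
  by apply: us'; have [] := at_change hp' hq.
- move=> j k; rewrite openE => x [p [bp h]]; rewrite /interior; apply/(near_glued _ h).
  by apply: filterS (open_nbhs_nbhs (conj (bo k) bp)) => p' bp' x' h'; exists p'.
- move=> j x U [p h] /(near_glued _ h) /bs[k [kp kU]]; exists k; split; first by exists p.
  by move=> x' [p' [/kU hp' hx']]; exact: hp'.
Qed.

Definition gemb_index y := sval (cid (W_cover y)).

Lemma gemb_ex y : exists x, at_pt x (gemb_index y) (s (gemb_index y) y).
Proof. by apply: at_mk; apply: emb_model; exact: svalP (cid (W_cover y)). Qed.

Definition gemb y : glued_space := sval (cid (gemb_ex y)).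

Lemma emb_pieces i j y : W i y -> W j y -> cls j (s j y) (i, s i y).
Proof.
move=> Wi Wj; have iy := W_V Wi; have jy := W_V Wj.
split=> /=; [exact: emb_model| |by rewrite g_base].
split; first by rewrite proj_emb; [exact/W_sub/subset_closure|exact: V_dom].
by rewrite g_base // proj_emb; [exact: subset_closure|exact: V_dom].
Qed.

Lemma gembE y i : W i y -> at_pt (gemb y) i (s i y).
Proof.
move=> Wi; have [hj e] := svalP (cid (gemb_ex y)).
have Wj : W (gemb_index y) y := svalP (cid (W_cover y)).
split; first exact: emb_model.
by rewrite /gemb e; apply/esym/cls_eq => //; exact: emb_pieces.
Qed.

Lemma gemb_near y i : W i y -> \forall y' \near y, at_pt (gemb y') i (s i y').
Proof. by move=> /near_opens; apply: filterS => y'; exact: gembE. Qed.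

Lemma gemb_continuous : continuous gemb.
Proof.
move=> y P; have [i Wi] := W_cover y; move/(near_glued _ (gembE Wi)) => hP.
have hP' : \forall y' \near y, forall x', at_pt x' i (s i y') -> P x'.
  exact: (near_pull (memb_continuous (V_dom (W_V Wi))) hP).
by apply: filterS2 hP' (gemb_near Wi) => y' h1 /h1.
Qed.

Lemma emb_cdom y j x0 i : W i y -> cdom (gchart j x0) (gemb y) -> J i (s i y) j.
Proof. by move=> Wi [p hp]; have [] := at_change (gembE Wi) hp. Qed.

Lemma gemb_coord y (c : chart R M m) j x0 i : W i y -> atlas c -> cdom c y ->
  cdom (gchart j x0) (gemb y) ->
  \forall w \near cmap c y, (g j i \o (@inlmx R m n \o (cmap (ch i) \o cinv c))) w =
     (cmap (gchart j x0) \o gemb \o cinv c) w.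
Proof.
move=> Wi ac cy [p hp].
have n1 := memb_continuous (V_dom (W_V Wi)).
have n2 : \forall y' \near y, forall x', at_pt x' i (s i y') -> at_pt x' j (g j i (s i y')).
  exact: (near_pull n1 (at_near (gembE Wi) hp)).
have n3 : \forall y' \near y, s i y' = inlmx n (cmap (ch i) y').
  by apply: filterS (mdom_near (V_dom (W_V Wi))) => y'; exact: L_emb.
have n4 : \forall y' \near y, g j i (inlmx n (cmap (ch i) y')) = gcoord j (gemb y').
  apply: filterS3 n2 n3 (gemb_near Wi) => y' h1 <- /h1 h2.
  by rewrite (gcoordE h2).
exact: near_cinv cy n4.
Qed.

Lemma ch_differentiable y (c : chart R M m) i : W i y -> atlas c -> cdom c y ->
  differentiable (@inlmx R m n \o (cmap (ch i) \o cinv c)) (cmap c y) /\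
  (@inlmx R m n \o (cmap (ch i) \o cinv c)) (cmap c y) = s i y.
Proof.
move=> Wi ac cy; have hi := V_dom (W_V Wi); split; last by rewrite /= cmapK // L_emb.
apply: differentiable_comp; first exact: atlas_compatible (ac) (ch_atlas i) y cy (ch_dom hi).
by apply: linear_differentiable; exact: inlmx_continuous.
Qed.

Lemma gemb_holomorphic : holomorphic gemb.
Proof.
move=> y; split; first exact: gemb_continuous.
move=> c _ ac [j [x0 ->]] cy jy; have [i Wi] := W_cover y.
apply: near_eq_differentiable (gemb_coord Wi ac cy jy) _.
have [d1 e1] := ch_differentiable Wi ac cy; apply: differentiable_comp => //.
rewrite e1; have [[_ _ _ _ H] _] := modelP (emb_model Wi).
by have [] := H j (emb_cdom Wi jy).
Qed.

Lemma gemb_at y i q : at_pt (gemb y) i q -> closure (V i) y /\ q = s i y.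
Proof.
move=> h; have [j Wj] := W_cover y; have jy := W_V Wj.
have [[Vi _] ->] := at_change (gembE Wj) h.
rewrite proj_emb in Vi; last exact: V_dom.
have iy : closure (V i) y by exact: subset_closure.
by split=> //; exact: g_base.
Qed.

Lemma gemb_injective : injective gemb.
Proof.
move=> y y' e; have [i Wi] := W_cover y; have h := gembE Wi.
rewrite e in h; have [iy' e'] := gemb_at h.
by rewrite -(proj_emb (V_dom (W_V Wi))) e' proj_emb //; exact: V_dom.
Qed.

(** Near the image of M, the charts of M can be recovered from those of the glued
space by a change of model and a projection. *)
Lemma gemb_immersion (x : M) (c : chart R M m) (d : chart R glued_space (m + n)) : atlas c -> atlas d -> cdom c x -> cdom d (gemb x) ->
  injective ('d (cmap d \o gemb \o cinv c) (cmap c x)).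
Proof.
move=> ac [j [x0 ->]] cx [p hp]; have [i Wi] := W_cover x.
have hi := V_dom (W_V Wi); have [Ji pE] := at_change hp (gembE Wi).
have [[_ _ _ _ H] _] := modelP hp.1; have [_ dg _] := H i Ji.
pose G q := (cmap c \o cinv (ch i)) (lsubmx (g i j q)).
have gp : gcoord j (gemb x) = p := gcoordE hp.
have n1 : \forall y' \near x, forall x', at_pt x' i (s i y') -> at_pt x' j (g j i (s i y')).
  exact: (near_pull (memb_continuous hi) (at_near (gembE Wi) hp)).
have n2 : \forall y' \near x, G (gcoord j (gemb y')) = cmap c y'.
  apply: filterS3 n1 (gemb_near Wi) (mdom_near hi) => y' h1 h2 h3.
  have h4 := h1 _ h2; have [_ e] := at_change h4 h2.
  rewrite (gcoordE h4) /G -e /= -/(proj i (s i y')) proj_emb //.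
have dG : differentiable G p.
  apply: (@differentiable_comp _ _ _ _ (@lsubmx C 1 m n \o g i j) (cmap c \o cinv (ch i))).
    apply: (@differentiable_comp _ _ _ _ (g i j) (@lsubmx C 1 m n)); first exact: dg.
    by apply: linear_differentiable; exact: lsubmx_continuous.
  rewrite /= -pE L_emb // row_mxKl.
  exact: (atlas_compatible (ch_atlas i) ac (ch_dom hi) cx).
apply: (@diff_injective _ _ _ _ G).
- have [_ dF] := gemb_holomorphic x; apply: dF => //; first by exists j, x0.
  by exists p.
- have -> : (cmap (gchart j x0) \o gemb \o cinv c) (cmap c x) = p by rewrite /= cmapK.
  exact: dG.
- rewrite /=; have := near_cinv cx n2; have := chart_near cx.
  by apply: filterS2 => w [_ wE] /= ->.
Qed.

Lemma gemb_initial (U : set M) : open U -> exists2 V0, open V0 & U = gemb @^-1` V0.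
Proof.
move=> oU; exists [set x | exists i q, at_pt x i q /\ U (pr i q)].
  rewrite openE => x [i [q [h Uq]]]; rewrite /interior; apply/(near_glued _ h).
  have [[cq _ _ _ _] _] := modelP h.1.
  have : \forall q' \near q, U (pr i q').
    exact: (near_pull (cq : pr i @ q --> pr i q) (open_nbhs_nbhs (conj oU Uq))).
  by apply: filterS => q' Uq' x' h'; exists i, q'.
apply/seteqP; split=> [y Uy|y [i [q [h Uq]]]].
  have [i Wi] := W_cover y; exists i, (s i y); split; first exact: gembE.
  by rewrite proj_emb //; exact/V_dom/W_V.
by have [iy e] := gemb_at h; move: Uq; rewrite e proj_emb //; exact: V_dom.
Qed.

(** In the j-th model the image of M is the set of fixed points of the retraction. *)
Lemma gemb_closed : closed (range gemb).
Proof.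
rewrite -openC openE => x nx; rewrite /interior; have [j [p h]] := at_ex x.
have [[cp _ _ _ _] Wp] := modelP h.1.
pose f q := s j (pr j q).
have fp : f p <> p.
  move=> e; apply: nx; exists (pr j p) => //; apply: at_unique (gembE Wp) _.
  by rewrite -/(f p) e.
have cf : f @ p --> f p.
  exact: (continuous_comp cp (memb_continuous (V_dom (W_V Wp)))).
pose e := nrm (f p - p).
have e0 : 0 < e by rewrite nrm_gt0 subr_eq0; exact/eqP.
have n1 : \forall w \near f p, nrm (w - f p) < e / 2.
  by apply/near_nrm; exists (e / 2); [rewrite divr_gt0|].
have n2 : \forall q \near p, nrm (q - p) < e / 2.
  by apply/near_nrm; exists (e / 2); [rewrite divr_gt0|].
have n3 : \forall q \near p, nrm (f q - f p) < e / 2 := near_pull cf n1.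
apply/(near_glued _ h); apply: filterS2 n2 n3 => q l1 l2 x' hx' [y _ yx'].
rewrite -yx' in hx'; have [jy qE] := gemb_at hx'.
have fq : f q = q by rewrite qE /f proj_emb //; exact: V_dom.
have := nrm_tri (f p) q p; rewrite -/e (nrmB (f p) q) -{1}fq.
by move: l1 l2; lra.
Qed.

Lemma gemb_closed_embedding : closed_embedding gemb.
Proof.
split; [exact: gemb_holomorphic|exact: gemb_injective|exact: gemb_immersion|..].
  exact: gemb_initial.
exact: gemb_closed.
Qed.

(** Sections of A have germs on the glued space: those of their representatives in
the models. *)
Definition has_germ (V0 : opens M) (a : A V0) y (u : stalk (structure_sheaf glued_space) (gemb y)) :=
  exists i f, [/\ W i y, rep (L i) y a f & germ_of u (f \o gcoord i)].
Definition ggerm (V0 : opens M) (a : A V0) y := xget 0 (has_germ a (y := y)).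

Lemma ggerm_local (V0 : opens M) (a : A V0) y i f : V0 y -> W i y ->
  (\forall y' \near y, rep (L i) y' a f) ->
  exists (N : opens glued_space) (t : structure_sheaf glued_space N),
    \forall y' \near y, exists Ny : N (gemb y'), has_germ a (germ Ny t).
Proof.
move=> V0y Wi rf; have h := gembE Wi; have hi := V_dom (W_V Wi).
have ca : atlas (gchart i (gemb y) : chart R glued_space _) by exists i, (gemb y).
have cy : cdom (gchart i (gemb y)) (gemb y) by exists (s i y).
have hf : holf f (cmap (gchart i (gemb y)) (gemb y)).
  by rewrite /= (gcoordE h); exact: rep_hol hi (nbhs_singleton rf).
have [N [Ny [t [_ tE]]]] := chart_section ca cy hf.
exists N, t; have n1 : \forall y' \near y, N (gemb y').
  exact: (gemb_continuous (near_opens Ny)).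
apply: filterS3 n1 rf (near_opens Wi) => y' Ny' rf' Wi'; exists Ny', i, f; split=> //.
by exists N, Ny', t; split=> //; apply: filterS (near_opens Ny').
Qed.

Lemma has_germ_change (V0 : opens M) (a : A V0) y (u : stalk (structure_sheaf glued_space) (gemb y)) i :
  V0 y -> W i y -> has_germ a u -> exists2 f, rep (L i) y a f & germ_of u (f \o gcoord i).
Proof.
move=> V0y Wi [j [f [Wj rf uf]]]; exists (f \o g j i).
  by apply: g_ind rf => //; exact: W_V.
have n1 := (near_glued _ (gembE Wi)).2 (filterS _ (at_near (gembE Wi) (gembE Wj))).
have [N [Ny [t [uE tE]]]] := uf; exists N, Ny, t; split=> //.
have n2 : \forall z \near gemb y, gcoord j z = g j i (gcoord i z).
  apply: n1 => q hq x' h'; by rewrite (gcoordE h') (gcoordE (hq _ h')).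
by apply: filterS2 tE n2 => z -> /= ->.
Qed.

Lemma gcoord_near y i (f f' : E -> C) : W i y ->
  (\forall z \near gemb y, (f \o gcoord i) z = (f' \o gcoord i) z) <->
  (\forall w \near s i y, f w = f' w).
Proof.
move=> Wi; have h := gembE Wi; split=> [/((near_glued _ h).1) e|e].
  apply: filterS2 e (model_near h.1) => w e Ow.
  by have := e _ (gpointE (gemb y) Ow); rewrite /= (gcoordE (gpointE _ Ow)).
apply: (near_glued _ h).2; apply: filterS e => w e x' h'.
by rewrite /= (gcoordE h').
Qed.

Lemma has_germ_unique (V0 : opens M) (a : A V0) y u u' : V0 y ->
  has_germ a (y := y) u -> has_germ a u' -> u = u'.
Proof.
move=> V0y [i [f [Wi rf uf]]] /(has_germ_change V0y Wi)[f' rf' uf'].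
apply/(germ_of_eq uf uf').1/gcoord_near => //.
exact: (rep_fun (V_dom (W_V Wi)) rf rf').
Qed.

Lemma ggermP (V0 : opens M) (a : A V0) y : V0 y -> has_germ a (ggerm a y).
Proof.
move=> V0y; have [i Wi] := W_cover y; have [f rf] := rep_ex a (V_dom (W_V Wi)) V0y.
have [N [t /nbhs_singleton[Ny h]]] := ggerm_local V0y Wi rf.
by apply: (@xgetPex _ 0 (has_germ a (y := y))); exists (germ Ny t).
Qed.

Lemma ggermE (V0 : opens M) (a : A V0) y u : V0 y -> has_germ a u -> ggerm a y = u.
Proof. by move=> V0y; apply: has_germ_unique => //; exact: ggermP. Qed.

Lemma ggerm_rep (V0 : opens M) (a : A V0) y i : V0 y -> W i y ->
  exists2 f, rep (L i) y a f & germ_of (ggerm a y) (f \o gcoord i).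
Proof. by move=> V0y Wi; apply: has_germ_change => //; exact: ggermP. Qed.

Lemma glued_thickening : exists T : thickening val glued_space,
  tdom T = opensT M /\ temb T = gemb.
Proof.
unshelve refine (let T := @Thickening R M A val (m + n) glued_space (opensT M) gemb
  (fun V0 a y => ggerm a y) _ _ _ _ _ _ _ _ _ in _).
- by move=> y _; exact: gemb_continuous.
- move=> V0 a b y _ V0y; have [i Wi] := W_cover y; have hi := V_dom (W_V Wi).
  have [f rf uf] := ggerm_rep a V0y Wi; have [f' rf' uf'] := ggerm_rep b V0y Wi.
  apply: ggermE => //; exists i, (fun w => f w + f' w); split=> //; first exact: repD.
  exact: germ_ofD.
- move=> V0 a b y _ V0y; have [i Wi] := W_cover y; have hi := V_dom (W_V Wi).
  have [f rf uf] := ggerm_rep a V0y Wi; have [f' rf' uf'] := ggerm_rep b V0y Wi.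
  apply: ggermE => //; exists i, (fun w => f w * f' w); split=> //; first exact: repM.
  exact: germ_ofM.
- move=> V0 k y _ V0y; have [i Wi] := W_cover y; have hi := V_dom (W_V Wi).
  apply: ggermE => //; exists i, (fun=> k); split=> //; first exact: rep_scal.
  exact: germ_of_scal.
- move=> V0 W0 WV a y _ W0y; have [i Wi] := W_cover y; have hi := V_dom (W_V Wi).
  have [f rf uf] := ggerm_rep a (WV _ W0y) Wi.
  by apply: ggermE => //; exists i, f; split=> //; exact/(rep_res WV a f hi W0y).
- move=> V0 a y _ V0y; have [i Wi] := W_cover y.
  have [f rf] := rep_ex a (V_dom (W_V Wi)) V0y.
  have [N [t h]] := ggerm_local V0y Wi rf; exists N, t.
  by apply: filterS2 h (near_opens V0y) => y' [Ny' h'] V0y'; exists Ny'; exact: ggermE.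
- move=> y _ N Ny t; have [i Wi] := W_cover y; have hi := V_dom (W_V Wi).
  have h := gembE Wi; pose c : chart R glued_space _ := gchart i (gemb y).
  have ca : atlas c by exists i, (gemb y).
  have cy : cdom c (gemb y) by exists (s i y).
  have := holf_section t ca cy Ny; rewrite /= (gcoordE h).
  move=> /(rep_lift hi)[V0 [a [V0y ra]]].
  have oN : open (gemb @^-1` N) by apply: open_comp (opens_open N) => z _; exact: gemb_continuous.
  pose W0 := opensI (opensI V0 (W i)) (Opens oN).
  have W0V : W0 `<=` V0 by move=> ? [[]].
  exists W0; have W0y : W0 y by [].
  exists W0y, (res W0V a) => y' W0y'; split=> //; have [[V0y' Wi'] Ny'] := W0y'.
  exists Ny'; apply: ggermE => //; exists i, (t \o cinv c); split=> //.
    by have [hy' r] := ra _ V0y'; apply/rep_res.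
  exists N, Ny', t; split=> //.
  have cy' : cdom c (gemb y') by exists (s i y'); exact: gembE.
  by apply: filterS (near_cdom cy') => z cz; exact: esym (congr1 t (cmapK cz)).
- move=> V0 a b y _ V0y e; have [i Wi] := W_cover y; have hi := V_dom (W_V Wi).
  have [f rf uf] := ggerm_rep a V0y Wi; have [f' rf' uf'] := ggerm_rep b V0y Wi.
  apply: (rep_inj hi V0y rf); apply: rep_near hi _ rf'.
  by apply/gcoord_near => //; apply/(germ_of_eq uf' uf); rewrite e.
- move=> V0 a y _ V0y; have [i Wi] := W_cover y; have hi := V_dom (W_V Wi).
  have [f rf uf] := ggerm_rep a V0y Wi.
  by rewrite (germ_of_val uf) /= (gcoordE (gembE Wi)) (rep_val hi V0y rf).
by exists T.
Qed.

End GluedSpace.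

(** * Existence of the thickening *)

Section Existence.
Variables (R : realType) (m : nat) (M : atlas_space R m).
Hypothesis mfM : complex_manifold M.
Variables (A : sheaf R M) (n : nat) (pr : sheaf_mor A (structure_sheaf M)).
Local Notation C := (complex_field R).
Let val (V : opens M) (a : A V) (y : M) : C := pr V a y.

(** A chart c of M at x is multiplied by C^n; the rest transports the isomorphism from the
subspace U to M. *)
Lemma local_model_ex (x : M) (U : opens M)
  (alpha : sheaf_mor (sheaf_restr U A) (inverse_image (@zero_section R m n (open_atlas_space U))
     (structure_sheaf (prod_atlas_space n (open_atlas_space U))))) : U x ->
  sheaf_iso alpha ->
  (forall (V : opens (set_type U)) (s : sheaf_restr U A V) (y : set_type U), V y ->
     comorphism (@zero_section_holomorphic R m n (open_atlas_space U)) V (alpha V s) y =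
     pr (image_val V) s (set_val y)) ->
  exists (L : local_model val (m + n)) (c : chart R M m), [/\ atlas c, mdom L x,
    forall y, mdom L y -> cdom c y & forall y, mdom L y -> memb L y = inlmx n (cmap c y)].
Proof.
move=> Ux iso aval; have [c ac cx] := atlas_cover x.
pose x0 : set_type U := exist _ x (mem_set Ux).
pose valU (V : opens (set_type U)) (a : sheaf_restr U A V) (y : set_type U) : C :=
  pr (image_val V) a (set_val y).
have zc : continuous (@zero_section R m n (open_atlas_space U)).
  by move=> y; have [] := zero_section_holomorphic n (y : open_atlas_space U).
have [T [Td [Te _]]] := @thickening_of_iso _ _ _ valU _ _ _ alpha zc iso aval.
have val_res (V W : opens M) (WV : W `<=` V) (a : A V) y : W y -> val (res WV a) y = val a y.
  by move=> Wy; rewrite /val mor_res; exact: (sec_resE (P := holomorphic_condition M)).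
have [T' [T'd T'e]] := thickening_of_restriction val_res x0 Td.
have ad : atlas (@prod_chart R m n (open_atlas_space U) (sub_chart c x0) :
    chart R (prod_atlas_space n (open_atlas_space U)) _).
  by exists (sub_chart c x0) => //; exists c, x0.
exists (LocalModel T' ad), c.
have key y : mdom (LocalModel T' ad) y <-> U y /\ cdom c y.
  rewrite /mdom /= T'd T'e Te /=; split=> -[Uy]; rewrite to_subK //.
split=> //; first exact/key.
  by move=> y /key[].
by move=> y /key[Uy cy]; rewrite /memb /= T'e Te /= to_subK.
Qed.

Hypothesis model_ex : forall x : M,
  exists (L : local_model val (m + n)) (c : chart R M m), [/\ atlas c, mdom L x,
    forall y, mdom L y -> cdom c y & forall y, mdom L y -> memb L y = inlmx n (cmap c y)].

(** Transition maps exist near each point and are unique as germs along M, so that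
[glue_germs] applies. *)
Lemma transition_glue (L1 L2 : local_model val (m + n)) (c2 : chart R M m) (Z : set M) :
  atlas c2 -> (forall y, mdom L2 y -> cdom c2 y) ->
  (forall y, mdom L2 y -> memb L2 y = inlmx n (cmap c2 y)) ->
  closed Z -> (forall y, Z y -> mdom L1 y /\ mdom L2 y) ->
  exists g, forall y, Z y -> induces L1 L2 y g.
Proof.
move=> ac dc ec Zc Zm.
have /choice[g hg] : forall y, exists g, Z y -> \forall y' \near y, induces L1 L2 y' g.
  move=> y; have [Zy|nZy] := pselect (Z y); last by exists id.
  by have [h1 h2] := Zm y Zy; have [g _ ig] := transition_ex h1 h2; exists g.
pose r (w : 'rV[C]_(m + n)) : M := cinv c2 (lsubmx w).
have [| |h hE] := @glue_germs M _ _ mfM.2 mfM.1 Z (memb L2) r g Zc _ _ id.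
- move=> y /Zm[_ h2]; rewrite ec //; have cy := dc _ h2.
  have c : r @ inlmx n (cmap c2 y) --> r (inlmx n (cmap c2 y)).
    apply: continuous_comp; first exact: lsubmx_continuous.
    by rewrite row_mxKl; exact: cinv_continuous.
  by move: c; rewrite {2}/r row_mxKl cmapK.
- move=> y Zy; have [h1 h2] := Zm y Zy.
  apply: filterS (hg y Zy) => y' i1 Zy'; have [h1' h2'] := Zm y' Zy'.
  exact: induces_unique h1' h2' (nbhs_singleton (hg y' Zy')) i1.
exists h => y Zy; have [h1 h2] := Zm y Zy.
apply: induces_near h2 _ (nbhs_singleton (hg y Zy)).
by apply: filterS (hE y Zy) => w ->.
Qed.

Lemma thickening_ex : exists M' : atlas_space R (m + n), complex_manifold M' /\
  exists (iota : M -> M') (emb : closed_embedding iota)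
    (alpha : sheaf_mor A (inverse_image iota (structure_sheaf M'))),
    sheaf_iso alpha /\
    forall (U : opens M) (s : A U),
      comorphism (ce_holomorphic emb) U (alpha U s) = pr U s.
Proof.
have /choice[L0 /choice[c0 hL]] := model_ex.
have [|I [k [V [W [clV clW cov fin]]]]] := nested_covers mfM.2 mfM.1 (U := fun x => mdom (L0 x)).
  by move=> x; have [_ hx _ _] := hL x; exact: mdom_near.
pose L i := L0 (k i); pose ch i := c0 (k i).
have ch_atlas i : atlas (ch i) by have [] := hL (k i).
have ch_dom i y : mdom (L i) y -> cdom (ch i) y by have [_ _ h _] := hL (k i); exact: h.
have L_emb i y : mdom (L i) y -> memb (L i) y = inlmx n (cmap (ch i) y).
  by have [_ _ _ h] := hL (k i); exact: h.
have /choice[g hg] : forall ij : I * I, exists g, forall y,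
    (closure (V ij.1) `&` closure (V ij.2)) y -> induces (L ij.1) (L ij.2) y g.
  move=> [i j]; apply: (transition_glue (ch_atlas j) (@ch_dom j) (@L_emb j)).
    by apply: closedI; exact: closed_closure.
  by move=> y [/clV ? /clV ?].
have g_ind i j y (hi : closure (V i) y) (hj : closure (V j) y) :
    induces (L i) (L j) y (g (i, j)) := hg (i, j) y (conj hi hj).
have manif := glued_manifold ch clW (fun i j => g (i, j)).
have emb := gemb_closed_embedding clV clW cov fin ch_atlas ch_dom L_emb g_ind.
have [T [Td Te]] := glued_thickening clV clW cov fin ch_dom L_emb g_ind.
rewrite -Te in emb; have [alpha [iso aE]] := iso_of_thickening Td.
eexists; split; first exact: manif.
exists (temb T), emb, alpha; split=> // U s; apply: sec_ext => y Uy.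
rewrite -[LHS]/(eval_germ (alpha U s y)) aE // tgerm_val //.
by rewrite Td.
Qed.

End Existence.

(** * Uniqueness of the thickening *)

Section HolomorphicMaps.
Variable R : realType.

Lemma holomorphic_at_near m n (X : atlas_space R m) (Y : atlas_space R n) (f g : X -> Y) x :
  (\forall z \near x, f z = g z) -> holomorphic_at f x -> holomorphic_at g x.
Proof.
move=> fg [cf df]; have e := nbhs_singleton fg; split.
  have cg : f @ x --> g x by rewrite -e.
  by move=> P Pg; apply: filterS2 fg (near_pull cg Pg) => z fgz; rewrite /= fgz.
move=> c d ac ad cx dx; rewrite -e in dx.
apply: near_eq_differentiable (df c d ac ad cx dx).
by have := near_cinv cx fg; apply: filterS => w /= ->.
Qed.

Lemma holomorphic_at_comp m n p (X : atlas_space R m) (Y : atlas_space R n)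
    (Z : atlas_space R p) (f : X -> Y) (g : Y -> Z) x :
  holomorphic_at f x -> holomorphic_at g (f x) -> holomorphic_at (g \o f) x.
Proof.
move=> [cf df] [cg dg]; split; first exact: continuous_comp.
move=> c e ac ae cx ex; have [d ad dx] := atlas_cover (f x).
apply: (@near_eq_differentiable _ _ _ ((cmap e \o g \o cinv d) \o (cmap d \o f \o cinv c))).
  have : \forall z \near x, cdom d (f z) := near_pull cf (near_cdom dx).
  by move/(near_cinv cx); apply: filterS => w dw; rewrite /= cmapK.
apply: differentiable_comp; first exact: df.
by rewrite /= cmapK //; exact: dg.
Qed.

Lemma holomorphic_at_id m (X : atlas_space R m) (x : X) : holomorphic_at id x.
Proof. by split=> // c d ac ad cx dx; exact: atlas_compatible. Qed.

Lemma holomorphic_in_charts m n (X : atlas_space R m) (Y : atlas_space R n)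
    (c : chart R X m) (d : chart R Y n) (g : 'rV[complex_field R]_m -> 'rV[complex_field R]_n) x :
  atlas c -> atlas d -> cdom c x -> differentiable g (cmap c x) ->
  cdom d (cinv d (g (cmap c x))) -> cmap d (cinv d (g (cmap c x))) = g (cmap c x) ->
  holomorphic_at (cinv d \o g \o cmap c) x.
Proof.
move=> ac ad cx dg dx dE; split.
  apply: continuous_comp; first exact: cmap_continuous.
  apply: continuous_comp; first exact: differentiable_continuous.
  by rewrite -dE; exact: cinv_continuous.
move=> c' d' ac' ad' c'x d'x.
rewrite -[_ \o cinv c']/((cmap d' \o cinv d) \o (g \o (cmap c \o cinv c'))).
have cE : (cmap c \o cinv c') (cmap c' x) = cmap c x by rewrite /= cmapK.
apply: differentiable_comp.
  apply: differentiable_comp; first exact: atlas_compatible.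
  by rewrite cE.
by rewrite -[(g \o _) _]/(g ((cmap c \o cinv c') (cmap c' x))) cE -dE; exact: atlas_compatible.
Qed.

Lemma sub_holomorphic_at m n (X : atlas_space R m) (Y : atlas_space R n) (U : opens X)
    (V : opens Y) (f : open_atlas_space U -> open_atlas_space V) (F : X -> Y) (y : set_type U) :
  (forall z : set_type U, set_val (f z) = F (set_val z)) -> holomorphic_at F (set_val y) ->
  holomorphic_at f y.
Proof.
move=> fF [cF dF]; split.
  have -> : f = to_sub (f y) \o F \o set_val.
    by apply/funext => z; rewrite /= -fF set_valK.
  apply: continuous_comp; first exact: set_val_continuous.
  apply: continuous_comp; first exact: cF.
  by apply: to_sub_continuous; rewrite -fF; exact: set_valP.
move=> _ _ [c [x0 [ac ->]]] [d [x1 [ad ->]]] cy; rewrite /= fF => dy.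
apply: near_eq_differentiable (dF c d ac ad cy dy).
have := near_cinv (cy : cdom c (set_val y)) (near_opens (set_valP y)).
by apply: filterS => w Uw; rewrite /= fF to_subK.
Qed.

End HolomorphicMaps.

Section Comparison.
Variables (R : realType) (m : nat) (M : atlas_space R m) (A : sheaf R M).
Local Notation C := (complex_field R).
Variable val : forall V : opens M, A V -> M -> C.

Lemma germ_of_near d (Y : atlas_space R d) (x : Y) (a : stalk (structure_sheaf Y) x) h h' :
  (\forall z \near x, h z = h' z) -> germ_of a h -> germ_of a h'.
Proof.
move=> hh' [N [Nx [t [-> th]]]]; exists N, Nx, t; split=> //.
by apply: filterS2 th hh' => z -> ->.
Qed.

(** The analogue of [induces] for maps between manifolds. Pulling back germs determines G
near the image of x only if G is continuous there. *)
Definition pulls d1 d2 (Y1 : atlas_space R d1) (Y2 : atlas_space R d2)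
    (T1 : thickening val Y1) (T2 : thickening val Y2) x (G : Y2 -> Y1) :=
  [/\ G (temb T2 x) = temb T1 x, \forall z \near temb T2 x, holomorphic_at G z &
    forall (V : opens M) (a : A V) h, V x ->
      germ_of (tgerm T1 a x) h -> germ_of (tgerm T2 a x) (h \o G)].

Lemma pulls_id d (Y : atlas_space R d) (T : thickening val Y) x : pulls T T x id.
Proof. by split=> //; apply: near_all => z; exact: holomorphic_at_id. Qed.

Lemma pulls_cvg d1 d2 (Y1 : atlas_space R d1) (Y2 : atlas_space R d2)
    (T1 : thickening val Y1) (T2 : thickening val Y2) x G : pulls T1 T2 x G -> G @ temb T2 x --> temb T1 x.
Proof. by move=> [e h _]; have [c _] := nbhs_singleton h; rewrite -e; exact: c. Qed.

Section Pulls.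
Variables (d1 d2 : nat) (Y1 : atlas_space R d1) (Y2 : atlas_space R d2).
Variables (T1 : thickening val Y1) (T2 : thickening val Y2).

Lemma pulls_comp d3 (Y3 : atlas_space R d3) (T3 : thickening val Y3) x G H :
  pulls T1 T2 x G -> pulls T2 T3 x H -> pulls T1 T3 x (G \o H).
Proof.
move=> hG hH; have cH := pulls_cvg hH.
have [eG gG aG] := hG; have [eH gH aH] := hH; split; first by rewrite /= eH.
  have n1 : \forall z \near temb T3 x, holomorphic_at G (H z) := near_pull cH gG.
  by apply: filterS2 gH n1 => z; exact: holomorphic_at_comp.
by move=> V a h Vx ah; exact: aH Vx (aG _ _ _ Vx ah).
Qed.

Lemma pulls_near x G G' : (\forall z \near temb T2 x, G z = G' z) ->
  pulls T1 T2 x G -> pulls T1 T2 x G'.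
Proof.
move=> GG' [e h p]; split; first by rewrite -(nbhs_singleton GG').
  by apply: filterS2 (near_join GG') h => z; exact: holomorphic_at_near.
move=> V a f Vx af; apply: germ_of_near (p V a f Vx af).
by apply: filterS GG' => z /= ->.
Qed.

Hypothesis T1_dom : tdom T1 = opensT M.
Hypothesis T2_dom : tdom T2 = opensT M.

Lemma pulls_unique x G G' : pulls T1 T2 x G -> pulls T1 T2 x G' ->
  \forall z \near temb T2 x, G z = G' z.
Proof.
move=> hG hG'; have [c ac cx] := atlas_cover (temb T1 x).
have hx : mdom (LocalModel T1 ac) x by split=> //=; rewrite T1_dom.
have n1 : \forall z \near temb T2 x, cdom c (G z) := near_pull (pulls_cvg hG) (near_cdom cx).
have n2 : \forall z \near temb T2 x, cdom c (G' z) := near_pull (pulls_cvg hG') (near_cdom cx).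
have n3 : \forall z \near temb T2 x, forall j, cmap c (G z) 0 j = cmap c (G' z) 0 j.
  apply: (@filter_forall _ _ (fun j z => cmap c (G z) 0 j = cmap c (G' z) 0 j)
    (nbhs (temb T2 x))) => j.
  have [V [a [Vx /(_ x Vx)[_ r]]]] := rep_lift hx (holf_coord j (memb (LocalModel T1 ac) x)).
  have [[_ _ p] [_ _ p']] := (hG, hG').
  exact: (germ_of_eq (p _ _ _ Vx r) (p' _ _ _ Vx r)).2 erefl.
apply: filterS3 n1 n2 n3 => z cz cz' e.
have ee : cmap c (G z) = cmap c (G' z) by apply/rowP => j; exact: e.
by rewrite -(cmapK cz) ee cmapK.
Qed.

Lemma pulls_ex (x : M) : exists G, \forall x' \near x, pulls T1 T2 x' G.
Proof.
have [c1 ac1 c1x] := atlas_cover (temb T1 x); have [c2 ac2 c2x] := atlas_cover (temb T2 x).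
pose L1 := LocalModel T1 ac1; pose L2 := LocalModel T2 ac2.
have h1 : mdom L1 x by split=> //=; rewrite T1_dom.
have h2 : mdom L2 x by split=> //=; rewrite T2_dom.
have [g _ ig] := transition_ex h1 h2; exists (cinv c1 \o g \o cmap c2).
apply: filterS3 ig (mdom_near h1) (mdom_near h2) => x' i1 k1 k2.
have [_ c1x'] := k1; have [_ c2x'] := k2.
have e : g (cmap c2 (temb T2 x')) = cmap c1 (temb T1 x') := induces_base k1 k2 i1.
split; first by rewrite /= e cmapK.
- have dg := induces_differentiable k1 k2 i1.
  have cg : g @ cmap c2 (temb T2 x') --> cmap c1 (temb T1 x').
    by rewrite -e; exact: (differentiable_continuous (nbhs_singleton dg)).
  have n1 : \forall w \near cmap c2 (temb T2 x'),
      cdom c1 (cinv c1 (g w)) /\ cmap c1 (cinv c1 (g w)) = g w := near_pull cg (chart_near c1x').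
  apply: filterS3 (near_cmap c2x' dg) (near_cmap c2x' n1) (near_cdom c2x') => z dz [b1 b2] b3.
  exact: holomorphic_in_charts.
move=> V a h Vx' ah; apply: (i1 V a (h \o cinv c1) Vx').
by apply: germ_of_near ah; apply: filterS (near_cdom c1x') => z cz /=; rewrite cmapK.
Qed.

End Pulls.

Section Gluing.
Variables (d1 d2 : nat) (Y1 : atlas_space R d1) (Y2 : atlas_space R d2).
Variables (T1 : thickening val Y1) (T2 : thickening val Y2).
Hypothesis T1_dom : tdom T1 = opensT M.
Hypothesis T2_dom : tdom T2 = opensT M.
Hypothesis Y2_mf : complex_manifold Y2.
Hypothesis T2_emb : closed_embedding (temb T2 : M -> Y2).

(** The germs of the local maps are glued along the closed image of M in Y2, which is
paracompact. *)
Lemma pulls_glue : (Y2 -> Y1) -> exists G, forall x, pulls T1 T2 x G.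
Proof.
move=> G0; have inj := ce_injective T2_emb; have ini := ce_initial T2_emb; have clo := ce_closed T2_emb.
have /choice[G hG] := pulls_ex T1_dom T2_dom.
have /choice[r hr] : forall z, exists G, forall x : M, z = temb T2 x -> \forall x' \near x, pulls T1 T2 x' G.
  move=> z; have [[x zx]|no] := pselect (exists x, z = temb T2 x); last first.
    by exists G0 => x zx; case: no; exists x.
  by exists (G x) => x'; rewrite zx => /inj <-; exact: hG.
have [| |G1 hG1] := @glue_germs Y2 _ _ Y2_mf.2 Y2_mf.1 (range (temb T2)) id id r clo _ _ G0.
- by move=> z _; exact: cvg_id.
- move=> _ [x _ <-]; have h := hr _ x erefl.
  have [P oP PE] := ini _ (open_interior [set x' | pulls T1 T2 x' (r (temb T2 x))]).
  have Px : P (temb T2 x) by rewrite -[P _]/((temb T2 @^-1` P) x) -PE.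
  apply: filterS (open_nbhs_nbhs (conj oP Px)) => z Pz [x' _ x'z]; rewrite -x'z in Pz *.
  have : (temb T2 @^-1` P) x' by []; rewrite -PE => /interior_subset p.
  exact: pulls_unique (nbhs_singleton (hr _ x' erefl)) p.
exists G1 => x; apply: pulls_near (nbhs_singleton (hr _ x erefl)).
by have := hG1 (temb T2 x) (ex_intro2 _ _ x I erefl); apply: filterS => z ->.
Qed.

End Gluing.
End Comparison.

Section UniquenessOfThickening.
Variables (R : realType) (m d1 d2 : nat) (M : atlas_space R m).
Local Notation C := (complex_field R).
Variables (M1 : atlas_space R d1) (M2 : atlas_space R d2).
Variables (iota1 : M -> M1) (iota2 : M -> M2).
Variable phi : sheaf_mor (inverse_image iota1 (structure_sheaf M1))
                         (inverse_image iota2 (structure_sheaf M2)).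

Section Existence.
Hypothesis M1_mf : complex_manifold M1.
Hypothesis M2_mf : complex_manifold M2.
Hypothesis emb1 : closed_embedding iota1.
Hypothesis emb2 : closed_embedding iota2.
Hypothesis phi_iso : sheaf_iso phi.
Hypothesis phi_val : forall (U : opens M) (s : inverse_image iota1 (structure_sheaf M1) U),
  comorphism (ce_holomorphic emb2) U (phi U s) = comorphism (ce_holomorphic emb1) U s.

Local Notation A := (inverse_image iota1 (structure_sheaf M1)).
Let val (V : opens M) (a : A V) (y : M) : C := eval_germ (a y).

(** The maps that are glued in the two directions are inverse to each other near M, as
their composites induce the identity on stalks. The sets N1 and N2 are cut down so
that each of the maps sends one to the other. *)
Lemma inducing_biholomorphism_ex : exists (N1 : opens M1) (N2 : opens M2)
  (g : open_atlas_space N2 -> open_atlas_space N1), inducing_biholomorphism phi g.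
Proof.
(* Glued maps need default values, which exist only if M is not empty. *)
have [[x0 _]|M_empty] := pselect (exists x : M, True); last first.
  have oN1 : open (set0 : set M1) by exact: open0.
  have oN2 : open (set0 : set M2) by exact: open0.
  have no (T : topologicalType) (U : opens T) (y : set_type U) (U0 : forall z, ~ U z) : False.
    exact: (U0 _ (set_valP y)).
  pose g (y : set_type (Opens oN2)) : set_type (Opens oN1) := match no _ _ y (fun=> id) with end.
  exists (Opens oN1), (Opens oN2), g; split.
  - by move=> z [x]; case: M_empty; exists x.
  - by move=> z [x]; case: M_empty; exists x.
  - split; first by move=> y; case: (no _ _ y (fun=> id)).
    exists (fun y : set_type (Opens oN1) => match no _ _ y (fun=> id) with end).
    by split=> y; case: (no _ _ y (fun=> id)).
  - by move=> y; case: (no _ _ y (fun=> id)).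
  - by move=> U s x; case: M_empty; exists x.
have c1 : continuous iota1 by move=> y; have [] := ce_holomorphic emb1 y.
have c2 : continuous iota2 by move=> y; have [] := ce_holomorphic emb2 y.
pose ident : sheaf_mor A A := @SheafMor _ _ A A (fun U => idfun) (fun _ _ => erefl) (fun _ _ _ _ => erefl).
have ident_iso : sheaf_iso ident by exists ident.
have val2 (V : opens M) (a : A V) y : V y -> eval_germ (phi V a y) = val a y.
  by move=> _; exact: (congr1 (fun s : structure_sheaf M V => s y) (phi_val a)).
have [T1 [T1d [T1e T1g]]] := @thickening_of_iso _ _ _ val _ _ _ ident c1 ident_iso (fun _ _ _ _ => erefl).
have [T2 [T2d [T2e T2g]]] := @thickening_of_iso _ _ _ val _ _ _ phi c2 phi_iso val2.
have e1 : closed_embedding (temb T1 : M -> M1) by rewrite T1e.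
have e2 : closed_embedding (temb T2 : M -> M2) by rewrite T2e.
have [G hG] := pulls_glue T1d T2d M2_mf e2 (fun=> iota1 x0).
have [H hH] := pulls_glue T2d T1d M1_mf e1 (fun=> iota2 x0).
have HG x : \forall z \near iota2 x, H (G z) = z.
  by have := pulls_unique T2d (pulls_comp (hH x) (hG x)) (pulls_id T2 x); rewrite T2e.
have GH x : \forall z \near iota1 x, G (H z) = z.
  by have := pulls_unique T1d (pulls_comp (hG x) (hH x)) (pulls_id T1 x); rewrite T1e.
have Gi x : G (iota2 x) = iota1 x by have [+ _ _] := hG x; rewrite T1e T2e.
have Hi x : H (iota1 x) = iota2 x by have [+ _ _] := hH x; rewrite T1e T2e.
pose P2 := [set z | holomorphic_at G z /\ H (G z) = z]^°.
pose P1 := [set z | holomorphic_at H z /\ G (H z) = z]^°.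
have P2i x : P2 (iota2 x).
  by apply: filterI (HG x); have [_ + _] := hG x; rewrite T2e.
have P1i x : P1 (iota1 x).
  by apply: filterI (GH x); have [_ + _] := hH x; rewrite T1e.
have oP2 : open P2 by exact: open_interior.
have oP1 : open P1 by exact: open_interior.
have oN2 : open [set z | P2 z /\ P1 (G z)].
  rewrite openE => z [P2z P1z]; have [[cG _] _] := interior_subset P2z.
  apply: filterI; first exact: open_nbhs_nbhs (conj oP2 P2z).
  exact: cG (open_nbhs_nbhs (conj oP1 P1z)).
have oN1 : open [set z | P1 z /\ P2 (H z)].
  rewrite openE => z [P1z P2z]; have [[cH _] _] := interior_subset P1z.
  apply: filterI; first exact: open_nbhs_nbhs (conj oP1 P1z).
  exact: cH (open_nbhs_nbhs (conj oP2 P2z)).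
pose N2 := Opens oN2; pose N1 := Opens oN1.
have G12 z : N2 z -> N1 (G z).
  by move=> [P2z P1z]; split=> //; have [_ ->] := interior_subset P2z.
have H21 z : N1 z -> N2 (H z).
  by move=> [P1z P2z]; split=> //; have [_ ->] := interior_subset P1z.
pose g (y : open_atlas_space N2) : open_atlas_space N1 :=
  exist _ (G (set_val y)) (mem_set (G12 _ (set_valP y))).
pose h (y : open_atlas_space N1) : open_atlas_space N2 :=
  exist _ (H (set_val y)) (mem_set (H21 _ (set_valP y))).
exists N1, N2, g; split.
- by move=> _ [x _ <-]; split; [exact: P1i|rewrite Hi; exact: P2i].
- by move=> _ [x _ <-]; split; [exact: P2i|rewrite Gi; exact: P1i].
- split.
    move=> y; apply: (@sub_holomorphic_at _ _ _ _ _ _ _ _ G) => //.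
    by have [/interior_subset[]] := set_valP y : N2 (set_val y).
  exists h; split.
  + move=> y; apply: (@sub_holomorphic_at _ _ _ _ _ _ _ _ H) => //.
    by have [/interior_subset[]] := set_valP y : N1 (set_val y).
  + move=> y; apply: val_inj.
    by have [/interior_subset[]] := set_valP y : N2 (set_val y).
  + move=> y; apply: val_inj.
    by have [/interior_subset[]] := set_valP y : N1 (set_val y).
- by move=> y x yx; rewrite -Gi -yx.
move=> U s x Ux V Vx t sx.
have Vx1 : V (temb T1 x) by rewrite T1e.
have st : germ_of (tgerm T1 s x) t.
  by exists V, Vx1, t; split; [exact/(T1g _ s x V Vx1 Vx t)|exact: near_all].
have [_ _ p] := hG x; have [N [Nx [u [su ut]]]] := p U s t Ux st.
have Nx2 : N (iota2 x) by rewrite -T2e.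
have VG : \forall z \near iota2 x, V (G z).
  have cG := pulls_cvg (hG x); rewrite T1e T2e in cG.
  exact: (near_pull cG (near_opens Vx)).
have N2x : N2 (iota2 x) by split; [exact: P2i|rewrite Gi; exact: P1i].
pose W := opensI (opensI N N2) (Opens (open_interior [set z | V (G z) /\ u z = t (G z)])).
have Wx : W (iota2 x).
  split; first by split.
  by apply: filterI VG _; rewrite -T2e.
have WN : W `<=` N by move=> ? [[]].
exists W, Wx, (res WN u); split.
  move=> z Wz; have [[_ N2z] /interior_subset[Vz uz]] := Wz.
  exists (exist _ z (mem_set N2z)); split=> //.
  by rewrite (sec_resE (P := holomorphic_condition M2)).
by rewrite (germ_res Nx2); exact/(T2g _ s x N Nx Nx2 u).
Qed.

End Existence.

(** Such a map is determined near M by the germs of the pulled back coordinates. *)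
Lemma inducing_biholomorphism_unique (N1 N1' : opens M1) (N2 N2' : opens M2)
    (g : open_atlas_space N2 -> open_atlas_space N1)
    (g' : open_atlas_space N2' -> open_atlas_space N1') :
  continuous iota1 -> inducing_biholomorphism phi g -> inducing_biholomorphism phi g' ->
  exists W : opens M2, range iota2 `<=` W /\
    forall z : M2, W z -> exists (y : set_type N2) (y' : set_type N2'),
      [/\ set_val y = z, set_val y' = z & set_val (g y) = set_val (g' y')].
Proof.
move=> ci [_ _ _ _ ig] [_ _ _ _ ig'].
pose P := [set z | exists (y : set_type N2) (y' : set_type N2'),
      [/\ set_val y = z, set_val y' = z & set_val (g y) = set_val (g' y')]].
exists (Opens (open_interior P)); split; last by move=> z /interior_subset.
move=> _ [x _ <-]; rewrite /= /interior /P.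
have [c ac cx] := atlas_cover (iota1 x).
(* The pull-backs of f by g and by g' have the same germ, as both maps induce phi. For
f = 0 it remains that g and g' map points near iota2 x to the domain of c. *)
have pull f : holf f (cmap c (iota1 x)) -> \forall z \near iota2 x,
    exists (y : set_type N2) (y' : set_type N2'), [/\ set_val y = z, set_val y' = z,
      cdom c (set_val (g y)), cdom c (set_val (g' y')) &
      f (cmap c (set_val (g y))) = f (cmap c (set_val (g' y')))].
  move=> hf; have [V [Vx [t [Vc tE]]]] := chart_section ac cx hf.
  have [U [s [UE sE]]] := pull_section ci t.
  have Ux : U x by rewrite /opens_pred UE.
  have [W [Wx [u [uE e]]]] := ig U s x Ux V Vx t (sE x Vx).
  have [W' [Wx' [u' [uE' e']]]] := ig' U s x Ux V Vx t (sE x Vx).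
  have uu' : \forall z \near iota2 x, u z = u' z.
    by apply/(germ_eqP Wx Wx'); rewrite -e.
  apply: filterS3 uu' (near_opens Wx) (near_opens Wx') => z uz /uE[y [yz Vy uy]] /uE'[y' [yz' Vy' uy']].
  exists y, y'; split=> //; [exact: Vc|exact: Vc|].
  by rewrite -!tE // -uy -uy'.
have n0 := pull (fun=> 0) (holf_cst 0 _).
have n1 : \forall z \near iota2 x, forall j, exists (y : set_type N2) (y' : set_type N2'),
    [/\ set_val y = z, set_val y' = z, cdom c (set_val (g y)), cdom c (set_val (g' y')) &
      cmap c (set_val (g y)) 0 j = cmap c (set_val (g' y')) 0 j].
  by apply: filter_forall => j; exact: pull _ (holf_coord j _).
apply: filterS2 n0 n1 => z [y [y' [yz yz' cy cy' _]]] h; exists y, y'; split=> //.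
have e : cmap c (set_val (g y)) = cmap c (set_val (g' y')).
  apply/rowP => j; have [y1 [y1' [y1z y1z' _ _]]] := h j.
  have -> : y1 = y by apply: val_inj; rewrite [LHS]y1z -yz.
  by have -> : y1' = y' by apply: val_inj; rewrite [LHS]y1z' -yz'.
by rewrite -(cmapK cy) e cmapK.
Qed.

End UniquenessOfThickening.

Theorem theorem1 (R : realType) (m : nat) (M : atlas_space R m)
    (mfM : complex_manifold M) (A : sheaf R M) (n : nat)
    (pr : sheaf_mor A (structure_sheaf M))
    (locA : forall x : M, exists U : opens M, U x /\
       let MU := open_atlas_space U in
       exists alpha : sheaf_mor (sheaf_restr U A)
           (inverse_image (@zero_section R m n MU)
              (structure_sheaf (prod_atlas_space n MU))),
         sheaf_iso alpha /\
         forall (V : opens (set_type U)) (s : sheaf_restr U A V) (y : set_type U),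
           V y ->
           comorphism (@zero_section_holomorphic R m n MU) V (alpha V s) y =
           pr (image_val V) s (set_val y)) :
  (exists M' : atlas_space R (m + n), complex_manifold M' /\
   exists (iota : M -> M') (emb : closed_embedding iota)
     (alpha : sheaf_mor A (inverse_image iota (structure_sheaf M'))),
     sheaf_iso alpha /\
     forall (U : opens M) (s : A U),
       comorphism (ce_holomorphic emb) U (alpha U s) = pr U s) /\
  (forall (d1 d2 : nat) (M1 : atlas_space R d1) (M2 : atlas_space R d2),
   complex_manifold M1 -> complex_manifold M2 ->
   forall (iota1 : M -> M1) (iota2 : M -> M2)
     (emb1 : closed_embedding iota1) (emb2 : closed_embedding iota2)
     (phi : sheaf_mor (inverse_image iota1 (structure_sheaf M1))
                      (inverse_image iota2 (structure_sheaf M2))),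
   sheaf_iso phi ->
   (forall (U : opens M) (s : inverse_image iota1 (structure_sheaf M1) U),
      comorphism (ce_holomorphic emb2) U (phi U s) =
      comorphism (ce_holomorphic emb1) U s) ->
   (exists (N1 : opens M1) (N2 : opens M2)
      (g : open_atlas_space N2 -> open_atlas_space N1),
      inducing_biholomorphism phi g) /\
   (forall (N1 N1' : opens M1) (N2 N2' : opens M2)
      (g : open_atlas_space N2 -> open_atlas_space N1)
      (g' : open_atlas_space N2' -> open_atlas_space N1'),
      inducing_biholomorphism phi g -> inducing_biholomorphism phi g' ->
      exists W : opens M2, range iota2 `<=` W /\
        forall z : M2, W z -> exists (y : set_type N2) (y' : set_type N2'),
          [/\ set_val y = z, set_val y' = z & set_val (g y) = set_val (g' y')])).

Proof.
split.
  apply: (thickening_ex (n := n) mfM) => x.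
  have [U [Ux [alpha [iso aval]]]] := locA x.
  exact: local_model_ex Ux iso aval.
move=> d1 d2 M1 M2 mf1 mf2 iota1 iota2 emb1 emb2 phi iso phi_val; split.
  exact (inducing_biholomorphism_ex mf1 mf2 iso phi_val).
move=> N1 N1' N2 N2' g g'; apply: inducing_biholomorphism_unique => x.
by have [] := ce_holomorphic emb1 x.
Qed.
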